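(* Consider the adaptive data-collection setting, scores, chronological split, pilot direction $w_n$, variance estimators and statistic $T_n(w_n)$ defined in the context. Assume: (1) (Ignorability, positivity) For each $b\in\{a,a'\}$ and $t\ge 1$: $Y_t=Y_t(b)$ on $\{A_t=b\}$; $Y_t(b)\perp A_t\mid (X_t,\mathcal F_{t-1})$; and $\pi_t(b\mid X_t)>0$ almost surely. (2) (Kernel) $k_{\mathcal Y}$ is characteristic and $\sup_{y\in\mathcal Y}k_{\mathcal Y}(y,y)\le\kappa<\infty$. (3) (Nuisance envelope) There is $B_\mu<\infty$ with $\sup_{r\in\{1,2\}}\sup_{t\ge 1}\sup_{b\in\mathcal A,x\in\mathcal X}\|\widehat\mu^{(r)}_{t-1}(b,x)\|_{\mathcal H_{\mathcal Y}}\le B_\mu$ a.s. (4) (Nuisance stabilization) There exist $\mu_\infty:\mathcal A\times\mathcal X\to\mathcal H_{\mathcal Y}$ and $\beta>0$ with $\|\widehat\mu^{(2)}_{t-1}-\mu_\infty\|_{L_2(P_X\times\mu_{\mathcal A};\mathcal H_{\mathcal Y})}=O(t^{-\beta})$ a.s. (5) (Policy class) There exist a reference policy $\pi_{\mathrm{ref}}$ and constants $G<\infty$, $p>0$ such that, with $\mathcal G_{\mathrm{ref}}=\{\pi/\pi_{\mathrm{ref}}:\pi\in\Pi\}$, $\sup_{g\in\mathcal G_{\mathrm{ref}}}\|g\|_\infty\le G$ and $\log N_{[]}(\varepsilon,\mathcal G_{\mathrm{ref}},\|\cdot\|_{2,\mathrm{ref}})\lesssim\varepsilon^{-p}$. (6)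 (Exploration floor) There exist $c_\pi>0$ and $\alpha\in[0,1)$ with $\alpha<\min\{\frac1{3+p},\frac1{1+2p},\beta\}$ such that $\pi_t(b\mid x)\ge c_\pi t^{-\alpha}$ for every $t\ge1$, every $b\in\mathcal A$ and $P_X$-almost every $x$. (7) (Negligible clipping) $\frac1n\sum_{t\in\mathcal I_2}\mathbf 1\{\sigma_{0,t}(w_n)\le 2\epsilon_n\}\to 0$ in probability, where $\epsilon_n=n^{-\rho}$ with $0<\rho<\min\{\frac{1-3\alpha}{4},\frac{\nu(\alpha,\beta,p)}{2}\}$ and $\nu(\alpha,\beta,p)>0$ is the rate constant described in the context. Then $T_n(w_n)$ converges in distribution to $\mathcal N(0,1)$ under $H_0:\eta(a)=\eta(a')$. Consequently, for $\gamma\in(0,1)$, the rejection rule $\phi_n=\mathbf 1\{T_n(w_n)>z_{1-\gamma}\}$, with $z_{1-\gamma}$ the $(1-\gamma)$-quantile of $\mathcal N(0,1)$, has asymptotic level $\gamma$, that is, $\limsup_{n\to\infty}\mathbb P(\phi_n=1)\le\gamma$ under $H_0$.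
   Context: **Adaptive data.** $P_X$ is a distribution on $\mathcal X$; $\mathcal A$ is a discrete action set with base measure $\mu_{\mathcal A}$ (counting measure, so policy densities are action probabilities); $P_{Y\mid X,A}$ is a fixed conditional distribution on $\mathcal Y$; $\Pi$ is a class of policies (conditional densities on $\mathcal A$ given $x\in\mathcal X$). With $\mathcal F_{t-1}=\sigma(X_1,A_1,Y_1,\dots,X_{t-1},A_{t-1},Y_{t-1})$, at each round $t$: $X_t\sim P_X$ independently of the past; $A_t\sim\pi_t(\cdot\mid X_t)$ given $(\mathcal F_{t-1},X_t)$, where $\pi_t\in\Pi$ may depend on $\mathcal F_{t-1}$; then $Y_t\sim P_{Y\mid X,A}(\cdot\mid X_t,A_t)$, depending only on the current context and action. Potential outcomes $Y_t(b)$, $b\in\mathcal A$, satisfy $Y_t=Y_t(A_t)$. Target actions $a,a'\in\mathcal A$ are fixed. **Embeddings.** $k_{\mathcal Y}$ is a kernel on $\mathcal Y$ with RKHS $\mathcal H_{\mathcal Y}$ and feature map $\phi_{\mathcal Y}(y)=k_{\mathcal Y}(\cdot,y)$; characteristic means that the mean embedding of probability measures is injective. $\mu_{Y\mid A,X}(b,x)=\mathbb E[\phi_{\mathcal Y}(Y)\mid A=b,X=x]$. The interventional mean embedding is $\eta(b)=\mathbb E[\phi_{\mathcal Y}(Y(b))]$, with expectation over $X\sim P_X$ and the outcome law $P_{Y\mid X,A}(\cdot\mid X,b)$, so $\eta(b)=\mathbb E_{P_X}[\mu_{Y\mid A,X}(b,X)]$; $\Psi(a,a')=\eta(a)-\eta(a')$.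 **Scores.** For a policy $\pi$ and $\bar\mu:\mathcal A\times\mathcal X\to\mathcal H_{\mathcal Y}$, $$D'(\pi,\bar\mu,b)(X,A,Y)=\frac{\mathbf 1\{A=b\}}{\pi(b\mid X)}(\phi_{\mathcal Y}(Y)-\bar\mu(b,X))+\bar\mu(b,X).$$ $T=2n$, $\mathcal I_1=\{1,\dots,n\}$, $\mathcal I_2=\{n+1,\dots,2n\}$. For $r\in\{1,2\}$, $t\in\mathcal I_r$, $\widehat\mu^{(r)}_{t-1}$ is an $\mathcal F_{t-1}$-measurable estimator of $\mu_{Y\mid A,X}$, and $$\hat\phi^{(r)}_t=D'(\pi_t,\widehat\mu^{(r)}_{t-1},a)(X_t,A_t,Y_t)-D'(\pi_t,\widehat\mu^{(r)}_{t-1},a')(X_t,A_t,Y_t).$$ Pilot witness $v_n=\frac1n\sum_{t\in\mathcal I_1}\hat\phi^{(1)}_t$; pilot direction $w_n=v_n/\|v_n\|_{\mathcal H_{\mathcal Y}}$ if $v_n\ne0$ and $w_n=u_0$ otherwise, where $u_0$ is a fixed unit vector. For $t\in\mathcal I_2$: $\xi_t(w_n)=\langle w_n,\hat\phi^{(2)}_t\rangle_{\mathcal H_{\mathcal Y}}$ and $\sigma_{0,t}(w_n)=\mathrm{Var}(\xi_t(w_n)\mid\mathcal F_{t-1})^{1/2}$. **Variance estimator.** For $t\in\mathcal I_2$ let $S_t=\{s\in\mathcal I_2:s<t\}$, $m_t=|S_t|$, and for $s\in S_t$ $$\check\xi_{s,t}(w_n)=\big\langle w_n,\,D'(\pi_t,\widehat\mu^{(2)}_{s-1},a)(X_s,A_s,Y_s)-D'(\pi_t,\widehat\mu^{(2)}_{s-1},a')(X_s,A_s,Y_s)\big\rangle_{\mathcal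 H_{\mathcal Y}},\quad w_{s,t}=\frac{\pi_t(A_s\mid X_s)}{\pi_s(A_s\mid X_s)}.$$ For $t\ge n+2$: $\widehat M_{1,t}(w_n)=\frac1{m_t}\sum_{s\in S_t}w_{s,t}\check\xi_{s,t}(w_n)$, $\widehat M_{2,t}(w_n)=\frac1{m_t}\sum_{s\in S_t}w_{s,t}\check\xi_{s,t}(w_n)^2$, $\widehat\sigma_t^2(w_n)=(\widehat M_{2,t}(w_n)-\widehat M_{1,t}(w_n)^2)_+$. For $t=n+1$: $\widehat M_{1,n+1}=0$, $\widehat M_{2,n+1}=1$, $\widehat\sigma^2_{n+1}=1$. Oracle moments: $M_{j,t}(w_n)=\mathbb E[\xi_t(w_n)^j\mid\mathcal F_{t-1}]$, $j=1,2$. With the deterministic clip sequence $\epsilon_n\downarrow0$, $\widetilde\sigma_t(w_n)=\max(\widehat\sigma_t(w_n),\epsilon_n)$. **Statistic.** $T_n(w_n)=\frac1{\sqrt n}\sum_{t\in\mathcal I_2}\widetilde\sigma_t(w_n)^{-1}\xi_t(w_n)$. **Norms.** $\|m\|^2_{L_2(P_X\times\mu_{\mathcal A};\mathcal H_{\mathcal Y})}=\int\!\int\|m(b,x)\|^2_{\mathcal H_{\mathcal Y}}d\mu_{\mathcal A}(b)dP_X(x)$; $\|h\|^2_{2,\mathrm{ref}}=\mathbb E_{X\sim P_X}[\int h(b,X)^2\pi_{\mathrm{ref}}(b\mid X)d\mu_{\mathcal A}(b)]$; $N_{[]}$ is the bracketing number. The reference policy $\pi_{\mathrm{ref}}$ is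 a fixed strictly positive conditional density. **Rate constant.** $\nu(\alpha,\beta,p)>0$ denotes a constant such that, under assumptions (1)-(6) of the claim, each of $\frac1n\sum_{t\in\mathcal I_2}|\widehat M_{1,t}(w_n)-M_{1,t}(w_n)|$, $\frac1n\sum_{t\in\mathcal I_2}|\widehat M_{2,t}(w_n)-M_{2,t}(w_n)|$ and $\frac1n\sum_{t\in\mathcal I_2}|\widehat\sigma_t^2(w_n)-\sigma_{0,t}^2(w_n)|$ is $O_{\mathrm{a.s.}}(n^{-\nu(\alpha,\beta,p)})$ (the paper proves that such a constant exists). $Z_n=O_{\mathrm{a.s.}}(r_n)$ means $\limsup_n|Z_n|/r_n<\infty$ almost surely. *)

(* Defs.v *)
From HB Require Import structures.
From mathcomp Require Import all_boot all_order all_algebra.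
From mathcomp Require Import all_classical all_reals all_analysis.

Set Implicit Arguments.
Unset Strict Implicit.
Unset Printing Implicit Defensive.
Import Order.TTheory GRing.Theory Num.Theory.
Import numFieldNormedType.Exports.

Local Open Scope classical_set_scope.
Local Open Scope ring_scope.

HB.mixin Record CompleteNormedModule_isHilbert (R : realType) (H : Type)
    of CompleteNormedModule R H := {
  inner : H -> H -> R ;
  innerC : forall f g, inner f g = inner g f ;
  innerDZl : forall (c : R) f g h,
    inner (c *: f + g) h = c * inner f h + inner g h ;
  inner_normE : forall f, inner f f = `|f| ^+ 2 }.

#[short(type="hilbertType")]
HB.structure Definition Hilbert (R : realType) :=
  {H of CompleteNormedModule_isHilbert R H & CompleteNormedModule R H}.

(** [H] is the RKHS of [k]: through [ev], an element of [H] is a function on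
    [Y]; [phi] is the canonical feature map. *)
Record is_rkhs (R : realType) (Y : Type) (H : hilbertType R)
    (k : Y -> Y -> R) (ev : H -> Y -> R) (phi : Y -> H) : Prop := {
  rkhs_linear : forall (c : R) f g y,
    ev (c *: f + g) y = c * ev f y + ev g y ;
  rkhs_injective : injective ev ;
  rkhs_feature : forall y y', ev (phi y) y' = k y' y ;
  rkhs_reproducing : forall f y, ev f y = inner f (phi y) }.

(** Bochner measurability with respect to a sigma-algebra [G]. *)
Definition strongly_measurable (T : Type) (R : realType) (H : hilbertType R)
    (G : set (set T)) (f : T -> H) : Prop :=
  (forall U : set H, open U -> G (f @^-1` U)) /\
  exists2 S : set H, countable S & range f `<=` closure S.

(** Expectation of an [H]-valued map: the element of [H] representing
    [h |-> E <f, h>] ([0] if there is none, which cannot happen for a bounded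
    strongly measurable [f] and a probability measure, by Riesz). *)
Definition hilbert_mean d (T : measurableType d) (R : realType)
    (H : hilbertType R) (mu : {measure set T -> \bar R}) (f : T -> H) : H :=
  xget 0 [set m : H | forall h : H,
    mu.-integrable [set: T] (fun x => (inner (f x) h)%:E) /\
    ((inner m h)%:E = \int[mu]_x (inner (f x) h)%:E)%E].

Definition characteristic d (Y : measurableType d) (R : realType)
    (H : hilbertType R) (phi : Y -> H) : Prop :=
  forall Q1 Q2 : probability Y R,
    hilbert_mean Q1 phi = hilbert_mean Q2 phi ->
    forall B, measurable B -> Q1 B = Q2 B.

Definition sigma_of (T : Type) d (U : measurableType d) (f : T -> U) :
    set (set T) :=
  preimage_set_system setT f measurable.

Definition measurable_wrt (T : Type) d (U : measurableType d)
    (G : set (set T)) (f : T -> U) : Prop :=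
  sigma_of f `<=` G.

Definition prod_sigma (T : Type) d (U : measurableType d) (G : set (set T)) :
    set (set (T * U)) :=
  <<s [set E `*` F | E in G & F in @measurable d U] >>.

Section conditional.
Context d (T : measurableType d) (R : realType) (P : probability T R).
Implicit Types (G : set (set T)) (f g : T -> R).

Definition is_condE G f g : Prop :=
  [/\ measurable_wrt G g,
      P.-integrable [set: T] (fun w => (g w)%:E) &
      forall E, G E ->
        (\int[P]_(w in E) (g w)%:E = \int[P]_(w in E) (f w)%:E)%E].

(** A version of E[f | G]; it is unique up to P-a.s. equality. *)
Definition condE G f : T -> R := xget (fun=> 0) [set g | is_condE G f g].

Definition condVar G f : T -> R :=
  condE G (fun w => (f w - condE G f w) ^+ 2).

Definition cond_indep d1 d2 (T1 : measurableType d1) (T2 : measurableType d2)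
    G (U : T -> T1) (V : T -> T2) : Prop :=
  forall B C, measurable B -> measurable C ->
    {ae P, forall w, condE G (\1_(U @^-1` B `&` V @^-1` C)) w =
                     condE G (\1_(U @^-1` B)) w * condE G (\1_(V @^-1` C)) w}.

(** [Z] is extended-real-valued because an L2 norm may be infinite. *)
Definition O_as (Z : nat -> T -> \bar R) (r : nat -> R) : Prop :=
  {ae P, forall w,
    (limn_esup (fun n => `|Z n w| * ((r n)^-1)%:E) < +oo)%E}.

Definition cvg_in_probability (Z : nat -> T -> R) (c : R) : Prop :=
  forall delta : R, 0 < delta ->
    P [set w | delta <= `|Z n w - c|] @[n --> \oo] --> 0%E.

(** Convergence of the distribution functions at every continuity point of
    the limiting one. *)
Definition cvg_in_distribution (Z : nat -> T -> R)
    (Q : probability (measurableTypeR R) R) : Prop :=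
  forall x : R, Q [set x] = 0%E ->
    P [set w | Z n w <= x] @[n --> \oo] --> Q `]-oo, x]%classic.

End conditional.

Definition quantile (R : realType) (Q : probability (measurableTypeR R) R) (q : R) : R :=
  inf [set z : R | (q%:E <= Q `]-oo, z]%classic)%E].

Definition discrete_space d (A : measurableType d) : Prop :=
  countable [set: A] /\ forall B : set A, measurable B.

Section policies.
Context (R : realType) dX (X : measurableType dX) dA (A : measurableType dA).
Variable PX : probability X R.

(** [p b x] is the conditional density at [b] given [x], with respect to the
    counting measure. *)
Definition is_policy (p : A -> X -> R) : Prop :=
  [/\ forall b, measurable_fun [set: X] (p b),
      forall b x, 0 <= p b x &
      forall x, (\int[counting]_b (p b x)%:E = 1)%E].

Definition L2norm (H : hilbertType R) (m : A -> X -> H) : \bar R :=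
  sqrte (\int[PX]_x \int[counting]_b (`|m b x| ^+ 2)%:E)%E.

Definition refnorm (pref h : A -> X -> R) : \bar R :=
  sqrte (\int[PX]_x \int[counting]_b (h b x ^+ 2 * pref b x)%:E)%E.

Definition is_bracket (nrm : (A -> X -> R) -> \bar R) (eps : R)
    (l u : A -> X -> R) : Prop :=
  [/\ forall b, measurable_fun [set: X] (l b) /\ measurable_fun [set: X] (u b),
      (nrm l < +oo)%E, (nrm u < +oo)%E &
      (nrm (fun b x => (u b x - l b x)%R) < eps%:E)%E].

Definition bracketing_number (nrm : (A -> X -> R) -> \bar R) (eps : R)
    (F : set (A -> X -> R)) : \bar R :=
  ereal_inf [set (N%:R)%:E | N in [set N : nat |
    exists l u : 'I_N -> A -> X -> R,
      (forall i, is_bracket nrm eps (l i) (u i)) /\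
      (forall f, F f -> exists i, forall b x, l i b x <= f b x <= u i b x)]].

Definition ref_ratios (Pol : set (A -> X -> R)) (pref : A -> X -> R) :
    set (A -> X -> R) :=
  [set (fun b x => p b x / pref b x) | p in Pol].

End policies.

(** Times are 1-based: the values [ctx 0], [act 0], [out 0], [pol 0] are never
    used. [nuis1 t] and [nuis2 t] are the estimators based on the first [t]
    rounds, so that round [t] uses [nuis1 t.-1] or [nuis2 t.-1]. *)
Record experiment (R : realType) (Omega X A Y : Type) (H : Type) := Experiment {
  ctx : nat -> Omega -> X ;
  act : nat -> Omega -> A ;
  out : nat -> Omega -> Y ;
  pot : nat -> A -> Omega -> Y ;
  pol : nat -> Omega -> A -> X -> R ;
  nuis1 : nat -> Omega -> A -> X -> H ;
  nuis2 : nat -> Omega -> A -> X -> H }.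

Section experiments.
Context (R : realType) d (Omega : measurableType d)
  dX (X : measurableType dX) dA (A : measurableType dA)
  dY (Y : measurableType dY) (H : hilbertType R).
Variable (S : experiment R Omega X A Y H).

Definition hist (t : nat) : set (set Omega) :=
  <<s \bigcup_(s in [set s | (1 <= s <= t)%N])
        (sigma_of (ctx S s) `|` sigma_of (act S s) `|` sigma_of (out S s)) >>.

Definition hist_ctx (t : nat) : set (set Omega) :=
  <<s hist t.-1 `|` sigma_of (ctx S t) >>.

Definition hist_ctx_act (t : nat) : set (set Omega) :=
  <<s hist t.-1 `|` sigma_of (ctx S t) `|` sigma_of (act S t) >>.

Record adaptive_data (P : probability Omega R) (PX : probability X R)
    (PY : R.-pker (X * A)%type ~> Y) (Pol : set (A -> X -> R)) : Prop := {
  data_measurable : forall t, (1 <= t)%N ->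
    [/\ measurable_fun [set: Omega] (ctx S t),
        measurable_fun [set: Omega] (act S t),
        measurable_fun [set: Omega] (out S t) &
        forall b, measurable_fun [set: Omega] (pot S t b)] ;
  data_class : forall p, Pol p -> is_policy p ;
  data_policy : forall t w, (1 <= t)%N -> Pol (pol S t w) ;
  data_policy_adapted : forall t b, (1 <= t)%N ->
    measurable_wrt (@prod_sigma _ _ X (hist t.-1))
      (fun wx => pol S t wx.1 b wx.2) ;
  data_context : forall t B E, (1 <= t)%N -> measurable B -> hist t.-1 E ->
    P (ctx S t @^-1` B `&` E) = (PX B * P E)%E ;
  data_action : forall t b, (1 <= t)%N ->
    is_condE P (hist_ctx t) (\1_(act S t @^-1` [set b]))
      (fun w => pol S t w b (ctx S t w)) ;
  data_outcome : forall t C, (1 <= t)%N -> measurable C ->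
    is_condE P (hist_ctx_act t) (\1_(out S t @^-1` C))
      (fun w => fine (PY (ctx S t w, act S t w) C)) ;
  data_potential : forall t, (1 <= t)%N ->
    {ae P, forall w, out S t w = pot S t (act S t w) w} }.

Definition adapted_nuisance (nuis : nat -> Omega -> A -> X -> H) : Prop :=
  forall t b, strongly_measurable (@prod_sigma _ _ X (hist t))
    (fun wx => nuis t wx.1 b wx.2).

(** mu_{Y|A,X} *)
Definition cond_mean_embedding (PY : R.-pker (X * A)%type ~> Y) (phi : Y -> H)
    (b : A) (x : X) : H :=
  hilbert_mean (PY (x, b)) phi.

Definition interventional_embedding (PX : probability X R)
    (PY : R.-pker (X * A)%type ~> Y) (phi : Y -> H) (b : A) : H :=
  hilbert_mean PX (cond_mean_embedding PY phi b).

Variables (phi : Y -> H) (a a' : A) (u0 : H).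

Definition score (p : A -> X -> R) (mu : A -> X -> H) (b : A)
    (x : X) (c : A) (y : Y) : H :=
  (\1_[set b] c / p b x) *: (phi y - mu b x) + mu b x.

Definition contrast (p : A -> X -> R) (mu : A -> X -> H)
    (x : X) (c : A) (y : Y) : H :=
  score p mu a x c y - score p mu a' x c y.

Definition phihat (nuis : nat -> Omega -> A -> X -> H) (t : nat)
    (w : Omega) : H :=
  contrast (pol S t w) (nuis t.-1 w) (ctx S t w) (act S t w) (out S t w).

Definition pilot_witness (n : nat) (w : Omega) : H :=
  n%:R^-1 *: \sum_(1 <= t < n.+1) phihat (nuis1 S) t w.

Definition pilot_direction (n : nat) (w : Omega) : H :=
  if pilot_witness n w == 0 then u0
  else `|pilot_witness n w|^-1 *: pilot_witness n w.

Definition xi (n t : nat) (w : Omega) : R :=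
  inner (pilot_direction n w) (phihat (nuis2 S) t w).

Definition xi_check (n s t : nat) (w : Omega) : R :=
  inner (pilot_direction n w)
    (contrast (pol S t w) (nuis2 S s.-1 w) (ctx S s w) (act S s w) (out S s w)).

Definition weight (s t : nat) (w : Omega) : R :=
  pol S t w (act S s w) (ctx S s w) / pol S s w (act S s w) (ctx S s w).

(** For n + 1 <= t, the past of [t] in the second half is
    {n + 1, ..., t - 1}, which has t - (n + 1) elements. *)
Definition Mhat1 (n t : nat) (w : Omega) : R :=
  if t == n.+1 then 0 else
  (t - n.+1)%:R^-1 * \sum_(n.+1 <= s < t) weight s t w * xi_check n s t w.

Definition Mhat2 (n t : nat) (w : Omega) : R :=
  if t == n.+1 then 1 else
  (t - n.+1)%:R^-1 * \sum_(n.+1 <= s < t) weight s t w * xi_check n s t w ^+ 2.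

(** Equal to 1 at t = n + 1. *)
Definition sigma2hat (n t : nat) (w : Omega) : R :=
  Num.max (Mhat2 n t w - Mhat1 n t w ^+ 2) 0.

Variable P : probability Omega R.

Definition oracle_moment (j n t : nat) : Omega -> R :=
  condE P (hist t.-1) (fun w => xi n t w ^+ j).

Definition sigma2_0 (n t : nat) : Omega -> R :=
  condVar P (hist t.-1) (xi n t).

Definition sigma_0 (n t : nat) (w : Omega) : R := Num.sqrt (sigma2_0 n t w).

Definition sigma_tilde (eps : nat -> R) (n t : nat) (w : Omega) : R :=
  Num.max (Num.sqrt (sigma2hat n t w)) (eps n).

Definition avg2 (n : nat) (F : nat -> R) : R :=
  n%:R^-1 * \sum_(n.+1 <= t < (2 * n).+1) F t.

Definition statistic (eps : nat -> R) (n : nat) (w : Omega) : R :=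
  (Num.sqrt n%:R)^-1 *
  \sum_(n.+1 <= t < (2 * n).+1) (sigma_tilde eps n t w)^-1 * xi n t w.

(** The property that characterizes the rate constant nu(alpha, beta, p): the
    three averaged errors are O_a.s.(n^(- nu)). *)
Definition has_rate (nu : R) : Prop :=
  let r := fun n : nat => n%:R `^ (- nu) in
  [/\ O_as P (fun n w => (avg2 n (fun t =>
        `|Mhat1 n t w - oracle_moment 1 n t w|))%:E) r,
      O_as P (fun n w => (avg2 n (fun t =>
        `|Mhat2 n t w - oracle_moment 2 n t w|))%:E) r &
      O_as P (fun n w => (avg2 n (fun t =>
        `|sigma2hat n t w - sigma2_0 n t w|))%:E) r].

End experiments.

(* Main.v *)
(* Conditioning first on [(F_{t-1}, X_t, A_t)] and then on [(F_{t-1}, X_t)], inverse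
   propensity weighting makes [E[<w_n, D'(pi_t, m, b)> | F_{t-1}] = <w_n, eta(b)>] for
   every nuisance [m] known at time [t - 1]; so under [H_0] the [xi_t(w_n)] are
   martingale differences. The exploration floor bounds them by [O(n^alpha)], hence
   the studentized terms by [O(n^(alpha + rho - 1/2)) -> 0]. Their conditional
   variances sum to [1] in the limit because
     [|sigma_0^2 / max(sigma^, eps)^2 - 1|
        <= 4 * 1{sigma_0 <= 2 * eps} + |sigma^^2 - sigma_0^2| / eps^2],
   and the two averages vanish by (7) and by the rate [nu]. The martingale central
   limit theorem is proved by Lindeberg's method: the mean of [u(1 - V_k, S_k)], with
   [u(s, x) = P(x + N(0, s) <= a)] and [V_k] the accumulated conditional variance,
   is almost constant in [k] since [u] solves the heat equation. *)
From HB Require Import structures.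
Require Import Defs.
From mathcomp Require Import all_boot all_order all_algebra.
From mathcomp Require Import all_classical all_reals all_analysis.
From mathcomp Require Import measurable_realfun ring lra.

Set Implicit Arguments.
Unset Strict Implicit.
Unset Printing Implicit Defensive.
Import Order.TTheory GRing.Theory Num.Theory.
Import numFieldNormedType.Exports.

Local Open Scope classical_set_scope.
Local Open Scope ring_scope.

(** * Hilbert spaces *)

(** Several obstacles shape the proof. The function [u] is singular at [s = 0], and the argument
    needs [V_k] bounded on every path, whereas its final value is only close to 1 in probability. So
    the array is stopped before [V_k] exceeds [1 + eta], the time argument runs from
    [eta + (1 + eta)] down to no less than [eta], and the indicator is caught between the values of
    [u] for thresholds shifted by [theta]; [eta] is fixed before [n] grows, so the large derivatives
    of [u] near time [eta] do no harm. Conditional moments of the array are expressed by bounded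
    test functions of the past. This form survives multiplication by predictable factors, and a test
    function times [w_n] is again a direction known in the past, so no Hilbert-valued conditional
    expectation is needed. Policies and nuisances are random functions evaluated at a fresh draw;
    disintegration along the kernel of that draw integrates it out with the past frozen. Floor,
    envelope and variance bounds hold almost surely, while test functions and increments must be
    bounded on every path; truncation at levels that are almost surely inactive bridges the gap. *)

Lemma natSinv_lt (R : realType) (e : R) : 0 < e ->
  exists N, forall n, (N <= n)%N -> n.+1%:R^-1 < e.
Proof.
by move=> e0; have [N _ NP] := near_infty_natSinv_lt (PosNum e0); exists N => n /NP.
Qed.

Section hilbert.
Context {R : realType} {H : hilbertType R}.
Implicit Types f g h m : H.

Lemma innerDl f g h : inner (f + g) h = inner f h + inner g h.
Proof. by rewrite -{1}[f]scale1r innerDZl mul1r. Qed.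

Lemma innerZl c f g : inner (c *: f) g = c * inner f g.
Proof.
have i0 h : inner (0 : H) h = 0.
  by have := innerDl 0 0 h; rewrite addr0 => /eqP; rewrite -subr_eq0 opprD addNKr oppr_eq0 => /eqP.
by rewrite -{1}[_ *: _]addr0 innerDZl i0 addr0.
Qed.

Lemma inner0l h : inner (0 : H) h = 0.
Proof. by rewrite -(scale0r (0 : H)) innerZl mul0r. Qed.

Lemma inner0r h : inner h (0 : H) = 0. Proof. by rewrite innerC inner0l. Qed.

Lemma innerNl f g : inner (- f) g = - inner f g.
Proof. by rewrite -scaleN1r innerZl mulN1r. Qed.

Lemma innerBl f g h : inner (f - g) h = inner f h - inner g h.
Proof. by rewrite innerDl innerNl. Qed.

Lemma innerDr f g h : inner f (g + h) = inner f g + inner f h.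
Proof. by rewrite innerC innerDl !(innerC f). Qed.

Lemma innerZr c f g : inner f (c *: g) = c * inner f g.
Proof. by rewrite innerC innerZl innerC. Qed.

Lemma innerBr f g h : inner f (g - h) = inner f g - inner f h.
Proof. by rewrite innerC innerBl !(innerC f). Qed.

Lemma sqr_normD f g : `|f + g| ^+ 2 = `|f| ^+ 2 + 2 * inner f g + `|g| ^+ 2.
Proof.
rewrite -!inner_normE !innerDl !innerDr (innerC g f); ring.
Qed.

Lemma sqr_normB f g : `|f - g| ^+ 2 = `|f| ^+ 2 - 2 * inner f g + `|g| ^+ 2.
Proof.
by rewrite sqr_normD normrN -[inner f (- g)]innerC innerNl innerC mulrN.
Qed.

Lemma cauchy_schwarz f g : `|inner f g| <= `|f| * `|g|.
Proof.
have [->|g0] := eqVneq g 0; first by rewrite inner0r !normr0 mulr0.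
have gp : 0 < `|g| ^+ 2 by rewrite exprn_gt0 // normr_gt0.
rewrite -ler_sqr ?nnegrE ?mulr_ge0 //.
have := sqr_ge0 `|f - (inner f g / `|g| ^+ 2) *: g|.
rewrite sqr_normB innerZr normrZ exprMn real_normK ?num_real // => h.
rewrite exprMn -subr_ge0.
have -> : `|f| ^+ 2 * `|g| ^+ 2 - `|inner f g| ^+ 2 = `|g| ^+ 2 *
 (`|f| ^+ 2 - 2 * (inner f g / `|g| ^+ 2 * inner f g) +
    (inner f g / `|g| ^+ 2) ^+ 2 * `|g| ^+ 2).
  rewrite real_normK ?num_real //; field.
  by rewrite normr_eq0.
by rewrite mulr_ge0 // ltW.
Qed.

Lemma inner_continuous h : continuous (fun f : H => inner f h).
Proof.
move=> f; apply/cvgrPdist_lt => /= e e0.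
have h1 : 0 < `|h| + 1 by rewrite ltr_wpDl.
have eh : 0 < e / (`|h| + 1) by rewrite divr_gt0.
near=> g; rewrite -innerBl.
apply: (le_lt_trans (cauchy_schwarz _ _)).
apply: (@le_lt_trans _ _ (`|f - g| * (`|h| + 1))).
  by rewrite ler_wpM2l // lerDl.
rewrite -ltr_pdivlMr //.
Unshelve. all: by end_near. Qed.

Lemma sqr_norm_midpoint f g :
  `|2^-1 *: (f + g)| ^+ 2 = (`|f| ^+ 2 + `|g| ^+ 2) / 2 - `|f - g| ^+ 2 / 4.
Proof.
by rewrite normrZ exprMn sqr_normB sqr_normD ger0_norm //; field.
Qed.

(* The representing vector minimizes [h |-> |h|^2 - 2 L h]; the parallelogram
   identity makes every minimizing sequence Cauchy. *)
Lemma riesz_representation (L : H -> R) (C : R) :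
  (forall c f g, L (c *: f + g) = c * L f + L g) ->
  (forall h, `|L h| <= C * `|h|) ->
  exists m, forall h, inner m h = L h.
Proof.
move=> Llin Lbd.
have L0 : L 0 = 0.
  by have := Llin 1 0 0; rewrite scaler0 addr0 mul1r => /eqP; rewrite -subr_eq0 opprD addNKr oppr_eq0 => /eqP.
have LZ c f : L (c *: f) = c * L f by rewrite -[_ *: _]addr0 Llin L0 addr0.
have LD f g : L (f + g) = L f + L g by rewrite -{1}[f]scale1r Llin mul1r.
pose J h : R := `|h| ^+ 2 - 2 * L h.
(* From [(|h| - C)^2 >= 0] and [L h <= C * |h|]. *)
have Jlb : lbound (range J) (- C ^+ 2).
  move=> _ [h _ <-]; rewrite /J.
  have := Lbd h; rewrite ler_norml => /andP[_ h1].
  have := sqr_ge0 (`|h| - C); rewrite sqrrB => h2.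
  rewrite -subr_ge0; apply: (le_trans h2); rewrite -subr_ge0.
  have -> : `|h| ^+ 2 - 2 * L h - - C ^+ 2 - (`|h| ^+ 2 - `|h| * C *+ 2 + C ^+ 2)
    = 2 * (C * `|h| - L h) by ring.
  by rewrite mulr_ge0 // subr_ge0.
have hinf : has_inf (range J) by split; [exists (J 0), 0 | exists (- C ^+ 2)].
pose dd := inf (range J).
have Jd h : dd <= J h by apply: ge_inf; [exists (- C ^+ 2) | exists h].
have /choice[u uP] : forall k : nat, exists h, J h < dd + k.+1%:R^-1.
  move=> k; have k0 : 0 < k.+1%:R^-1 :> R by rewrite invr_gt0.
  by have [_ [h _ <-] hk] := inf_adherent k0 hinf; exists h.
have ucau k l : `|u k - u l| ^+ 2 <= 2 * (k.+1%:R^-1 + l.+1%:R^-1).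
  have := Jd (2^-1 *: (u k + u l)); rewrite /J sqr_norm_midpoint LZ LD => h.
  have := uP k; have := uP l; rewrite /J.
  move: (k.+1%:R^-1) (l.+1%:R^-1) => p q; lra.
(* Near-minimality makes the derivative of [J] small: along the line [u k - s *: h] the quadratic
   [J] is least at [s = e / |h|^2], where it has dropped by [e^2 / |h|^2], and it cannot drop by
   more than [1 / (k + 1)]. *)
have uL h k : `|inner (u k) h - L h| ^+ 2 <= `|h| ^+ 2 * k.+1%:R^-1.
  have [->|h0] := eqVneq h 0; first by rewrite inner0r L0 subrr !normr0 expr0n /= mul0r.
  have hp : 0 < `|h| ^+ 2 by rewrite exprn_gt0 // normr_gt0.
  rewrite -ler_pdivrMl // real_normK ?num_real //.
  set e := inner (u k) h - L h.
  have := Jd (u k - (e / `|h| ^+ 2) *: h).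
  rewrite /J sqr_normB innerZr normrZ exprMn real_normK ?num_real //.
  have -> : L (u k - (e / `|h| ^+ 2) *: h) = L (u k) - e / `|h| ^+ 2 * L h.
    by rewrite LD -scaleNr LZ mulNr.
  move=> h1.
  have h2 : (e / `|h| ^+ 2) ^+ 2 * `|h| ^+ 2 = e ^+ 2 / `|h| ^+ 2.
    by field; rewrite normr_eq0.
  have h3 : 2 * (e / `|h| ^+ 2 * inner (u k) h) - 2 * (e / `|h| ^+ 2 * L h)
     = 2 * (e ^+ 2 / `|h| ^+ 2).
    by rewrite -mulrBr -mulrBr -/e; field; rewrite normr_eq0.
  have := uP k; rewrite /J [_^-1 * _]mulrC.
  move: h1 h2 h3; move: k.+1%:R^-1 (e ^+ 2 / `|h| ^+ 2) (e / `|h| ^+ 2) => p q r; lra.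
have ucvg : cvgn u.
  apply/cauchy_cvgP/cauchy_exP => e e0.
  have e2 : 0 < e ^+ 2 / 4 by rewrite divr_gt0 // exprn_gt0.
  have [N NP] := natSinv_lt e2.
  exists (u N); exists N => // n /= Nn.
  rewrite -ball_normE /ball_ /=.
  rewrite -(@ltr_pXn2r _ 2) ?nnegrE ?(ltW e0) //.
  apply: (le_lt_trans (ucau _ _)).
  move: (NP _ Nn) (NP N (leqnn _)); move: n.+1%:R^-1 N.+1%:R^-1 => p q; lra.
exists (lim (u @ \oo)) => h.
have h1 : inner (u k) h @[k --> \oo] --> inner (lim (u @ \oo)) h.
  exact: cvg_comp ucvg (@inner_continuous h _).
have h2 : inner (u k) h @[k --> \oo] --> L h.
  apply/cvgrPdist_lt => e e0.
  have e2 : 0 < e ^+ 2 / (`|h| ^+ 2 + 1) by rewrite divr_gt0 ?exprn_gt0 // ltr_wpDl ?sqr_ge0.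
  have [N NP] := natSinv_lt e2.
  exists N => // n /= Nn.
  rewrite distrC -(@ltr_pXn2r _ 2) ?nnegrE ?(ltW e0) //.
  apply: (le_lt_trans (uL _ _)).
  apply: (@le_lt_trans _ _ ((`|h| ^+ 2 + 1) * n.+1%:R^-1)).
    by rewrite ler_wpM2r // ?invr_ge0 // lerDl.
  have := NP _ Nn; rewrite ltr_pdivlMr; last by rewrite ltr_wpDl ?sqr_ge0.
  by rewrite mulrC.
exact: (cvg_unique _ h1 h2).
Qed.

End hilbert.

(** * Measurability relative to a sigma-algebra and of Hilbert-valued maps *)

Section measurability_wrt.
Context (T : pointedType).
Implicit Types G : set (set T).

(** Gives access to the closure properties of [measurable_fun] for a sub-sigma-algebra, by viewing
    [T] as a measurable space with [G] for its measurable sets. *)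
Lemma measurable_wrtP d (U : measurableType d) G (f : T -> U) :
  sigma_algebra setT G ->
  measurable_wrt G f <-> measurable_fun [set: g_sigma_algebraType G] f.
Proof.
move=> sG; split => [h _ B mB|h E [B mB <-]].
  by apply: sub_sigma_algebra; apply: h; exists B.
by have := h measurableT B mB; rewrite /measurable /= sigma_algebra_id.
Qed.

Lemma measurable_wrtS d (U : measurableType d) G G' (f : T -> U) :
  G `<=` G' -> measurable_wrt G f -> measurable_wrt G' f.
Proof. by move=> GG' h E /h /GG'. Qed.

End measurability_wrt.

Section weakly_measurable.
Context {R : realType} {H : hilbertType R}.

(* By Pettis' theorem this is strong measurability, in a form that is visibly
   stable under linear combinations. *)
Definition weakly_measurable d (T : measurableType d) (f : T -> H) : Prop :=
  (forall h, measurable_fun [set: T] (fun x => inner (f x) h)) /\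
  exists2 S : set H, countable S & range f `<=` closure S.

Lemma strong_weakly_measurable d (T : measurableType d) (f : T -> H) :
  strongly_measurable (@measurable d T) f -> weakly_measurable f.
Proof.
move=> [mf sf]; split => // h.
apply: (measurability _ (RGenOpens.measurableE R)).
move=> _ [_ [a [b ->] <-]]; rewrite setTI.
apply: (mf ((fun x => inner x h) @^-1` `]a, b[)).
apply: open_comp; last exact: interval_open.
by move=> x _; exact: inner_continuous.
Qed.

(** Only an inclusion, since [S] may be empty; indices that code no element of [S] are sent to 0. *)
Lemma countable_sub_range (S : set H) : countable S ->
  exists s : nat -> H, S `<=` range s.
Proof.
move=> /countable_injP[f injf].
exists (fun n => xget 0 [set x | S x /\ f x = n]) => x Sx.
exists (f x) => //; case: xgetP => [y _ [Sy fyx]|/(_ x)[]//].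
exact: injf (mem_set Sy) (mem_set Sx) fyx.
Qed.

(* For [y] in the closure of a set [S], [|y|^2] is the supremum over [s] in [S]
   of [2 <y, s> - |s|^2 = |y|^2 - |y - s|^2]. *)
Lemma measurable_sqr_norm d (T : measurableType d) (f : T -> H) :
  weakly_measurable f -> measurable_fun [set: T] (fun x => `|f x| ^+ 2).
Proof.
move=> [mf [S /countable_sub_range[s Ss] fS]].
apply: (measurability _ (RGenOInfty.measurableE R)) => _ [_ [c ->] <-].
rewrite setTI.
have -> : (fun x => `|f x| ^+ 2) @^-1` `]c, +oo[%classic =
  \bigcup_n [set x | c < 2 * inner (f x) (s n) - `|s n| ^+ 2].
  apply/seteqP; split => [x /=|x [n _] /=]; rewrite in_itv /= andbT.
    rewrite -subr_gt0 => cf.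
    have rp : 0 < Num.sqrt (`|f x| ^+ 2 - c) by rewrite sqrtr_gt0.
    have [y [/Ss[n _ <-]]] := fS _ (ex_intro2 _ _ x I erefl) _ (nbhsx_ballx _ _ rp).
    rewrite -ball_normE /ball_ /= => fs.
    exists n => //=; rewrite -subr_gt0.
    have -> : 2 * inner (f x) (s n) - `|s n| ^+ 2 - c =
      `|f x| ^+ 2 - c - `|f x - s n| ^+ 2 by rewrite sqr_normB; ring.
    by rewrite subr_gt0 -(sqr_sqrtr (ltW cf)) ltr_pXn2r // nnegrE // ltW.
  move=> /lt_le_trans; apply; rewrite -subr_ge0.
  have -> : `|f x| ^+ 2 - (2 * inner (f x) (s n) - `|s n| ^+ 2) =
    `|f x - s n| ^+ 2 by rewrite sqr_normB; ring.
  exact: sqr_ge0.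
apply: bigcupT_measurable => n.
rewrite -[X in measurable X]setTI; apply: measurable_fun_ltr => //.
apply: measurable_funB => //; apply: measurable_funM => //; exact: mf.
Qed.

Lemma weakly_measurable_cst d (T : measurableType d) (h : H) :
  weakly_measurable (fun _ : T => h).
Proof.
split=> [g|]; first exact: measurable_cst.
exists [set h]; first exact: countable1.
by move=> _ [x _ <-]; apply: subset_closure.
Qed.

Lemma weakly_measurableD d (T : measurableType d) (f g : T -> H) :
  weakly_measurable f -> weakly_measurable g ->
  weakly_measurable (fun x => f x + g x).
Proof.
move=> [mf [S cS fS]] [mg [S' cS' gS']]; split=> [h|].
  by under eq_fun do rewrite innerDl; apply: measurable_funD.
exists [set u.1 + u.2 | u in S `*` S'].
  by apply: card_le_trans (card_image_le _ _) _; apply: countableX.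
move=> _ [x _ <-].
have fx : closure S (f x) by apply: fS; exists x.
have gx : closure S' (g x) by apply: gS'; exists x.
move=> B /(add_continuous (f x, g x)) [[B1 B2] /= [n1 n2]] BB.
have [y [Sy By]] := fx _ n1; have [z [Sz Bz]] := gx _ n2.
by exists (y + z); split; [exists (y, z)|apply: (BB (y, z))].
Qed.

Lemma weakly_measurableZ d (T : measurableType d) (c : T -> R) (f : T -> H) :
  measurable_fun [set: T] c ->
  weakly_measurable f -> weakly_measurable (fun x => c x *: f x).
Proof.
move=> mc [mf [S cS fS]]; split=> [h|].
  by under eq_fun do rewrite innerZl; apply: measurable_funM.
(* Real multiples of [S] would not be countable; rational ones are, and are dense among them. *)
exists [set ratr u.1 *: u.2 | u in [set: rat] `*` S].
  by apply: card_le_trans (card_image_le _ _) _; by apply: countableX.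
move=> _ [x _ <-].
have fx : closure S (f x) by apply: fS; exists x.
move=> B /(scale_continuous (c x, f x)) [[B1 B2] /= [n1 n2]] BB.
have [y [Sy By]] := fx _ n2.
have [z [/interior_subset Bz [q _ qz]]] : (B1 : set R)° `&` (ratr @` [set: rat]) !=set0.
  by apply: dense_rat; [exists (c x); exact: n1|exact: open_interior].
rewrite -{}qz in Bz.
by exists (ratr q *: y); split; [exists (q, y)|exact: (BB (ratr q, y))].
Qed.

(** Weak measurability concerns pairings with a fixed vector; polarization reduces two varying maps
    to squared norms. *)
Lemma measurable_inner d (T : measurableType d) (f g : T -> H) :
  weakly_measurable f -> weakly_measurable g ->
  measurable_fun [set: T] (fun x => inner (f x) (g x)).
Proof.
move=> wf wg.
have -> : (fun x => inner (f x) (g x)) =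
  (fun x => 4^-1 * (`|f x + g x| ^+ 2 - `|f x + -1 *: g x| ^+ 2)).
  by apply/funext => x; rewrite scaleN1r sqr_normD sqr_normB; field.
apply: measurable_funM => //; apply: measurable_funB; apply: measurable_sqr_norm.
  exact: weakly_measurableD.
by apply: weakly_measurableD => //; exact: weakly_measurableZ.
Qed.

Lemma weakly_measurableB d (T : measurableType d) (f g : T -> H) :
  weakly_measurable f -> weakly_measurable g ->
  weakly_measurable (fun x => f x - g x).
Proof.
move=> wf wg; under eq_fun do rewrite -scaleN1r.
by apply: weakly_measurableD => //; exact: weakly_measurableZ.
Qed.

Lemma weakly_measurable_sum d (T : measurableType d) I (r : seq I)
    (f : I -> T -> H) : (forall i, weakly_measurable (f i)) ->
  weakly_measurable (fun x => \sum_(i <- r) f i x).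
Proof.
move=> wf; elim: r => [|i r IH].
  by under eq_fun do rewrite big_nil; exact: weakly_measurable_cst.
by under eq_fun do rewrite big_cons; exact: weakly_measurableD.
Qed.

Lemma weakly_measurable_comp d d' (T : measurableType d) (T' : measurableType d')
    (f : T' -> H) (g : T -> T') :
  weakly_measurable f -> measurable_fun [set: T] g ->
  weakly_measurable (f \o g).
Proof.
move=> [mf [S cS fS]] mg; split=> [h|].
  exact: measurableT_comp (mf h) mg.
by exists S => // _ [x _ <-]; apply: fS; exists (g x).
Qed.

End weakly_measurable.

(** * The normal distribution and the heat equation *)

Section mean_value.
Context {R : realType}.
Implicit Types f df : R -> R.

Lemma derive_bound0 f df (C b : R) :
  (forall x : R, `|x| <= `|b| -> is_derive x 1 f (df x)) ->
  (forall x, `|x| <= `|b| -> `|df x| <= C) ->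
  `|f b - f 0| <= C * `|b|.
Proof.
move=> fd dfC.
have cf (i : interval R) : (forall x, x \in i -> `|x| <= `|b|) -> {within [set` i], continuous f}.
  move=> ib; apply: derivable_within_continuous => x /ib xb.
  by have := fd _ xb => -[].
have [b0|b0] := leP 0 b.
  have h x : x \in `[0, b] -> `|x| <= `|b|.
    by rewrite in_itv /= => /andP[x0 xb]; rewrite !ger0_norm.
  have [|c cb ->] := @MVT_segment R f df 0 b b0 _ (cf _ h).
    by move=> x xb; apply/fd/h/subset_itv_oo_cc.
  by rewrite subr0 normrM ler_wpM2r // dfC // h.
have h x : x \in `[b, 0] -> `|x| <= `|b|.
  by rewrite in_itv /= => /andP[x0 xb]; rewrite !ler0_norm ?lerN2 // ltW.
have [|c cb] := @MVT_segment R f df b 0 (ltW b0) _ (cf _ h).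
  by move=> x xb; apply/fd/h/subset_itv_oo_cc.
by rewrite distrC => ->; rewrite sub0r normrM normrN ler_wpM2r // dfC // h.
Qed.

Lemma derive_bound f df (C a b : R) : a <= b ->
  (forall x : R, a <= x <= b -> is_derive x 1 f (df x)) ->
  (forall x, a <= x <= b -> `|df x| <= C) ->
  `|f b - f a| <= C * (b - a).
Proof.
move=> ab fd dfC.
have [||c cab ->] := @MVT_segment R f df a b ab.
- by move=> x /subset_itv_oo_cc xab; apply: fd; rewrite in_itv in xab.
- apply: derivable_within_continuous => x; rewrite in_itv /= => xab.
  by have := fd _ xab => -[].
by rewrite normrM [`|b - a|]ger0_norm ?subr_ge0 // ler_wpM2r ?subr_ge0 // dfC // -in_itv.
Qed.

(** A Lipschitz bound on the second derivative stands in for a third derivative. The remainder [h]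
    has derivative [k], whose own derivative is [f2 (x + t) - f2 x]; two uses of the mean value
    inequality give [C] rather than the sharp [C / 6]. *)
Lemma taylor2_bound f f1 f2 (C x D : R) :
  (forall y : R, is_derive y 1 f (f1 y)) ->
  (forall y : R, is_derive y 1 f1 (f2 y)) ->
  (forall t, `|f2 (x + t) - f2 x| <= C * `|t|) ->
  `|f (x + D) - f x - D * f1 x - D ^+ 2 / 2 * f2 x| <= C * `|D| ^+ 3.
Proof.
move=> d1 d2 lip.
pose h t := f (x + t) - t * f1 x - t ^+ 2 / 2 * f2 x.
pose k t := f1 (x + t) - f1 x - t * f2 x.
have sh (g g' : R -> R) (t : R) : (forall y : R, is_derive y 1 g (g' y)) ->
    is_derive t 1 (fun t => g (x + t)) (g' (x + t)).
  move=> dg.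
  have := @is_derive1_comp R g (fun t => x + t) t _ _ (dg (x + t)) _.
  move=> /(_ 1); rewrite mulr1; apply.
  rewrite (_ : +%R x = shift x); first exact: is_derive_shift.
  by apply/funext => y; rewrite /= addrC.
have hk (t : R) : is_derive t 1 h (k t).
  have := sh _ _ t d1 => H1; rewrite /h /k.
  apply: is_derive_eq.
  by rewrite !scaler0 !add0r ?addr0 /GRing.scale /=; field.
have kk (t : R) : is_derive t 1 k (f2 (x + t) - f2 x).
  have := sh _ _ t d2 => H1; rewrite /k.
  apply: is_derive_eq.
  by rewrite !scaler0 ?addr0 ?subr0 /GRing.scale /=; ring.
have C0 : 0 <= C.
  by have := lip 1; rewrite normr1 mulr1; apply: le_trans.
have kb t : `|k t| <= C * `|t| * `|t|.
  have := @derive_bound0 k _ (C * `|t|) t (fun t _ => kk t).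
  rewrite {2}/k addr0 subrr mul0r subrr subr0; apply => y yt.
  by apply: (le_trans (lip y)); rewrite ler_wpM2l.
have := @derive_bound0 h _ (C * `|D| * `|D|) D (fun t _ => hk t).
rewrite {2}/h addr0 mul0r expr0n /= !mul0r !subr0 /h.
have -> : f (x + D) - f x - D * f1 x - D ^+ 2 / 2 * f2 x =
  f (x + D) - D * f1 x - D ^+ 2 / 2 * f2 x - f x by ring.
rewrite -[C * `|D| ^+ 3]/(C * (`|D| * (`|D| * `|D|))) !mulrA; apply => y yD.
by apply: (le_trans (kb y)); rewrite -!mulrA ler_wpM2l // ler_pM.
Qed.

End mean_value.

Section normal_cdf.
Context {R : realType}.
Local Notation psi := (normal_pdf (0 : R) 1).

Definition normal_cdf (x : R) : R := fine (normal_prob (0 : R) 1 `]-oo, x]).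
Local Notation Phi := normal_cdf.

Lemma normal_cdfE x : normal_prob (0 : R) 1 `]-oo, x] = (Phi x)%:E.
Proof. by rewrite fineK // fin_num_measure. Qed.

Lemma normal_cdf_ge0 x : 0 <= Phi x.
Proof. exact: fine_ge0. Qed.

Lemma normal_cdf_le1 x : Phi x <= 1.
Proof. by rewrite -lee_fin -normal_cdfE probability_le1. Qed.

Lemma normal_cdf_nondecreasing : {homo Phi : x y / x <= y}.
Proof.
move=> x y xy; rewrite -lee_fin -!normal_cdfE le_measure ?inE //.
exact: subitvPr.
Qed.

(** The identity as a random variable under the normal law: its [cdf] is [Phi], so the limits of a
    [cdf] at infinity become available. *)
Let idTR : measurableTypeR R -> R := idfun.

#[local] HB.instance Definition _ :=
  @isMeasurableFun.Build _ _ _ _ idTR (@measurable_id _ _ [set: _]).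

Lemma normal_cdf_tails (e : R) : 0 < e ->
  exists2 M : R, 0 < M & 1 - e <= Phi M /\ Phi (- M) <= e.
Proof.
move=> e0.
pose P : probability (measurableTypeR R) R := normal_prob 0 1.
pose X : {RV P >-> R} := idTR.
have cdfE : fine \o cdf X = Phi by apply/funext.
have /fine_cvgP[_ /cvgrPdist_le/(_ e e0)[M1 [_]]] := cvg_cdfy1 X; rewrite cdfE => h1.
have /fine_cvgP[_ /cvgrPdist_le/(_ e e0)[M2 [_]]] := cvg_cdfNy0 X; rewrite cdfE => h2.
pose M : R := `|M1| + `|M2| + 1.
exists M; first by rewrite ltr_wpDl // addr_ge0.
split.
  have := h1 M; rewrite /= ler_norml => h.
  suff : M1 < M by move=> /h /andP[_]; lra.
  rewrite /M; have := ler_norm M1; have := normr_ge0 M2; lra.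
have := h2 (- M); rewrite /= ler_norml => h.
suff : - M < M2 by move=> /h /andP[+ _]; lra.
rewrite /M; have := ler_norm (- M2); have := normr_ge0 M1; rewrite normrN; lra.
Qed.

Lemma normal_pdf01E x :
  psi x = normal_peak 1 * expR (- (x ^+ 2 / 2)).
Proof.
by rewrite /normal_pdf oner_eq0 /normal_fun subr0 mulNr expr1n.
Qed.

Lemma is_derive_normal_cdf (x : R) : is_derive x 1 Phi (psi x).
Proof.
have ifm : (@lebesgue_measure R).-integrable [set: R] (EFin \o psi).
  exact: integrable_normal_pdf.
have xx : x < x + 1 by rewrite ltrDl.
have [//|||dF F'] := @continuous_FTC1 R psi -oo%O x _ xx.
- exact: integrableS ifm.
- by rewrite ltNyr.
- by apply: continuous_normal_pdf; rewrite oner_neq0.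
by apply: DeriveDef; [exact: dF|rewrite -F' derive1E].
Qed.

Lemma is_derive_normal_pdf (x : R) : is_derive x 1 psi (- (x * psi x)).
Proof.
have -> : psi = (fun x => normal_peak 1 * expR (- (x ^+ 2 / 2))).
  by apply/funext => y; rewrite normal_pdf01E.
have d1 : is_derive x 1 (fun x : R => - (x ^+ 2 / 2)) (- x).
  by apply: is_derive_eq; rewrite ?(scaler0, addr0, add0r) /GRing.scale /=; field.
have d2 := @is_derive1_comp R expR _ x _ _ (is_derive_expR _) d1.
have d3 : is_derive x 1 (fun x => expR (- (x ^+ 2 / 2))) (expR (- (x ^+ 2 / 2)) * - x) by [].
apply: is_derive_eq.
by rewrite ?(scaler0, addr0, add0r) /GRing.scale /=; ring.
Qed.

(** The three functions that occur in [heat2] and in its derivatives in [x] and in [s]. *)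
Lemma normal_pdf_moments_bounded : exists2 K : R, 0 < K &
  forall x, [/\ `|x * psi x| <= K, `|(1 - x ^+ 2) * psi x| <= K &
                `|x * ((1 - x ^+ 2) * psi x)| <= K].
Proof.
pose p : R := normal_peak 1.
have p0 : 0 < p by apply: normal_peak_gt0; rewrite oner_neq0.
(* Each polynomial factor is at most [4 * (1 + x^4)], while [E <= 1] and [x^4 * E <= 16], whence
   [68 = 4 * 1 + 4 * 16]. The bound 16 is the square of [x^2 * exp (- x^2 / 4) <= 4], which follows
   from [1 + y <= exp y] at [y = x^2 / 4]. *)
exists (p * 68); first by rewrite mulr_gt0.
move=> x; rewrite normal_pdf01E -/p.
set E := expR _.
have E0 : 0 < E by exact: expR_gt0.
have E1 : E <= 1.
  by rewrite -expR0 ler_expR oppr_le0 divr_ge0 // sqr_ge0.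
have E2 : x ^+ 4 * E <= 16.
  have -> : E = expR (- (x ^+ 2 / 4)) ^+ 2.
    by rewrite -expRM_natl; congr expR; field.
  rewrite (_ : x ^+ 4 * _ = (x ^+ 2 * expR (- (x ^+ 2 / 4))) ^+ 2); last by ring.
  rewrite (_ : 16 = 4 ^+ 2); last by ring.
  rewrite ler_pXn2r ?nnegrE //; last by rewrite mulr_ge0 ?sqr_ge0 // expR_ge0.
  rewrite expRN ler_pdivrMr ?expR_gt0 //.
  have := expR_ge1Dx (x ^+ 2 / 4); lra.
have bd (q : R) : `|q| <= 4 * (1 + x ^+ 4) -> `|q * (p * E)| <= p * 68.
  move=> qx; rewrite mulrCA normrM ger0_norm ?(ltW p0) // ler_pM2l //.
  rewrite normrM [X in _ * X]ger0_norm ?(ltW E0) //.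
  apply: (@le_trans _ _ (4 * (1 + x ^+ 4) * E)); first by rewrite ler_wpM2r // ltW.
  have -> : 4 * (1 + x ^+ 4) * E = 4 * E + 4 * (x ^+ 4 * E) by ring.
  have -> : 68 = 4 * 1 + 4 * 16 :> R by ring.
  by rewrite lerD // ler_pM2l.
have x4 : x ^+ 4 = `|x| ^+ 4 by rewrite -normrX ger0_norm // exprn_even_ge0.
have x2 : x ^+ 2 = `|x| ^+ 2 by rewrite -normrX ger0_norm // exprn_even_ge0.
have q0 := normr_ge0 x.
have q1 : 0 <= (`|x| ^+ 2 - 1) ^+ 2 := sqr_ge0 _.
have q2 : 0 <= (`|x| - 1) ^+ 2 := sqr_ge0 _.
have q3 : 0 <= (`|x| - `|x| ^+ 2) ^+ 2 := sqr_ge0 _.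
have q4 : `|1 - x ^+ 2| <= 1 + x ^+ 2.
  by rewrite (le_trans (ler_normB _ _)) // normr1 ger0_norm ?sqr_ge0.
split; rewrite ?[x * (_ * (p * E))]mulrA; apply: bd; rewrite x4.
- move: q0 q1 q2 q3; move: `|x| => y q0 q1 q2 q3; nra.
- apply: (le_trans q4); rewrite x2.
  move: q0 q1 q2 q3; move: `|x| => y q0 q1 q2 q3; nra.
- rewrite normrM; apply: (@le_trans _ _ (`|x| * (1 + x ^+ 2))).
    by rewrite ler_wpM2l.
  rewrite x2; move: q0 q1 q2 q3; move: `|x| => y q0 q1 q2 q3; nra.
Qed.
End normal_cdf.

Section heat.
Context {R : realType}.
Variable a : R.
Local Notation psi := (normal_pdf (0 : R) 1).
Local Notation Phi := (@normal_cdf R).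

Let q (s : R) := (Num.sqrt s)^-1.

(* The solution of the backward heat equation with terminal value the
   indicator of [`]-oo, a]]: it is [P (x + N(0, s) <= a)]. *)
Definition heat (s x : R) := Phi ((a - x) * q s).
Definition heat1 (s x : R) := - (q s * psi ((a - x) * q s)).
Definition heat2 (s x : R) := - (q s ^+ 2 * ((a - x) * q s * psi ((a - x) * q s))).

Let is_derive_q (s : R) : 0 < s -> is_derive (s : R) 1 q (- (q s ^+ 3 / 2)).
Proof.
move=> s0.
have d1 := is_derive1_sqrt s0.
have n0 : Num.sqrt s != 0 by rewrite gt_eqF // sqrtr_gt0.
have d2 := is_deriveV n0 d1.
apply: (is_derive_eq d2).
by rewrite /GRing.scale /= /q; field.
Qed.

Let is_derive_zx (s x : R) : is_derive (x : R) 1 (fun x => (a - x) * q s) (- q s).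
Proof.
apply: is_derive_eq.
by rewrite ?(scaler0, addr0, add0r, sub0r) /GRing.scale /=; ring.
Qed.

Let is_derive_zs (s x : R) : 0 < s ->
  is_derive (s : R) 1 (fun s => (a - x) * q s) ((a - x) * - (q s ^+ 3 / 2)).
Proof.
move=> s0; have := is_derive_q s0 => d1.
apply: is_derive_eq.
by rewrite ?(scaler0, addr0, add0r, sub0r).
Qed.

Let comp (f f' g : R -> R) (x dg : R) : (forall y : R, is_derive y 1 f (f' y)) ->
  is_derive x 1 g dg -> is_derive x 1 (fun x => f (g x)) (f' (g x) * dg).
Proof. by move=> df d; exact: (@is_derive1_comp R f g x _ _ (df _) d). Qed.

Lemma is_derive_heat_x (s x : R) : is_derive (x : R) 1 (heat s) (heat1 s x).
Proof.
have := comp is_derive_normal_cdf (is_derive_zx s x).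
by rewrite /heat /heat1 mulrN mulrC.
Qed.

Lemma is_derive_heat1_x (s x : R) : is_derive (x : R) 1 (heat1 s) (heat2 s x).
Proof.
have := comp is_derive_normal_pdf (is_derive_zx s x) => d1.
rewrite /heat1 /heat2; apply: is_derive_eq.
by rewrite ?(scaler0, addr0, add0r, sub0r) /GRing.scale /=; ring.
Qed.

(** The heat equation itself: the time derivative is half of [heat2]. *)
Lemma is_derive_heat_s (s x : R) : 0 < s ->
  is_derive (s : R) 1 (heat^~ x) (heat2 s x / 2).
Proof.
move=> s0; have d1 := comp is_derive_normal_cdf (is_derive_zs x s0).
by apply: (is_derive_eq d1); rewrite /heat2; field.
Qed.

Let g (z : R) := z * psi z.

Let is_derive_g (z : R) : is_derive z 1 g ((1 - z ^+ 2) * psi z).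
Proof.
have := is_derive_normal_pdf z => d1; rewrite /g; apply: is_derive_eq.
by rewrite /GRing.scale /=; ring.
Qed.

Lemma is_derive_heat2_x (s x : R) : is_derive (x : R) 1 (heat2 s)
  (q s ^+ 3 * ((1 - ((a - x) * q s) ^+ 2) * psi ((a - x) * q s))).
Proof.
have := comp is_derive_g (is_derive_zx s x) => d1.
rewrite /heat2; apply: is_derive_eq.
by rewrite ?(scaler0, addr0, add0r, sub0r) /GRing.scale /=; ring.
Qed.

Lemma is_derive_heat2_s (s x : R) : 0 < s -> is_derive (s : R) 1 (heat2^~ x)
  (q s ^+ 4 * (g ((a - x) * q s) +
     (a - x) * q s * ((1 - ((a - x) * q s) ^+ 2) * psi ((a - x) * q s)) / 2)).
Proof.
move=> s0; have := comp is_derive_g (is_derive_zs x s0) => d1.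
have := is_derive_q s0 => d2.
rewrite /heat2; apply: is_derive_eq.
by rewrite ?(scaler0, addr0, add0r, sub0r) /GRing.scale /= /g; field.
Qed.

(** Expand to second order in [x] and to first order in [s], both at [(s, x)]: by the heat equation
    the time increment contributes [v / 2 * heat2], which merges with [D^2 / 2 * heat2]. If [D] has
    conditional mean 0 and variance [v], the displayed terms average to 0 and only the remainder is
    left. *)
Lemma heat_taylor (t : R) : 0 < t -> exists2 L : R, 0 < L & forall s x v D : R,
  t <= s -> 0 <= v ->
  `|heat s (x + D) - heat (s + v) x - D * heat1 s x
    - (D ^+ 2 - v) / 2 * heat2 s x| <= L * (`|D| ^+ 3 + v ^+ 2).
Proof.
move=> t0.
have [K K0 bK] := @normal_pdf_moments_bounded R.
have qt s : t <= s -> 0 <= q s <= q t.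
  move=> ts; have s0 := lt_le_trans t0 ts.
  by rewrite invr_ge0 sqrtr_ge0 lef_pV2 ?posrE ?sqrtr_gt0 // ler_wsqrtr.
have qt0 : 0 < q t by rewrite invr_gt0 sqrtr_gt0.
(* The summands bound the derivatives of [heat2] in [x] and in [s] at all times from [t] on, since
   [q] decreases. *)
pose L : R := q t ^+ 3 * K + q t ^+ 4 * (K + K / 2).
have L0 : 0 < L by rewrite addr_gt0 // mulr_gt0 ?exprn_gt0 // addr_gt0 // divr_gt0.
exists L => // s x v D ts v0.
have hx (y D' : R) : `|heat2 s (y + D') - heat2 s y| <= L * `|D'|.
  have sh (x' : R) : is_derive (x' : R) 1 (fun x' => heat2 s (y + x'))
    (q s ^+ 3 * ((1 - ((a - (y + x')) * q s) ^+ 2) * psi ((a - (y + x')) * q s))).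
    have d1 : is_derive x' 1 (+%R y) 1.
      rewrite (_ : +%R y = shift y); first exact: is_derive_shift.
      by apply/funext => z; rewrite /= addrC.
    by have := comp (is_derive_heat2_x s) d1; rewrite mulr1.
  have := @derive_bound0 R _ _ L D' (fun x' _ => sh x').
  rewrite addr0; apply => x' _.
  have [_ b2 _] := bK ((a - (y + x')) * q s).
  rewrite normrM; apply: (@le_trans _ _ (q t ^+ 3 * K)).
    have /andP[qs0 qst] := qt _ ts.
    by rewrite ler_pM // ger0_norm ?exprn_ge0 // lerXn2r ?nnegrE // ltW.
  by rewrite /L lerDl mulr_ge0 ?exprn_ge0 ?ltW // addr_gt0 // divr_gt0.
have hs (s' : R) : s <= s' -> `|heat2 s' x - heat2 s x| <= L * (s' - s).
  move=> ss'.
  have df (y : R) : s <= y <= s' -> is_derive (y : R) 1 (heat2^~ x)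
    (q y ^+ 4 * (g ((a - x) * q y) +
     (a - x) * q y * ((1 - ((a - x) * q y) ^+ 2) * psi ((a - x) * q y)) / 2)).
    move=> /andP[sy ys'].
    by apply: is_derive_heat2_s; rewrite (lt_le_trans t0) // (le_trans ts).
  have := @derive_bound R (heat2^~ x) _ L s s' ss' df.
  apply => y /andP[sy ys'].
  have [b1 _ b3] := bK ((a - x) * q y).
  rewrite normrM; apply: (@le_trans _ _ (q t ^+ 4 * (K + K / 2))).
    have /andP[qs0 qst] := qt _ (le_trans ts sy).
    rewrite ler_pM //.
      by rewrite ger0_norm ?exprn_ge0 // lerXn2r ?nnegrE // ltW.
    apply: (le_trans (ler_normD _ _)); apply: lerD => //.
    by rewrite normrM [`|2^-1|]ger0_norm // ler_wpM2r.
  by rewrite /L lerDr mulr_ge0 ?exprn_ge0 ?ltW.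
have T1 := taylor2_bound D (is_derive_heat_x s) (is_derive_heat1_x s) (hx x).
(* Mean value inequality for [f] below, whose derivative is half the increment of [heat2] in time;
   the term [0 / 2] is the value of its linear part at [y = s]. *)
have T2 : `|(heat (s + v) x - v / 2 * heat2 s x) - (heat s x - 0 / 2 * heat2 s x)|
     <= L * v * v.
  have vv : s <= s + v by rewrite lerDl.
  pose f y := heat y x - (y - s) / 2 * heat2 s x.
  have df (y : R) : s <= y <= s + v -> is_derive (y : R) 1 f (heat2 y x / 2 - heat2 s x / 2).
    move=> /andP[sy _].
    have := is_derive_heat_s x (lt_le_trans t0 (le_trans ts sy)) => d1.
    rewrite /f; apply: is_derive_eq.
    by rewrite ?(scaler0, addr0, add0r, subr0) /GRing.scale /=; field.
  have := @derive_bound R f _ (L * v) s (s + v) vv df.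
  rewrite /f subrr (addrC s) addrK; apply => y /andP[sy yv].
  rewrite -mulrBl normrM [`|2^-1|]ger0_norm //.
  apply: (@le_trans _ _ (L * v * 1)); last by rewrite mulr1.
  apply: ler_pM => //; last by rewrite invf_le1 // ler1n.
  apply: (le_trans (hs _ sy)); rewrite ler_wpM2l ?(ltW L0) //; lra.
rewrite (_ : _ - _ = (heat s (x + D) - heat s x - D * heat1 s x - D ^+ 2 / 2 * heat2 s x)
  - ((heat (s + v) x - v / 2 * heat2 s x) - (heat s x - 0 / 2 * heat2 s x))); last by field.
apply: (le_trans (ler_normB _ _)); rewrite mulrDr; apply: lerD => //.
by rewrite expr2 mulrA.
Qed.

End heat.

(** * Expectations of bounded measurable functions *)

Section bounded_measurable.
Context {d} {T : measurableType d} {R : realType}.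
Implicit Types (G : set (set T)) (f g : T -> R).

Definition sub_sigma_field G := sigma_algebra setT G /\ G `<=` measurable.

Lemma measurable_wrt_measurable d' (U : measurableType d') (f : T -> U) :
  measurable_wrt measurable f <-> measurable_fun [set: T] f.
Proof.
by split => [h _ B mB|h E [B mB <-]]; [apply: h; exists B|exact: h].
Qed.

Lemma sub_field_measurable_fun d' (U : measurableType d') G (f : T -> U) :
  sub_sigma_field G -> measurable_wrt G f -> measurable_fun [set: T] f.
Proof. by move=> [_ GS] /(measurable_wrtS GS) /measurable_wrt_measurable. Qed.

Lemma measurable_wrt_comp d1 d2 (U : measurableType d1) (V : measurableType d2)
    G (f : T -> U) (h : U -> V) : measurable_fun [set: U] h ->
  measurable_wrt G f -> measurable_wrt G (h \o f).
Proof.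
move=> mh mf _ [B mB <-]; apply: mf; exists (h @^-1` B) => //.
by rewrite -[X in measurable X]setTI; exact: mh.
Qed.

Lemma measurable_wrt_cst G (c : R) : sigma_algebra setT G ->
  measurable_wrt G (fun _ : T => c).
Proof. by move=> sG; apply/measurable_wrtP => //; exact: measurable_cst. Qed.

Lemma measurable_wrtD G f g : sigma_algebra setT G ->
  measurable_wrt G f -> measurable_wrt G g ->
  measurable_wrt G (fun x => f x + g x).
Proof.
move=> sG /(measurable_wrtP _ sG) mf /(measurable_wrtP _ sG) mg.
by apply/measurable_wrtP => //; exact: measurable_funD.
Qed.

Lemma measurable_wrtM G f g : sigma_algebra setT G ->
  measurable_wrt G f -> measurable_wrt G g ->
  measurable_wrt G (fun x => f x * g x).
Proof.
move=> sG /(measurable_wrtP _ sG) mf /(measurable_wrtP _ sG) mg.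
by apply/measurable_wrtP => //; exact: measurable_funM.
Qed.

Lemma measurable_wrt_sum G I (r : seq I) (Q : pred I) (f : I -> T -> R) :
  sigma_algebra setT G ->
  (forall i, Q i -> measurable_wrt G (f i)) ->
  measurable_wrt G (fun x => \sum_(i <- r | Q i) f i x).
Proof.
move=> sG mf; elim: r => [|i r IH].
  by under eq_fun do rewrite big_nil; exact: measurable_wrt_cst.
under eq_fun do rewrite big_cons.
have [Qi|_] := boolP (Q i); last exact: IH.
by apply: measurable_wrtD => //; exact: mf.
Qed.

Lemma measurable_wrt_indic G A : sigma_algebra setT G -> G A ->
  measurable_wrt G (\1_A : T -> R).
Proof.
move=> sG GA; apply/measurable_wrtP => //; apply: measurable_indic.
exact: sub_sigma_algebra.
Qed.

Lemma measurable_wrt_le G f g : sigma_algebra setT G ->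
  measurable_wrt G f -> measurable_wrt G g -> G [set x | f x <= g x].
Proof.
move=> sG /(measurable_wrtP _ sG) mf /(measurable_wrtP _ sG) mg.
have /= := measurable_fun_ler mf mg measurableT (Y := [set true]) I.
by rewrite setTI /measurable /= sigma_algebra_id.
Qed.

(** The class of test functions. The bound holds at every point, so the class is stable under
    products and multiplies integrable functions into integrable ones. *)
Definition bmeas G f := measurable_wrt G f /\ exists C : R, forall x, `|f x| <= C.

Lemma bmeasS G G' f : G `<=` G' -> bmeas G f -> bmeas G' f.
Proof. by move=> GG' [mf ?]; split => //; exact: measurable_wrtS mf. Qed.

Lemma bmeas_cst G (c : R) : sigma_algebra setT G -> bmeas G (fun=> c).
Proof.
by move=> sG; split; [exact: measurable_wrt_cst | exists `|c|].
Qed.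

Lemma bmeasD G f g : sigma_algebra setT G -> bmeas G f -> bmeas G g ->
  bmeas G (fun x => f x + g x).
Proof.
move=> sG [mf [C fC]] [mg [C' gC']]; split; first exact: measurable_wrtD.
by exists (C + C') => x; rewrite (le_trans (ler_normD _ _)) // lerD.
Qed.

Lemma bmeasM G f g : sigma_algebra setT G -> bmeas G f -> bmeas G g ->
  bmeas G (fun x => f x * g x).
Proof.
move=> sG [mf [C fC]] [mg [C' gC']]; split; first exact: measurable_wrtM.
by exists (C * C') => x; rewrite normrM ler_pM.
Qed.

Lemma bmeasN G f : sigma_algebra setT G -> bmeas G f -> bmeas G (fun x => - f x).
Proof.
move=> sG bf; under eq_fun do rewrite -mulN1r.
by apply: bmeasM => //; exact: bmeas_cst.
Qed.

Lemma bmeasB G f g : sigma_algebra setT G -> bmeas G f -> bmeas G g ->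
  bmeas G (fun x => f x - g x).
Proof. by move=> sG bf bg; apply: bmeasD => //; exact: bmeasN. Qed.

Lemma bmeasX G f n : sigma_algebra setT G -> bmeas G f -> bmeas G (fun x => f x ^+ n).
Proof.
move=> sG bf; elim: n => [|n IH]; first exact: bmeas_cst.
by under eq_fun do rewrite exprS; exact: bmeasM.
Qed.

Lemma bmeas_indic G A : sigma_algebra setT G -> G A -> bmeas G (\1_A).
Proof.
move=> sG GA; split; first exact: measurable_wrt_indic.
by exists 1 => x; rewrite indicE ger0_norm // lern1 leq_b1.
Qed.

Lemma bmeas_sum G n (f : nat -> T -> R) : sigma_algebra setT G ->
  (forall i, (i < n)%N -> bmeas G (f i)) -> bmeas G (fun x => \sum_(i < n) f i x).
Proof.
move=> sG; elim: n => [|n IH] bf.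
  by under eq_fun do rewrite big_ord0; exact: bmeas_cst.
under eq_fun do rewrite big_ord_recr /=.
by apply: bmeasD => //; [apply: IH => i /ltnW; exact: bf|exact: bf].
Qed.

Lemma bmeas_norm G f : bmeas G f -> bmeas G (fun x => `|f x|).
Proof.
move=> [mf [C fC]]; split; last by exists C => x; rewrite normr_id.
exact: (measurable_wrt_comp (@normr_measurable R setT) mf).
Qed.

Variable P : probability T R.

Lemma bmeas_integrable f : bmeas measurable f ->
  P.-integrable [set: T] (fun x => (f x)%:E).
Proof.
move=> [/measurable_wrt_measurable mf [C fC]].
apply: (@measurable_bounded_integrable _ _ _ P f _ measurableT) => //.
  by rewrite -ge0_fin_numE // fin_num_measure.
by exists C; split; [exact: num_real|move=> y Cy x _ /=; exact: le_trans (fC x) (ltW Cy)].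
Qed.

Definition Ex f : R := \int[P]_x f x.

Lemma ExE f : bmeas measurable f -> (\int[P]_x (f x)%:E = (Ex f)%:E)%E.
Proof. by move=> bf; rewrite /Ex fineK //; exact/integrable_fin_num/bmeas_integrable. Qed.

Lemma ExD f g : bmeas measurable f -> bmeas measurable g ->
  Ex (fun x => f x + g x) = Ex f + Ex g.
Proof. by move=> bf bg; apply: RintegralD => //; exact: bmeas_integrable. Qed.

Lemma ExB f g : bmeas measurable f -> bmeas measurable g ->
  Ex (fun x => f x - g x) = Ex f - Ex g.
Proof. by move=> bf bg; apply: RintegralB => //; exact: bmeas_integrable. Qed.

Lemma ExZ c f : bmeas measurable f -> Ex (fun x => c * f x) = c * Ex f.
Proof. by move=> bf; apply: RintegralZl => //; exact: bmeas_integrable. Qed.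

Lemma Ex_cst c : Ex (fun=> c) = c.
Proof. rewrite /Ex Rintegral_cst // [X in fine X](_ : _ = 1%E) ?mulr1 //.
exact: probability_setT. Qed.

Lemma le_Ex f g : bmeas measurable f -> bmeas measurable g ->
  (forall x, f x <= g x) -> Ex f <= Ex g.
Proof. by move=> bf bg fg; apply: le_Rintegral => //; exact: bmeas_integrable. Qed.

Lemma Ex_norm f : bmeas measurable f -> `|Ex f| <= Ex (fun x => `|f x|).
Proof. by move=> bf; apply: le_normr_Rintegral => //; exact: bmeas_integrable. Qed.

Lemma Ex_indic A : measurable A -> (Ex (\1_A))%:E = P A.
Proof.
move=> mA; rewrite -ExE; last first.
  by apply: bmeas_indic => //; exact: sigma_algebra_measurable.
by rewrite integral_indic // setIT.
Qed.

Lemma Ex_sum n (f : nat -> T -> R) : (forall i, (i < n)%N -> bmeas measurable (f i)) ->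
  Ex (fun x => \sum_(i < n) f i x) = \sum_(i < n) Ex (f i).
Proof.
elim: n => [|n IH] bf.
  by under eq_fun do rewrite big_ord0; rewrite big_ord0 Ex_cst.
under eq_fun do rewrite big_ord_recr /=; rewrite big_ord_recr /= -IH; last first.
  by move=> i /ltnW; exact: bf.
apply: ExD; last exact: bf.
apply: bmeas_sum => [|i /ltnW]; [exact: sigma_algebra_measurable|exact: bf].
Qed.

Lemma Ex_dist f g c : bmeas measurable f -> bmeas measurable g ->
  (forall x, `|f x - g x| <= c) -> `|Ex f - Ex g| <= c.
Proof.
move=> bf bg fg; have sm := sigma_algebra_measurable T.
have bfg : bmeas measurable (fun x => f x - g x) by exact: bmeasB.
rewrite -ExB //; apply: (le_trans (Ex_norm bfg)); rewrite -(Ex_cst c).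
by apply: le_Ex => //; [exact: bmeas_norm|exact: bmeas_cst].
Qed.

End bounded_measurable.

Section measurable_extra.
Context {R : realType}.

(** [powR] inverts nonnegative numbers, hence the square; at 0 the formula agrees with the
    convention [0^-1 = 0]. *)
Lemma measurable_invr : measurable_fun [set: R] (fun x : R => x^-1).
Proof.
have -> : (fun x : R => x^-1) = (fun x => x * (x ^+ 2) `^ (-1)).
  apply/funext => x; rewrite powR_inv1 ?sqr_ge0 //.
  have [->|x0] := eqVneq x 0; first by rewrite invr0 mul0r.
  by field.
apply: measurable_funM => //.
exact: (measurableT_comp (@measurable_powR R (-1)) (@exprn_measurable R setT 2)).
Qed.

Lemma measurable_sqrt : measurable_fun [set: R] (fun x : R => Num.sqrt x).
Proof.
by apply: continuous_measurable_fun; exact: sqrt_continuous.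
Qed.

End measurable_extra.

Section heat_bounds.
Context {R : realType}.
Variable a : R.

Lemma heat_ge0 s x : 0 <= heat a s x. Proof. exact: normal_cdf_ge0. Qed.

Lemma heat_le1 s x : heat a s x <= 1. Proof. exact: normal_cdf_le1. Qed.

(** Makes [heat1] and [heat2] at predictable arguments admissible test functions, as long as time
    stays above a positive level. *)
Lemma heat_derivatives_bounded (t : R) : 0 < t -> exists C : R,
  forall s x, t <= s -> `|heat1 a s x| <= C /\ `|heat2 a s x| <= C.
Proof.
move=> t0; have [K K0 bK] := @normal_pdf_moments_bounded R.
pose p : R := normal_peak 1.
have p0 : 0 < p by apply: normal_peak_gt0; rewrite oner_neq0.
have q0 : 0 <= (Num.sqrt t)^-1 by rewrite invr_ge0 sqrtr_ge0.
exists ((Num.sqrt t)^-1 * p + (Num.sqrt t)^-1 ^+ 2 * K) => s x ts.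
have qs : 0 <= (Num.sqrt s)^-1 <= (Num.sqrt t)^-1.
  rewrite invr_ge0 sqrtr_ge0 lef_pV2 ?posrE ?sqrtr_gt0 ?(lt_le_trans t0) //.
  exact: ler_wsqrtr.
have /andP[qs0 qst] := qs.
rewrite /heat1 /heat2 !normrN; split.
  rewrite normrM (le_trans (y := (Num.sqrt t)^-1 * p)) //.
    rewrite ler_pM // ger0_norm ?normal_pdf_ge0 //.
    by apply: normal_pdf_ub; rewrite oner_neq0.
  by rewrite lerDl mulr_ge0 ?exprn_ge0 // ltW.
rewrite normrM (le_trans (y := (Num.sqrt t)^-1 ^+ 2 * K)) //.
  rewrite ler_pM //; first by rewrite ger0_norm ?exprn_ge0 // lerXn2r ?nnegrE.
  by case: (bK ((a - x) * (Num.sqrt s)^-1)).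
by rewrite lerDr mulr_ge0 // ltW.
Qed.

Lemma continuous_normal_cdf : continuous (@normal_cdf R).
Proof.
move=> x; apply/differentiable_continuous/derivable1_diffP.
by have [] := @is_derive_normal_cdf R x.
Qed.

Context {d} {T : measurableType d} (G : set (set T)) (s x : T -> R).
Hypothesis sG : sigma_algebra setT G.
Hypotheses (ms : measurable_wrt G s) (mx : measurable_wrt G x).

Let mq : measurable_wrt G (fun w => (Num.sqrt (s w))^-1).
Proof.
exact: (measurable_wrt_comp (measurableT_comp measurable_invr measurable_sqrt) ms).
Qed.

Let mz : measurable_wrt G (fun w => (a - x w) * (Num.sqrt (s w))^-1).
Proof.
apply: measurable_wrtM => //; apply: measurable_wrtD => //.
  exact: measurable_wrt_cst.
exact: (measurable_wrt_comp (@oppr_measurable R setT) mx).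
Qed.

Let mpsi : measurable_wrt G
  (fun w => normal_pdf 0 1 ((a - x w) * (Num.sqrt (s w))^-1)).
Proof. exact: (measurable_wrt_comp (measurable_normal_pdf 0 1) mz). Qed.

Let mN (f : T -> R) : measurable_wrt G f -> measurable_wrt G (fun w => - f w).
Proof. exact: measurable_wrt_comp (@oppr_measurable R setT). Qed.

Lemma bmeas_heat : bmeas G (fun w => heat a (s w) (x w)).
Proof.
split; last by exists 1 => w; rewrite ger0_norm ?heat_ge0 // heat_le1.
exact: (measurable_wrt_comp (continuous_measurable_fun continuous_normal_cdf) mz).
Qed.

Lemma bmeas_heat12 t : 0 < t -> (forall w, t <= s w) ->
  bmeas G (fun w => heat1 a (s w) (x w)) /\ bmeas G (fun w => heat2 a (s w) (x w)).
Proof.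
move=> t0 ts; have [C bC] := heat_derivatives_bounded t0.
split; (split; last by exists C => w; case: (bC (s w) (x w) (ts w))).
  by apply: mN; exact: measurable_wrtM.
apply: mN; apply: measurable_wrtM => //; first exact: measurable_wrtM.
exact: measurable_wrtM.
Qed.

End heat_bounds.

(** * The martingale central limit theorem *)

(* [D k] is the increment over the step from [F k] to [F k.+1], and [v k] its
   conditional variance given [F k]. *)
Record bounded_martingale_array d (T : measurableType d) (R : realType)
    (P : probability T R) (N : nat) (F : nat -> set (set T)) (D v : nat -> T -> R)
    (delta : R) : Prop := {
  array_delta_ge0 : 0 <= delta ;
  array_field : forall k, sub_sigma_field (F k) ;
  array_filtration : forall k, F k `<=` F k.+1 ;
  array_adapted : forall k, (k < N)%N -> measurable_wrt (F k.+1) (D k) ;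
  array_var_predictable : forall k, (k < N)%N -> measurable_wrt (F k) (v k) ;
  array_bound : forall k w, (k < N)%N -> `|D k w| <= delta ;
  array_var_bound : forall k w, (k < N)%N -> 0 <= v k w <= delta ^+ 2 ;
  array_centered : forall k g, (k < N)%N -> bmeas (F k) g ->
    Ex P (fun w => D k w * g w) = 0 ;
  array_variance : forall k g, (k < N)%N -> bmeas (F k) g ->
    Ex P (fun w => D k w ^+ 2 * g w) = Ex P (fun w => v k w * g w) }.

Section lindeberg.
Context {d} {T : measurableType d} {R : realType} {P : probability T R}.
Context {N : nat} {F : nat -> set (set T)} {D v : nat -> T -> R} {delta : R}.
Hypothesis A : bounded_martingale_array P N F D v delta.

Lemma array_filtration_le k l : (k <= l)%N -> F k `<=` F l.
Proof.
elim: l => [|l IH]; first by rewrite leqn0 => /eqP ->.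
rewrite leq_eqVlt ltnS => /predU1P[->//|/IH kl].
by move=> E /kl; apply: (array_filtration A).
Qed.

Let sF k : sigma_algebra setT (F k). Proof. by case: (array_field A k). Qed.

Lemma array_sum_adapted k : (k <= N)%N ->
  measurable_wrt (F k) (fun w => \sum_(i < k) D i w).
Proof.
move=> kN; apply: measurable_wrt_sum => // i _.
apply: (measurable_wrtS (array_filtration_le (ltn_ord i))).
exact/(array_adapted A)/(leq_trans (ltn_ord i)).
Qed.

Lemma array_var_sum_predictable k : (k < N)%N ->
  measurable_wrt (F k) (fun w => \sum_(i < k.+1) v i w).
Proof.
move=> kN; apply: measurable_wrt_sum => // i _.
apply: (measurable_wrtS (@array_filtration_le i k _)); first by rewrite -ltnS.
exact/(array_var_predictable A)/(leq_trans (ltn_ord i)).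
Qed.

Lemma array_sums_measurable k : (k <= N)%N ->
  measurable_wrt measurable (fun w => \sum_(i < k) D i w) /\
  measurable_wrt measurable (fun w => \sum_(i < k) v i w).
Proof.
move=> kN; split.
  apply: (measurable_wrtS _ (array_sum_adapted kN)).
  by case: (array_field A k).
apply: measurable_wrt_sum => [|i _]; first exact: sigma_algebra_measurable.
apply: (@measurable_wrtS _ _ _ (F i)); first by case: (array_field A i).
exact/(array_var_predictable A)/(leq_trans (ltn_ord i)).
Qed.

Lemma array_var_sum_le k w : (k <= N)%N ->
  \sum_(i < k) v i w <= \sum_(i < N) v i w.
Proof.
move=> kN; rewrite -(subnKC kN) big_split_ord /= lerDl.
apply: sumr_ge0 => i _.
have : (k + i < N)%N by rewrite -{2}(subnKC kN) ltn_add2l.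
by move=> /(array_var_bound A w) /andP[].
Qed.

Variables (a tau B L : R).
Hypothesis tau0 : 0 < tau.
Hypothesis VB : forall w, \sum_(i < N) v i w <= B.
Hypothesis L0 : 0 < L.
Hypothesis taylor : forall s x v D, tau <= s -> 0 <= v ->
  `|heat a s (x + D) - heat a (s + v) x - D * heat1 a s x
    - (D ^+ 2 - v) / 2 * heat2 a s x| <= L * (`|D| ^+ 3 + v ^+ 2).

Let S k w := \sum_(i < k) D i w.
Let V k w := \sum_(i < k) v i w.
(** The probability of ending below [a] if the unspent variance were replaced by an independent
    normal variable. As [V k <= B], the smoothing [tau] keeps the time argument away from 0. *)
Let phi k w := heat a (tau + B - V k w) (S k w).

Let VkB k w : (k <= N)%N -> V k w <= B.
Proof.
by move=> kN; apply: le_trans (VB w); exact: array_var_sum_le.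
Qed.

Let sm : sigma_algebra setT (@measurable d T). Proof. exact: sigma_algebra_measurable. Qed.

Let bphi k : (k <= N)%N -> bmeas measurable (phi k).
Proof.
move=> kN; have [mS mV] := array_sums_measurable kN.
apply: bmeas_heat => //; apply: measurable_wrtD => //; first exact: measurable_wrt_cst.
exact: (measurable_wrt_comp (@oppr_measurable R setT) mV).
Qed.

(** [v k] is predictable, so the later time [s = tau + B - V k.+1] is known at [F k] and [heat1],
    [heat2] at [(s, S k)] are test functions: the linear and the [D^2 - v] terms of [heat_taylor]
    have mean 0. The remainder [|D|^3 + v^2] is at most [delta * D^2 + delta^2 * v], and [D^2] has
    the mean of [v]. *)
Let step k : (k < N)%N ->
  `|Ex P (phi k.+1) - Ex P (phi k)| <= L * (delta + delta ^+ 2) * Ex P (v k).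
Proof.
move=> kN; have kN' := ltnW kN.
have mS := array_sum_adapted kN'.
have mV := array_var_sum_predictable kN.
pose s w := tau + B - V k.+1 w.
have ms : measurable_wrt (F k) s.
  apply: measurable_wrtD => //; first exact: measurable_wrt_cst.
  exact: (measurable_wrt_comp (@oppr_measurable R setT) mV).
have st w : tau <= s w by rewrite /s -addrA lerDl subr_ge0 VkB.
have [b1 b2] := bmeas_heat12 a (sF k) ms mS tau0 st.
pose h1 w := heat1 a (s w) (S k w); pose h2 w := heat2 a (s w) (S k w).
have Fm k' : F k' `<=` measurable by case: (array_field A k').
have bD : bmeas measurable (D k).
  split; first exact: (measurable_wrtS (Fm _) (array_adapted A kN)).
  by exists delta => w; exact: (array_bound A).
have bv : bmeas measurable (v k).
  split; first exact: (measurable_wrtS (Fm _) (array_var_predictable A kN)).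
  exists (delta ^+ 2) => w; have /andP[v0 vd] := array_var_bound A w kN.
  by rewrite ger0_norm.
have bh1 : bmeas measurable h1 by exact: bmeasS (Fm k) b1.
have bh2 : bmeas measurable h2 by exact: bmeasS (Fm k) b2.
have bD2 : bmeas measurable (fun w => D k w ^+ 2) by exact: bmeasX.
pose r w := phi k.+1 w - phi k w - D k w * h1 w
   - 2^-1 * (D k w ^+ 2 * h2 w - v k w * h2 w).
have bphi' : bmeas measurable (fun w => phi k.+1 w - phi k w).
  by apply: bmeasB => //; exact: bphi.
have bDh : bmeas measurable (fun w => D k w * h1 w) by exact: bmeasM.
have bphi'' : bmeas measurable (fun w => phi k.+1 w - phi k w - D k w * h1 w).
  exact: bmeasB.
have bq : bmeas measurable (fun w => D k w ^+ 2 * h2 w - v k w * h2 w).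
  by apply: bmeasB => //; exact: bmeasM.
have bq' : bmeas measurable (fun w => 2^-1 * (D k w ^+ 2 * h2 w - v k w * h2 w)).
  by apply: bmeasM => //; exact: bmeas_cst.
have br : bmeas measurable r by exact: bmeasB.
have c1 : Ex P (fun w => D k w * h1 w) = 0 by exact: (array_centered A kN b1).
have c2 : Ex P (fun w => D k w ^+ 2 * h2 w) = Ex P (fun w => v k w * h2 w).
  exact: (array_variance A kN b2).
have Er : Ex P r = Ex P (phi k.+1) - Ex P (phi k).
  have e1 := ExB P bphi'' bq'; have e2 := ExB P bphi' bDh.
  have e3 := ExB P (bphi kN) (bphi kN'); have e4 := ExZ P 2^-1 bq.
  have e5 := ExB P (bmeasM sm bD2 bh2) (bmeasM sm bv bh2).
  pose sub (x y : R) := x - y.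
  have e5' := etrans e5 (etrans (congr1 (sub^~ _) c2) (subrr _)).
  have e6 := etrans e4 (etrans (congr1 ( *%R 2^-1) e5') (mulr0 _)).
  have e7 := etrans e2 (etrans (congr2 sub e3 c1) (subr0 _)).
  exact: etrans e1 (etrans (congr2 sub e7 e6) (subr0 _)).
rewrite -Er; apply: (le_trans (Ex_norm P br)).
have bdom : bmeas measurable (fun w => L * (delta * D k w ^+ 2 + delta ^+ 2 * v k w)).
  apply: bmeasM => //; first exact: bmeas_cst.
  by apply: bmeasD => //; apply: bmeasM => //; exact: bmeas_cst.
have bc c (f : T -> R) : bmeas measurable f -> bmeas measurable (fun w => c * f w).
  by move=> bf; apply: bmeasM => //; exact: bmeas_cst.
apply: (@le_trans _ _ (Ex P (fun w => L * (delta * D k w ^+ 2 + delta ^+ 2 * v k w)))).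
  apply: le_Ex => // [|w]; first exact: bmeas_norm.
  have /andP[v0 vd] := array_var_bound A w kN.
  have := taylor (S k w) (D k w) (st w) v0.
  have -> : s w + v k w = tau + B - V k w by rewrite /s /V big_ord_recr /=; ring.
  have -> : S k w + D k w = S k.+1 w by rewrite /S big_ord_recr.
  rewrite (_ : _ - _ - _ - _ = r w); last by rewrite /r /phi /h1 /h2 -/(s w); field.
  move=> h; apply: (le_trans h); rewrite ler_pM2l //; apply: lerD.
    rewrite exprS -normrX [`|_ ^+ 2|]ger0_norm ?sqr_ge0 //.
    by rewrite ler_wpM2r ?sqr_ge0 // (array_bound A).
  by rewrite expr2 ler_wpM2r.
rewrite ExZ; last by apply: bmeasD => //; exact: bc.
rewrite ExD ?ExZ //; try exact: bc.
have := array_variance A kN (bmeas_cst 1 (sF k)).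
under [fun w => D k w ^+ 2 * 1]eq_fun do rewrite mulr1.
under [fun w => v k w * 1]eq_fun do rewrite mulr1.
by move=> ->; rewrite -mulrDl mulrA.
Qed.

(** Telescoping [step]: the errors are proportional to the mean variances, whose sum is at most [B]
    however many steps there are. *)
Lemma lindeberg_bound :
  `|Ex P (fun w => heat a (tau + B - \sum_(i < N) v i w) (\sum_(i < N) D i w))
    - heat a (tau + B) 0| <= L * (delta + delta ^+ 2) * B.
Proof.
have h k : (k <= N)%N -> `|Ex P (phi k) - heat a (tau + B) 0|
    <= L * (delta + delta ^+ 2) * \sum_(i < k) Ex P (v i).
  elim: k => [_|k IH kN].
    rewrite big_ord0 mulr0 /phi /S /V.
    under eq_fun do rewrite !big_ord0 subr0.
    by rewrite Ex_cst subrr normr0.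
  have h2 := step kN; have h1 := IH (ltnW kN); rewrite big_ord_recr /= [leRHS]mulrDr.
  apply: (le_trans _ (lerD h1 h2)).
  move: (Ex P (phi k.+1)) (Ex P (phi k)) => x y.
  by rewrite [leRHS]addrC ler_distD.
apply: (le_trans (h N (leqnn _))).
have bv i : (i < N)%N -> bmeas measurable (v i).
  move=> iN; split.
    apply: (measurable_wrtS _ (array_var_predictable A iN)).
    by case: (array_field A i).
  exists (delta ^+ 2) => w; have /andP[v0 vd] := array_var_bound A w iN.
  by rewrite ger0_norm.
have bs := bmeas_sum sm bv; rewrite -(Ex_sum P bv).
apply: ler_wpM2l.
  by rewrite mulr_ge0 ?(ltW L0) // addr_ge0 ?sqr_ge0 // (array_delta_ge0 A).
by rewrite -(Ex_cst P B); apply: le_Ex => //; exact: bmeas_cst.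
Qed.

End lindeberg.

(** * Stopping at a variance budget *)

Section stopping.
Context {d} {T : measurableType d} {R : realType} {P : probability T R}.
Context {N : nat} {F : nat -> set (set T)} {D v : nat -> T -> R} {delta : R}.
Hypothesis A : bounded_martingale_array P N F D v delta.
Variable B : R.
Hypothesis B0 : 0 <= B.

(** The sum already includes [v k], which is known at time [k]: the step is refused before it
    overshoots, and the refusal is predictable. *)
Let go k : set T := [set w | \sum_(i < k.+1) v i w <= B].

(* Multiplying by [\1_(go k)] discards the increments after the time at which
   the cumulated conditional variance exceeds [B]. *)
Definition stopped (f : nat -> T -> R) k w := \1_(go k) w * f k w.

Let sF k : sigma_algebra setT (F k). Proof. by case: (array_field A k). Qed.

Let mgo k : (k < N)%N -> F k (go k).
Proof.
move=> kN; apply: measurable_wrt_le => //.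
  exact: (array_var_sum_predictable A kN).
exact: measurable_wrt_cst.
Qed.

Let go01 k w : \1_(go k) w = 0 :> R \/ \1_(go k) w = 1 :> R.
Proof. by rewrite indicE; case: (_ \in _); [right|left]. Qed.

Lemma stopped_array :
  bounded_martingale_array P N F (stopped D) (stopped v) delta.
Proof.
split; [exact: (array_delta_ge0 A)|exact: (array_field A)|
  exact: (array_filtration A)|..].
- move=> k kN; apply: measurable_wrtM => //; last exact: (array_adapted A).
  by apply: measurable_wrt_indic => //; apply: (array_filtration A); exact: mgo.
- move=> k kN; apply: measurable_wrtM => //; last exact: (array_var_predictable A).
  by apply: measurable_wrt_indic => //; exact: mgo.
- move=> k w kN; rewrite /stopped; case: (go01 k w) => ->.
    by rewrite mul0r normr0 (array_delta_ge0 A).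
  by rewrite mul1r (array_bound A).
- move=> k w kN; rewrite /stopped; case: (go01 k w) => ->.
    by rewrite mul0r lexx sqr_ge0.
  by rewrite mul1r (array_var_bound A).
- move=> k g kN bg; rewrite -(@array_centered _ _ _ _ _ _ _ _ _ A k (fun w => \1_(go k) w * g w)) //.
    by congr Ex; apply/funext => w; rewrite /stopped; ring.
  by apply: bmeasM => //; apply: bmeas_indic => //; exact: mgo.
- move=> k g kN bg.
  have bg' : bmeas (F k) (fun w => \1_(go k) w * g w).
    by apply: bmeasM => //; apply: bmeas_indic => //; exact: mgo.
  have := array_variance A kN bg'.
  set l := Ex _ _; set r := Ex _ _ => lr.
  transitivity l; [|rewrite lr]; congr Ex; apply/funext => w; rewrite /stopped.
    by case: (go01 k w) => ->; rewrite ?(mul0r, mul1r, expr0n, mulr0).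
  by ring.
Qed.

Lemma stopped_var_le w : \sum_(i < N) stopped v i w <= B.
Proof.
(* The second inequality drives the induction: as long as step [k] is kept, the kept variance
   including [v k] is at most the full one, hence at most [B]. *)
suff h k : (k <= N)%N -> \sum_(i < k) stopped v i w <= B /\
    \sum_(i < k) stopped v i w <= \sum_(i < k) v i w.
  by case: (h N).
elim: k => [_|k IH kN]; first by rewrite !big_ord0.
have [IH1 IH2] := IH (ltnW kN).
have /andP[v0 _] := array_var_bound A w kN.
rewrite (big_ord_recr k) [X in _ /\ _ <= X](big_ord_recr k) /=.
rewrite {2 4}/stopped indicE; case: (boolP (w \in go k)) => [|_].
  rewrite inE /go /= big_ord_recr /= => vB.
  by rewrite mul1r lerD2r; split => //; apply: le_trans vB; rewrite lerD2r.
by rewrite mul0r addr0; split => //; rewrite (le_trans IH2) // lerDl.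
Qed.

Lemma stopped_sum (f : nat -> T -> R) w :
  \sum_(i < N) v i w <= B -> \sum_(i < N) stopped f i w = \sum_(i < N) f i w.
Proof.
move=> vB; apply: eq_bigr => i _; rewrite /stopped indicE mem_set ?mul1r //.
rewrite /go /=; apply: (le_trans _ vB).
exact: (array_var_sum_le A w (ltn_ord i)).
Qed.

End stopping.
Arguments stopped {d T R} v B f k w.

(** * Heat solutions compared with the normal limit and with the indicator *)

Section normal_cdf_lipschitz.
Context {R : realType}.

Lemma normal_cdf_lipschitz (x y : R) :
  `|normal_cdf x - normal_cdf y| <= normal_peak 1 * `|x - y|.
Proof.
wlog xy : x y / y <= x => [h|].
  by have [/h//|/ltW/h] := leP y x; rewrite distrC [`|y - x|]distrC.
rewrite [`|x - y|]ger0_norm ?subr_ge0 //.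
apply: (@derive_bound R _ (normal_pdf 0 1) _ _ _ xy) => z _.
  exact: is_derive_normal_cdf.
rewrite ger0_norm ?normal_pdf_ge0 //.
by apply: normal_pdf_ub; rewrite oner_neq0.
Qed.

(** With [q = 1 / sqrt (1 + e)], write [b * q - a = (b - a) * q - a * (1 - q)] and use
    [0 <= 1 - q <= e]. *)
Lemma heat_origin (a b e : R) : 0 < e ->
  `|heat b (1 + e) 0 - normal_cdf a| <= normal_peak 1 * (`|b - a| + `|a| * e).
Proof.
move=> e0; rewrite /heat subr0; apply: (le_trans (normal_cdf_lipschitz _ _)).
rewrite ler_wpM2l ?normal_peak_ge0 //.
set q := (Num.sqrt (1 + e))^-1.
have s1 : 1 <= Num.sqrt (1 + e) by rewrite -[leLHS]sqrtr1 ler_wsqrtr // lerDl ltW.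
have q1 : q <= 1 by rewrite invf_le1 // (lt_le_trans ltr01).
have q0 : 0 <= q by rewrite invr_ge0 (le_trans ler01).
have q2 : 1 - q <= e.
  have -> : 1 - q = (Num.sqrt (1 + e) - 1) * q.
    by rewrite mulrBl mulfV ?mul1r // gt_eqF // (lt_le_trans ltr01).
  apply: (@le_trans _ _ ((Num.sqrt (1 + e) - 1) * 1)).
    by rewrite ler_wpM2l // subr_ge0.
  have : Num.sqrt (1 + e) ^+ 2 = 1 + e by rewrite sqr_sqrtr // addr_ge0 // ltW.
  move: s1; move: (Num.sqrt _) => z; nra.
have -> : b * q - a = (b - a) * q - a * (1 - q) by ring.
apply: (le_trans (ler_normB _ _)); apply: lerD; rewrite normrM.
  by rewrite [`|q|]ger0_norm // ler_piMr.
by rewrite ler_wpM2l // ger0_norm // subr_ge0.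
Qed.

End normal_cdf_lipschitz.

Section sandwich.
Context {R : realType}.
Variables (a theta eta M e : R).
Hypotheses (theta0 : 0 < theta) (eta0 : 0 < eta) (M0 : 0 < M).
Hypotheses (Me : 1 - e <= normal_cdf M) (NMe : normal_cdf (- M) <= e).
Hypothesis small : M * Num.sqrt (3 * eta) <= theta.

Let scale s y : 0 < s -> s <= 3 * eta -> theta <= y -> M <= y * (Num.sqrt s)^-1.
Proof.
move=> s0 s3 ty; rewrite ler_pdivlMr ?sqrtr_gt0 //; apply: (le_trans _ ty).
by apply: le_trans small; rewrite ler_pM2l // ler_wsqrtr.
Qed.

(** A normal variable of variance at most [3 * eta] crosses a margin [theta], at least [M] standard
    deviations wide, with probability at most [e]. The factor 3 anticipates the time left,
    [eta + (1 + eta) - V], when [|V - 1| < eta]. *)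
Lemma heat_indicator s x : 0 < s -> s <= 3 * eta ->
  ((x <= a)%R%:R - e <= heat (a + theta) s x) /\
  (heat (a - theta) s x <= (x <= a)%R%:R + e).
Proof.
move=> s0 s3; have e0 : 0 <= e by exact: le_trans (normal_cdf_ge0 _) NMe.
have [xa|ax] := leP x a; split.
- apply: (le_trans Me); apply: normal_cdf_nondecreasing; apply: scale => //; lra.
- by rewrite (le_trans (heat_le1 _ _ _)) // lerDl.
- by rewrite sub0r (le_trans _ (heat_ge0 _ _ _)) // oppr_le0.
- rewrite add0r; apply: le_trans NMe; apply: normal_cdf_nondecreasing.
  rewrite lerNr -mulNr; apply: scale => //; lra.
Qed.

End sandwich.

Section martingale_clt.
Context {d} {T : measurableType d} {R : realType} (P : probability T R).

(** The array is stopped at budget [1 + eta]. The error terms stem in turn from paths whose variance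
    is off, from the Gaussian smoothing, from the Lindeberg sum with [tau = eta], and from moving
    the variance [1 + 2 * eta] to 1 and the shifted threshold back to [a]. *)
Lemma Ex_sandwich N (F : nat -> set (set T)) (D v : nat -> T -> R) delta
    (a theta eta M e L : R) :
  bounded_martingale_array P N F D v delta ->
  0 < theta -> 0 < eta -> 0 < M ->
  1 - e <= normal_cdf M -> normal_cdf (- M) <= e ->
  M * Num.sqrt (3 * eta) <= theta -> 0 < L ->
  (forall b, b = a + theta \/ b = a - theta -> forall s x v D, eta <= s -> 0 <= v ->
    `|heat b s (x + D) - heat b (s + v) x - D * heat1 b s x
      - (D ^+ 2 - v) / 2 * heat2 b s x| <= L * (`|D| ^+ 3 + v ^+ 2)) ->
  `|fine (P [set w | \sum_(i < N) D i w <= a]) - normal_cdf a| <=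
    fine (P [set w | eta <= `|\sum_(i < N) v i w - 1| ]) + e +
    L * (delta + delta ^+ 2) * (1 + eta) +
    normal_peak 1 * (theta + `|a| * (2 * eta)).
Proof.
move=> A theta0 eta0 M0 Me NMe small L0 tay.
have B0 : 0 <= 1 + eta by rewrite addr_ge0 // ltW.
have A' := stopped_array A (1 + eta).
have V' w := stopped_var_le A B0 w.
have [mS mV] := array_sums_measurable A (leqnn N).
have [mS' mV'] := array_sums_measurable A' (leqnn N).
have sm : sigma_algebra setT (@measurable d T) by exact: sigma_algebra_measurable.
pose G1 := [set w | \sum_(i < N) D i w <= a].
pose G2 := [set w | eta <= `|\sum_(i < N) v i w - 1| ].
have mG1 : measurable G1.
  by apply: measurable_wrt_le => //; exact: measurable_wrt_cst.
have mG2 : measurable G2.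
  apply: measurable_wrt_le => //; first exact: measurable_wrt_cst.
  apply: (measurable_wrt_comp (@normr_measurable R setT)).
  by apply: measurable_wrtD => //; exact: measurable_wrt_cst.
have b1 : bmeas measurable (\1_G1 : T -> R) by exact: bmeas_indic.
have b2 : bmeas measurable (\1_G2 : T -> R) by exact: bmeas_indic.
pose U b w := heat b (eta + (1 + eta) - \sum_(i < N) stopped v (1 + eta) v i w)
  (\sum_(i < N) stopped v (1 + eta) D i w).
have bU b : bmeas measurable (U b).
  apply: bmeas_heat => //; apply: measurable_wrtD => //; first exact: measurable_wrt_cst.
  exact: (measurable_wrt_comp (@oppr_measurable R setT) mV').
have main b : b = a + theta \/ b = a - theta ->
    `|Ex P (U b) - heat b (eta + (1 + eta)) 0| <= L * (delta + delta ^+ 2) * (1 + eta).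
  by move=> bb; exact: (lindeberg_bound A' eta0 V' L0 (tay b bb)).
have orig b : b = a + theta \/ b = a - theta ->
    `|heat b (eta + (1 + eta)) 0 - normal_cdf a| <=
      normal_peak 1 * (theta + `|a| * (2 * eta)).
  move=> bb; have -> : eta + (1 + eta) = 1 + 2 * eta by ring.
  have -> : theta = `|b - a|.
    case: bb => ->; first by rewrite addrC addKr gtr0_norm.
    by rewrite addrC addKr normrN gtr0_norm.
  by apply: heat_origin; rewrite mulr_gt0.
(* Off [G2] stopping changes nothing and the remaining time lies between [eta] and [3 * eta], so
   [heat_indicator] applies; on [G2] the indicator [\1_G2] makes both bounds trivial. *)
have pw w : \1_G1 w - e - \1_G2 w <= U (a + theta) w /\
    U (a - theta) w <= \1_G1 w + e + \1_G2 w.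
  have e0 : 0 <= e by exact: le_trans (normal_cdf_ge0 _) NMe.
  have i1 : \1_G1 w = (\sum_(i < N) D i w <= a)%R%:R :> R.
    by rewrite indicE (_ : (w \in G1) = (\sum_(i < N) D i w <= a)) //; apply/idP/idP; rewrite inE.
  have [wG|/negP wG] := boolP (w \in G2).
    have := heat_ge0 (a + theta) (eta + (1 + eta) - \sum_(i < N) stopped v (1 + eta) v i w)
      (\sum_(i < N) stopped v (1 + eta) D i w).
    have := heat_le1 (a - theta) (eta + (1 + eta) - \sum_(i < N) stopped v (1 + eta) v i w)
      (\sum_(i < N) stopped v (1 + eta) D i w).
    rewrite -/(U (a + theta) w) -/(U (a - theta) w) i1.
    rewrite indicE wG /=; case: (_ <= a) => /=; lra.
  have w2 : ~ eta <= `|\sum_(i < N) v i w - 1|.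
    by move=> h; apply: wG; rewrite inE.
  have {}w2 : `|\sum_(i < N) v i w - 1| < eta by rewrite ltNge; apply/negP.
  have /negPf nw : w \notin G2 by apply/negP.
  rewrite [\1_G2 w]indicE nw subr0 addr0 i1.
  move: w2; rewrite ltr_norml => /andP[w2 w3].
  have vB : \sum_(i < N) v i w <= 1 + eta by lra.
  rewrite /U !(stopped_sum A) //.
  apply: (@heat_indicator _ a theta eta M e) => //; lra.
have [mu ou] := (main _ (or_introl erefl), orig _ (or_introl erefl)).
have [ml ol] := (main _ (or_intror erefl), orig _ (or_intror erefl)).
have bc : bmeas measurable (fun _ : T => e) by exact: bmeas_cst.
have E1 : Ex P (\1_G1) - e - Ex P (\1_G2) <= Ex P (U (a + theta)).
  rewrite -{1}(Ex_cst P e) -ExB // -ExB //; last exact: bmeasB.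
  apply: le_Ex => // [|w]; last by case: (pw w).
  by apply: bmeasB => //; exact: bmeasB.
have E2 : Ex P (U (a - theta)) <= Ex P (\1_G1) + e + Ex P (\1_G2).
  rewrite -{1}(Ex_cst P e) -ExD // -ExD //; last exact: bmeasD.
  apply: le_Ex => // [|w]; last by case: (pw w).
  by apply: bmeasD => //; exact: bmeasD.
have P1 : fine (P G1) = Ex P (\1_G1) by rewrite -(Ex_indic P mG1).
have P2 : fine (P G2) = Ex P (\1_G2) by rewrite -(Ex_indic P mG2).
rewrite P1 P2; move: mu ou ml ol E1 E2.
move: (Ex P (\1_G1)) (Ex P (\1_G2)) (Ex P _) (Ex P _) (heat _ _ _) (heat _ _ _).
move: (L * _ * _) (normal_peak 1 * _) (normal_cdf a) => c1 c2 c3 x1 x2 x3 x4 x5 x6.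
rewrite !ler_norml => /andP[? ?] /andP[? ?] /andP[? ?] /andP[? ?] ? ?.
by apply/andP; split; lra.
Qed.

(** The parameters are fixed in the order [e], [M], [eta], [L], all independent of [n]; then [n]
    need only make small [delta n] and the probability of a variance deviation in [Ex_sandwich]. *)
Theorem martingale_clt (N : nat -> nat) (F : nat -> nat -> set (set T))
    (D v : nat -> nat -> T -> R) (delta : nat -> R) :
  (forall n, bounded_martingale_array P (N n) (F n) (D n) (v n) (delta n)) ->
  delta n @[n --> \oo] --> 0 ->
  cvg_in_probability P (fun n w => \sum_(i < N n) v n i w) 1 ->
  cvg_in_distribution P (fun n w => \sum_(i < N n) D n i w) (normal_prob 0 1).
Proof.
move=> A delta0 V1 a _.
rewrite [X in _ --> X](_ : _ = (normal_cdf a)%:E); last exact: normal_cdfE.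
have sm : sigma_algebra setT (@measurable d T) by exact: sigma_algebra_measurable.
have fineP (G : set T) : measurable G -> P G = (fine (P G))%:E.
  by move=> mG; rewrite fineK // fin_num_measure.
have mS n : measurable [set w | \sum_(i < N n) D n i w <= a].
  have [mS _] := array_sums_measurable (A n) (leqnn _).
  by apply: measurable_wrt_le => //; exact: measurable_wrt_cst.
under eq_fun do rewrite (fineP _ (mS _)).
apply: cvg_EFin; first by near=> n.
apply/cvgrPdist_le => eps eps0.
(* With [theta = e] and [eta <= e], the part of the bound that does not vanish with [n] is at most
   [e * K / 4], that is [eps / 4]. *)
pose K : R := 4 * (1 + normal_peak 1 * (1 + `|a| * 2)).
have pk0 : 0 <= normal_peak 1 :> R by exact: normal_peak_ge0.
have K0 : 0 < K.
  by rewrite mulr_gt0 // ltr_pwDl // mulr_ge0 // addr_ge0 // mulr_ge0.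
have [e e0 eK] : exists2 e : R, 0 < e & e * K = eps.
  by exists (eps / K); rewrite ?divr_gt0 // divfK // gt_eqF.
have [M M0 [Me NMe]] := normal_cdf_tails e0.
(* The first entry controls the excess variance in the limit, the second is the condition
   [M * sqrt (3 * eta) <= theta] for [theta = e]. *)
pose eta := Num.min e (e ^+ 2 / (3 * M ^+ 2)).
have eta0 : 0 < eta by rewrite lt_min e0 /= divr_gt0 ?exprn_gt0 // mulr_gt0 // exprn_gt0.
have etae : eta <= e by rewrite ge_min lexx.
have small : M * Num.sqrt (3 * eta) <= e.
  rewrite -ler_sqr ?nnegrE ?mulr_ge0 ?sqrtr_ge0 ?(ltW M0) //; last exact: ltW.
  rewrite exprMn sqr_sqrtr ?mulr_ge0 ?(ltW eta0) // mulrA.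
  rewrite -ler_pdivlMl ?mulr_gt0 ?exprn_gt0 // mulrC (mulrC (M ^+ 2)).
  by rewrite ge_min lexx orbT.
have [L1 L10 tay1] := heat_taylor (a + e) eta0.
have [L2 L20 tay2] := heat_taylor (a - e) eta0.
pose L := L1 + L2.
have L0 : 0 < L by rewrite addr_gt0.
have tay b : b = a + e \/ b = a - e -> forall s x v D : R, eta <= s -> 0 <= v ->
    `|heat b s (x + D) - heat b (s + v) x - D * heat1 b s x
      - (D ^+ 2 - v) / 2 * heat2 b s x| <= L * (`|D| ^+ 3 + v ^+ 2).
  move=> bb s x v' D' es v0.
  have h0 : 0 <= `|D'| ^+ 3 + v' ^+ 2 by rewrite addr_ge0 ?exprn_ge0 ?sqr_ge0.
  case: bb => ->; [apply: (le_trans (tay1 s x v' D' es v0))|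
    apply: (le_trans (tay2 s x v' D' es v0))]; rewrite ler_wpM2r //.
    by rewrite lerDl ltW.
  by rewrite lerDr ltW.
have key n := Ex_sandwich (A n) e0 eta0 M0 Me NMe small L0 tay.
have d0 : L * (delta n + delta n ^+ 2) * (1 + eta) @[n --> \oo] --> 0.
  rewrite (_ : 0 = L * (0 + 0 * 0) * (1 + eta)); last by ring.
  apply: cvgMl; apply: cvgMr; apply: cvgD => //.
  by under eq_fun do rewrite expr2; apply: cvgM.
have V0 : fine (P [set w | eta <= `|\sum_(i < N n) v n i w - 1| ]) @[n --> \oo] --> 0.
  exact: fine_cvg (V1 _ eta0).
have e40 : 0 < eps / 4 by rewrite divr_gt0.
move/cvgrPdist_le/(_ _ e40) : V0 => V0; move/cvgrPdist_le/(_ _ e40) : d0 => d0.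
apply: filterS2 V0 d0 => n h1 h2; rewrite distrC; apply: (le_trans (key n)).
have h3 : e + normal_peak 1 * (e + `|a| * (2 * eta)) <= eps / 4.
  apply: (@le_trans _ _ (e + normal_peak 1 * (e + `|a| * (2 * e)))).
    by rewrite lerD2l ler_wpM2l // lerD2l ler_wpM2l // ler_pM2l.
  have -> : e + normal_peak 1 * (e + `|a| * (2 * e)) = e * K / 4 by rewrite /K; field.
  by rewrite eK.
move: h1 h2 h3; rewrite !sub0r !normrN.
move=> /(le_trans (ler_norm _)) h1 /(le_trans (ler_norm _)) h2 h3.
lra.
Unshelve. all: by end_near. Qed.

End martingale_clt.

(** * Conditional expectations *)

Section real_integrable.
Context {d} {T : measurableType d} {R : realType} (P : probability T R).
Implicit Types (G : set (set T)) (f g h : T -> R).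

Definition rintegrable f := P.-integrable [set: T] (fun x => (f x)%:E).

Lemma rintegrable_measurable f : rintegrable f -> measurable_fun [set: T] f.
Proof. by move=> /measurable_int /measurable_EFinP. Qed.

Lemma rintegrableD f g : rintegrable f -> rintegrable g ->
  rintegrable (fun x => f x + g x).
Proof. by move=> jf jg; apply: eq_integrable (integrableD _ jf jg). Qed.

Lemma rintegrableB f g : rintegrable f -> rintegrable g ->
  rintegrable (fun x => f x - g x).
Proof. by move=> jf jg; apply: eq_integrable (integrableB _ jf jg). Qed.

Lemma rintegrableM f h : rintegrable f -> bmeas measurable h ->
  rintegrable (fun x => f x * h x).
Proof.
move=> jf [/measurable_wrt_measurable mh [C hC]].
apply: eq_integrable (integrableMl _ jf mh _) => //.
by exists C; split; [exact: num_real|move=> y Cy x _ /=; exact: le_trans (hC x) (ltW Cy)].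
Qed.

Lemma rEx f : rintegrable f -> (\int[P]_x (f x)%:E = (Ex P f)%:E)%E.
Proof. by move=> jf; rewrite /Ex fineK //; exact/integrable_fin_num. Qed.

Lemma rExD f g : rintegrable f -> rintegrable g ->
  Ex P (fun x => f x + g x) = Ex P f + Ex P g.
Proof. by move=> jf jg; apply: RintegralD. Qed.

Lemma rExB f g : rintegrable f -> rintegrable g ->
  Ex P (fun x => f x - g x) = Ex P f - Ex P g.
Proof. by move=> jf jg; apply: RintegralB. Qed.

Lemma rExZ c f : rintegrable f -> Ex P (fun x => c * f x) = c * Ex P f.
Proof. by move=> jf; apply: RintegralZl. Qed.

Lemma rExZr c f : rintegrable f -> Ex P (fun x => f x * c) = Ex P f * c.
Proof. by move=> jf; apply: RintegralZr. Qed.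

Lemma Ex_indicM f E : measurable E ->
  Ex P (fun x => f x * \1_E x) = \int[P]_(x in E) f x.
Proof.
move=> mE; rewrite /Ex [RHS]Rintegral_mkcond; apply: eq_Rintegral => x _.
by rewrite patchE indicE; case: ifPn => _ /=; rewrite ?mulr1 ?mulr0.
Qed.

Lemma Ex_ae_eq f g : measurable_fun [set: T] f -> measurable_fun [set: T] g ->
  {ae P, forall x, f x = g x} -> Ex P f = Ex P g.
Proof.
move=> mf mg fg; congr fine; apply: ae_eq_integral => //.
- exact/measurable_EFinP.
- exact/measurable_EFinP.
- by apply: filterS fg => x -> _.
Qed.

Lemma Ex_ge0_ae_eq0 f : rintegrable f -> (forall x, 0 <= f x) -> Ex P f <= 0 ->
  {ae P, forall x, f x = 0}.
Proof.
move=> jf f0 E0.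
have E00 : Ex P f = 0.
  by apply/eqP; rewrite eq_le E0 /=; apply: Rintegral_ge0.
have : ae_eq P [set: T] (fun x => (f x)%:E) (cst 0%E).
  apply/(ae_eq_integral_abs _ measurableT).
    exact/measurable_EFinP/rintegrable_measurable.
  rewrite -[RHS]/(0%:E) -E00 -rEx //; apply: eq_integral => x _.
  by rewrite gee0_abs // lee_fin.
by apply: filterS => x /(_ I) [].
Qed.

Lemma rintegrable_ae_bounded f (C : R) : measurable_fun [set: T] f ->
  {ae P, forall x, `|f x| <= C} -> rintegrable f.
Proof.
move=> mf fC; apply/integrableP; split; first exact/measurable_EFinP.
apply: (@le_lt_trans _ _ (`|C|%:E * P [set: T])%E).
  apply: integral_le_bound => //; first exact/measurable_EFinP.
  by apply: filterS fC => x fx _ /=; rewrite lee_fin (le_trans fx) // ler_norm.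
by rewrite lte_mul_pinfty // -ge0_fin_numE // fin_num_measure.
Qed.

End real_integrable.

Section uniform_approximation.
Context {d} {T : measurableType d} {R : realType}.

(** The sum counts the positive integers below [y]: it is the integer part of [y], written as a
    layer-cake sum. *)
Lemma count_levels n (y : R) : 0 <= y <= n%:R ->
  y - 1 <= \sum_(j < n) (j.+1%:R <= y)%R%:R <= y.
Proof.
elim: n => [|n IH] /andP[y0 yn].
  by rewrite big_ord0 subr_le0 y0 (le_trans yn).
rewrite big_ord_recr /=; have [h|h] := leP y n%:R.
  have -> : (n.+1%:R <= y)%R = false.
    by apply/negbTE; rewrite -ltNge (le_lt_trans h) // ltr_nat.
  by rewrite addr0 IH // y0.
have -> : \sum_(i < n) (i.+1%:R <= y)%R%:R = n%:R :> R.
  rewrite -[in RHS](card_ord n) -sum1_card natr_sum; apply: eq_bigr => i _.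
  by rewrite (le_trans _ (ltW h)) // ler_nat.
move: yn h; rewrite -natr1; move: n%:R => z; case: (leP (z + 1) y) => /= h1 h2 h3.
  by rewrite mulr1n; apply/andP; split; lra.
by rewrite mulr0n; apply/andP; split; lra.
Qed.

(** Since the approximation is uniform, linear identities pass from indicators of sets of [G] to
    bounded functions with an error controlled by the sup norm. *)
Lemma bmeas_uniform_approx (G : set (set T)) (h : T -> R) (m : nat) :
  sigma_algebra setT G -> bmeas G h ->
  exists n (c : nat -> R) (E : nat -> set T), (forall j, G (E j)) /\
    forall x, `|h x - \sum_(j < n) c j * \1_(E j) x| <= m.+1%:R^-1.
Proof.
move=> sigG [mh [C hC]].
pose K := (Num.truncn `|C|).+1.
have CK : C <= K%:R by rewrite (le_trans (ler_norm _)) // ltW // truncnS_gt.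
have GT : G setT by have [G0 GC _] := sigG; rewrite -(setD0 setT); exact: GC.
(* Levels of mesh [1 / (m + 1)] covering [[-K, K]]. The extra index [n], with the whole space and
   coefficient [-K], undoes the shift of [h] to nonnegative values. *)
pose n := (2 * K * m.+1)%N.
pose E j := if j == n then setT else [set x | - (K%:R : R) + j.+1%:R / m.+1%:R <= h x].
pose c j : R := if j == n then - K%:R else m.+1%:R^-1.
exists n.+1, c, E; split => [j|x].
  rewrite /E; case: ifP => // _.
  by apply: measurable_wrt_le => //; exact: measurable_wrt_cst.
have m0 : 0 < m.+1%:R :> R by rewrite ltr0n.
pose y := (h x + K%:R) * m.+1%:R.
have /count_levels : 0 <= y <= n%:R.
  have := hC x; rewrite ler_norml => /andP[h1 h2].
  rewrite mulr_ge0 //=; last by rewrite -lerBlDr sub0r (le_trans _ h1) // lerN2.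
  rewrite natrM ler_pM2r // mul2n -addnn natrD lerD2r.
  exact: le_trans h2 CK.
have sE : \sum_(j < n) c j * \1_(E j) x = m.+1%:R^-1 * \sum_(j < n) (j.+1%:R <= y)%R%:R.
  rewrite mulr_sumr; apply: eq_bigr => j _.
  rewrite /c /E ltn_eqF //; congr (_ * _); rewrite indicE.
  have eE : (- (K%:R : R) + j.+1%:R / m.+1%:R <= h x) = (j.+1%:R <= y).
    by rewrite [X in X <= _]addrC lerBlDr ler_pdivrMr.
  rewrite (_ : (x \in _) = (j.+1%:R <= y)) // -eE.
  by apply/idP/idP; rewrite inE.
have -> : \sum_(j < n.+1) c j * \1_(E j) x =
    \sum_(j < n) c j * \1_(E j) x + c n * \1_(E n) x by rewrite big_ord_recr.
rewrite sE /c /E eqxx indicT mulr1.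
set s := \sum_(j < n) _ => /andP[h1 h2].
have -> : h x - (m.+1%:R^-1 * s - K%:R) = (y - s) * m.+1%:R^-1.
  by rewrite /y; field; rewrite ?pnatr_eq0.
rewrite normrM [`|_^-1|]ger0_norm ?invr_ge0 ?(ltW m0) //.
by rewrite ler_piMl ?invr_ge0 ?(ltW m0) // ler_norml; apply/andP; split; lra.
Qed.

End uniform_approximation.

Section conditional_expectation.
Context {d} {T : measurableType d} {R : realType} (P : probability T R).
Variable G : set (set T).
Hypothesis sG : sub_sigma_field G.
Implicit Types f g h : T -> R.

Let sigG : sigma_algebra setT G. Proof. by case: sG. Qed.
Let subG : G `<=` measurable. Proof. by case: sG. Qed.

(** Simple test functions give 0 by linearity, and replacing [h] by a uniform approximation costs at
    most its error times the mean of [|f|]. *)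
Lemma Ex_orthogonal f h : rintegrable P f ->
  (forall E, G E -> Ex P (fun x => f x * \1_E x) = 0) ->
  bmeas G h -> Ex P (fun x => f x * h x) = 0.
Proof.
move=> jf fE bh.
have bh' : bmeas measurable h by exact: bmeasS bh.
have jfh : rintegrable P (fun x => f x * h x) by exact: rintegrableM.
have jn : rintegrable P (fun x => `|f x|) by exact: integrable_norm jf.
pose I := Ex P (fun x => `|f x|).
have I0 : 0 <= I by apply: Rintegral_ge0.
suff key m : `|Ex P (fun x => f x * h x)| <= m.+1%:R^-1 * I.
  apply/eqP; rewrite -normr_eq0 eq_le normr_ge0 andbT.
  apply/ler_addgt0Pr => e e0; rewrite add0r.
  have I1 : 0 < I + 1 by rewrite ltr_wpDl.
  have [N NP] := natSinv_lt (divr_gt0 e0 I1).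
  apply: (le_trans (key N)).
  apply: (@le_trans _ _ (e / (I + 1) * (I + 1))); last by rewrite divfK // gt_eqF.
  apply: ler_pM => //; first exact/ltW/NP.
  by rewrite lerDl.
have [n [c [E [GE hE]]]] := bmeas_uniform_approx m sigG bh.
have sm : sigma_algebra setT (@measurable d T) by exact: sigma_algebra_measurable.
have bc (r : R) : bmeas measurable (fun _ : T => r) by exact: bmeas_cst.
have bE j : bmeas measurable (fun x => c j * \1_(E j) x).
  by apply: bmeasM => //; apply: (bmeasS subG); exact: bmeas_indic.
have bhm := bmeas_sum sm (fun j (_ : (j < n)%N) => bE j).
pose hm x := \sum_(j < n) c j * \1_(E j) x.
have jfm : rintegrable P (fun x => f x * hm x) by exact: rintegrableM.
have E0 : Ex P (fun x => f x * hm x) = 0.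
  have e1 : forall k, (k <= n)%N ->
      rintegrable P (fun x => f x * \sum_(j < k) c j * \1_(E j) x)
      /\ Ex P (fun x => f x * \sum_(j < k) c j * \1_(E j) x) = 0.
    elim=> [_|k IH kn].
      under eq_fun do rewrite big_ord0 mulr0.
      by rewrite Ex_cst; split => //; exact: bmeas_integrable.
    have [i1 i2] := IH (ltnW kn).
    have bk : bmeas measurable (\1_(E k) : T -> R).
      by apply: (bmeasS subG); exact: bmeas_indic.
    have i4 : rintegrable P (fun x => f x * \1_(E k) x) by exact: rintegrableM.
    have i3 : rintegrable P (fun x => f x * \1_(E k) x * c k) by exact: rintegrableM.
    have -> : (fun x => f x * \sum_(j < k.+1) c j * \1_(E j) x) =
        (fun x => f x * \sum_(j < k) c j * \1_(E j) x + f x * \1_(E k) x * c k).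
      by apply/funext => x; rewrite big_ord_recr /=; ring.
    split; first exact: rintegrableD.
    by rewrite rExD // i2 rExZr // fE // mul0r addr0.
  by case: (e1 n (leqnn n)).
have -> : Ex P (fun x => f x * h x) = Ex P (fun x => f x * (h x - hm x)).
  transitivity (Ex P (fun x => f x * h x) - Ex P (fun x => f x * hm x)).
    by rewrite E0 subr0.
  by rewrite -rExB //; congr Ex; apply/funext => x; rewrite mulrBr.
have jd : rintegrable P (fun x => f x * (h x - hm x)).
  by apply: rintegrableM => //; exact: bmeasB.
apply: (le_trans (le_normr_Rintegral _ jd)) => //.
rewrite -rExZ //; apply: le_Rintegral => //.
- exact: integrable_norm jd.
- by have := rintegrableM jn (bc m.+1%:R^-1); apply: eq_integrable => // x _; rewrite /= mulrC.
- by move=> x _; rewrite normrM mulrC ler_wpM2r.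
Qed.

Lemma condE_pullout f g h : rintegrable P f -> is_condE P G f g -> bmeas G h ->
  Ex P (fun x => g x * h x) = Ex P (fun x => f x * h x).
Proof.
move=> jf [mg jg fg] bh; have bh' : bmeas measurable h by exact: bmeasS bh.
apply/eqP; rewrite -subr_eq0 -rExB; [|exact: rintegrableM..].
under eq_fun do rewrite -mulrBl.
apply/eqP/Ex_orthogonal => // [|E GE]; first exact: rintegrableB.
have mE := subG GE.
have bE : bmeas measurable (\1_E : T -> R) by apply: (bmeasS subG); exact: bmeas_indic.
under eq_fun do rewrite mulrBl.
rewrite rExB; [|exact: rintegrableM..].
by rewrite !Ex_indicM // /Rintegral fg // subrr.
Qed.

(** Test against [E = {g <= 0}], a set of [G]: there [g] integrates to at least 0 although it is
    nonpositive, so it vanishes almost everywhere on [E]. *)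
Lemma condE_ge0 f g : rintegrable P f -> is_condE P G f g ->
  {ae P, forall x, 0 <= f x} -> {ae P, forall x, 0 <= g x}.
Proof.
move=> jf cfg f0; have [mg jg _] := cfg.
pose E := [set x | g x <= 0].
have GE : G E by apply: measurable_wrt_le => //; exact: measurable_wrt_cst.
have bE : bmeas G (\1_E : T -> R) by exact: bmeas_indic.
have bE' : bmeas measurable (\1_E : T -> R) by exact: bmeasS bE.
have jgE : rintegrable P (fun x => g x * \1_E x) by exact: rintegrableM.
have e1 x : `|g x * \1_E x| = (-1) * (g x * \1_E x).
  rewrite indicE; case: (boolP (x \in E)) => [|_]; last by rewrite !mulr0 normr0.
  by rewrite inE mulr1 => gx; rewrite ler0_norm // mulN1r.
have : {ae P, forall x, `|g x * \1_E x| = 0}.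
  apply: Ex_ge0_ae_eq0 => //; first exact: integrable_norm jgE.
  under eq_fun do rewrite e1.
  rewrite rExZ // (condE_pullout jf cfg bE) mulN1r oppr_le0.
  rewrite (@Ex_ae_eq _ _ _ P _ (fun x => `|f x| * \1_E x)).
  - by apply: Rintegral_ge0 => x _; rewrite mulr_ge0.
  - by apply: (@rintegrable_measurable _ _ _ P); exact: rintegrableM.
  - by apply: (@rintegrable_measurable _ _ _ P); apply: rintegrableM => //; exact: integrable_norm jf.
  - by apply: filterS f0 => x fx; rewrite ger0_norm.
apply: filterS => x; rewrite indicE.
case: (boolP (x \in E)) => [_|/negP].
  by rewrite mulr1 => /eqP; rewrite normr_eq0 => /eqP ->.
by rewrite inE => /negP; rewrite -ltNge => /ltW.
Qed.

Lemma condE_ae_eq f g g' : is_condE P G f g -> is_condE P G f g' ->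
  {ae P, forall x, g x = g' x}.
Proof.
have j0 : rintegrable P (fun=> 0).
  by apply: bmeas_integrable; apply: bmeas_cst; exact: sigma_algebra_measurable.
(* The difference of two versions is a version for the zero function. *)
have le g1 g2 : is_condE P G f g1 -> is_condE P G f g2 ->
    {ae P, forall x, 0 <= g1 x - g2 x}.
  move=> [m1 j1 f1] [m2 j2 f2]; apply: (condE_ge0 j0); last exact: aeW.
  split.
  - apply: measurable_wrtD => //.
    exact: (measurable_wrt_comp (@oppr_measurable R setT) m2).
  - exact: rintegrableB.
  - move=> E GE; have mE := subG GE.
    have s1 := integrableS measurableT mE (@subsetT _ E) j1.
    have s2 := integrableS measurableT mE (@subsetT _ E) j2.
    rewrite [RHS]integral0_eq // integralB_EFin // f1 // f2 // subee // -f1 //.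
    exact: integrable_fin_num s1.
move=> c1 c2; have := le _ _ c1 c2; have := le _ _ c2 c1.
by apply: filterS2 => x; rewrite !subr_ge0 => h1 h2; apply/eqP; rewrite eq_le h1 h2.
Qed.

Section existence.
Variable f : T -> R.
Hypothesis jf : rintegrable P f.

Let TG := g_sigma_algebraType G.

Let measurableTG (B : set TG) : measurable B -> G B.
Proof. by rewrite /measurable /= sigma_algebra_id. Qed.

Let i : T -> TG := id.

Let mi : measurable_fun [set: T] i.
Proof. by move=> _ B /measurableTG GB; rewrite setTI; exact: subG. Qed.

#[local] HB.instance Definition _ := @isMeasurableFun.Build _ _ T TG i mi.

Let PG : probability TG R := distribution P i.

Let nu (B : set TG) : \bar R := (\int[P]_(x in B) (f x)%:E)%E.

Let nu0 : nu set0 = 0%E. Proof. exact: integral_set0. Qed.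

Let nu_fin B : measurable B -> nu B \is a fin_num.
Proof.
move=> /measurableTG /subG mB; apply: integrable_fin_num => //.
exact: integrableS jf.
Qed.

Let nu_additive : semi_sigma_additive nu.
Proof.
move=> F mF tF mUF.
apply: (@charge_semi_sigma_additive _ _ _ (induced_charge jf : {charge set T -> \bar R})) => //.
- by move=> n; apply/subG/measurableTG.
- exact/subG/measurableTG.
Qed.

#[local] HB.instance Definition _ := isCharge.Build _ TG R nu nu0 nu_fin nu_additive.

(** The Radon-Nikodym derivative of the charge [nu] with respect to [PG]. The latter is [P]
    restricted to [G], obtained as the law of the identity into the coarser space, so a density
    there is [G]-measurable by construction. *)
Lemma condE_exists : exists g, is_condE P G f g.
Proof.
have nuPG : nu `<< PG.
  apply/null_content_dominatesP => B /measurableTG /subG mB PB0.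
  apply: null_set_integral => //; apply: measurable_funTS.
  exact: measurable_int jf.
pose r := Radon_Nikodym nu PG.
have r_fin x : r x \is a fin_num by exact: Radon_Nikodym_fin_num.
have jr : PG.-integrable [set: TG] r by exact: Radon_Nikodym_integrable.
have mr := measurable_int _ jr.
have rE : (fun x => (fine (r x))%:E) = r by apply/funext => x; rewrite fineK.
have jr' : P.-integrable [set: T] r.
  apply/integrableP; split; first exact: measurableT_comp mr mi.
  move/integrableP : jr => [_]; rewrite ge0_integral_pushforward //.
  exact: measurableT_comp mr.
exists (fine \o r); split.
- apply/measurable_wrtP => //; apply/measurable_EFinP.
  by rewrite (_ : _ \o _ = r).
- by rewrite /= rE.
- move=> E GE; under eq_integral do rewrite /= fineK //.
  have mE : measurable (E : set TG) by rewrite /measurable /= sigma_algebra_id.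
  rewrite [RHS](Radon_Nikodym_integral nuPG mE) /PG /distribution.
  by rewrite integral_pushforward //; exact: integrableS (subG GE) _ jr'.
Qed.

End existence.

(** Existence excludes the default value in the definition of [condE]. *)
Lemma condEP f : rintegrable P f -> is_condE P G f (condE P G f).
Proof.
move=> /condE_exists [g cg]; rewrite /condE; case: xgetP => [h _ //|/(_ g)].
by [].
Qed.

End conditional_expectation.

(** * Disintegration *)

Section total_mass_one.
Context d (T : measurableType d) (R : realType).
Variable mu : {measure set T -> \bar R}.
Hypothesis mu1 : mu setT = 1%E.

(** A new name for [mu], so that a probability structure can be attached to it; it depends on the
    proof [mu1]. *)
Definition total_mass_one : set T -> \bar R := mu.
HB.instance Definition _ := Measure.on total_mass_one.
HB.instance Definition _ := Measure_isProbability.Build _ _ _ total_mass_one mu1.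

Definition prob_of : probability T R := total_mass_one.
End total_mass_one.

Section kernel_mean.
Context d (S : measurableType d) dZ (Z : measurableType dZ) (R : realType).
Variable K : S -> {measure set Z -> \bar R}.
Hypothesis K1 : forall s, K s setT = 1%E.
Hypothesis mK : forall C, measurable C -> measurable_fun [set: S] (K^~ C).

HB.instance Definition _ := isKernel.Build _ _ _ _ _ K mK.
HB.instance Definition _ := Kernel_isProbability.Build _ _ _ _ _ K K1.

Lemma bmeas_section (F : S * Z -> R) s : bmeas measurable F ->
  bmeas measurable (fun y => F (s, y)).
Proof.
move=> [/measurable_wrt_measurable mF [C FC]]; split; last by exists C => y.
by apply/measurable_wrt_measurable; apply: measurableT_comp mF _.
Qed.

Lemma bmeas_kernel_mean (F : S * Z -> R) : bmeas measurable F ->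
  bmeas measurable (fun s => Ex (prob_of (K1 s)) (fun y => F (s, y))).
Proof.
move=> bF; have [/measurable_wrt_measurable mF [C FC]] := bF; split; last first.
  exists C => s; have bs := bmeas_section s bF.
  apply: (le_trans (Ex_norm (prob_of (K1 s)) bs)).
  rewrite -(Ex_cst (prob_of (K1 s)) C); apply: le_Ex => //; first exact: bmeas_norm.
  by apply: bmeas_cst; exact: sigma_algebra_measurable.
have sZ : sigma_algebra setT (@measurable _ Z) by exact: sigma_algebra_measurable.
(* The shift by [C] makes the integrand nonnegative, as the measurability of kernel integrals
   requires; mass one lets it be subtracted afterwards. *)
have mFC : measurable_fun [set: S * Z] (fun x => (F x + C)%:E).
  by apply/measurable_EFinP; exact: measurable_funD.
have FC0 x : (0 <= (F x + C)%:E)%E.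
  by rewrite lee_fin; have := FC x; rewrite ler_norml => /andP[]; lra.
have := measurable_fun_integral_finite_kernel _ (K : R.-fker S ~> Z) FC0 mFC.
move=> mI; apply/measurable_wrt_measurable.
have -> : (fun s => Ex (prob_of (K1 s)) (fun y => F (s, y))) =
    (fun s => fine (\int[K s]_y (F (s, y) + C)%:E)%E - C).
  apply/funext => s; have bs := bmeas_section s bF.
  by rewrite -[fine _]/(Ex (prob_of (K1 s)) (fun y => F (s, y) + C)) ExD ?Ex_cst ?addrK //;
    exact: bmeas_cst.
apply: measurable_funB => //.
exact: measurableT_comp (fine_measurable measurableT) mI.
Qed.

End kernel_mean.

Lemma indic_set_comp (R : realType) (T U : Type) (f : T -> U) (E : set U) w :
  \1_E (f w) = \1_[set x | E (f x)] w :> R.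
Proof.
by rewrite !indicE (_ : (f w \in E) = (w \in [set x | E (f x)])).
Qed.

Section disintegration.
Context d (T : measurableType d) dZ (Z : measurableType dZ) (R : realType).
Variables (P : probability T R) (G : set (set T)).
Hypothesis sG : sub_sigma_field G.
Variable z : T -> Z.
Hypothesis mz : measurable_fun [set: T] z.
Local Notation TG := (g_sigma_algebraType G).
Variable K : TG -> {measure set Z -> \bar R}.
Hypothesis K1 : forall w, K w setT = 1%E.
Hypothesis mK : forall C, measurable C -> measurable_fun [set: TG] (K^~ C).

(* [K] is a regular conditional distribution of [z] given [G]. *)
Hypothesis PK : forall E C, G E -> measurable C ->
  P (E `&` z @^-1` C) = (\int[P]_(w in E) K w C)%E.

Let sigG : sigma_algebra setT G. Proof. by case: sG. Qed.
Let subG : G `<=` measurable. Proof. by case: sG. Qed.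

HB.instance Definition _ := isKernel.Build _ _ _ _ _ K mK.
HB.instance Definition _ := Kernel_isProbability.Build _ _ _ _ _ K K1.

Let mTG (f : T -> \bar R) : measurable_fun [set: TG] f -> measurable_fun [set: T] f.
Proof.
move=> mf _ B mB; rewrite setTI; apply: subG.
by have := mf measurableT B mB; rewrite setTI /measurable /= sigma_algebra_id.
Qed.

Lemma measurable_graph : measurable_fun [set: T] (fun w => (w, z w) : TG * Z).
Proof.
apply/measurable_fun_pair => //= _ B mB; rewrite setTI; apply: subG.
by move: mB; rewrite /measurable /= sigma_algebra_id.
Qed.

Let mxs (B : set (TG * Z)) : measurable B ->
  measurable_fun [set: TG] (fun w => K w (xsection B w)).
Proof.
by move=> mB; apply: (measurable_fun_xsection_finite_kernel (K : R.-fker TG ~> Z)); rewrite inE.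
Qed.

Let K_ge0_le1 w (C : set Z) : measurable C -> (K w C <= 1)%E.
Proof. by move=> mC; exact: (probability_le1 (prob_of (K1 w)) mC). Qed.

Let K_section_integrable (A : set (TG * Z)) : measurable A ->
  P.-integrable [set: T] (fun w => K w (xsection A w)).
Proof.
move=> mA; apply/integrableP; split; first exact: (mTG (mxs mA)).
apply: (@le_lt_trans _ _ (\int[P]_w (cst 1%E) w)%E); last first.
  by rewrite integral_cst // mul1e -ge0_fin_numE // fin_num_measure.
apply: ge0_le_integral => //.
  by apply: measurableT_comp => //; exact: (mTG (mxs mA)).
by move=> w _; rewrite gee0_abs // K_ge0_le1 //; exact: measurable_xsection.
Qed.

(** Dynkin's pi-lambda argument: [PK] is the case of rectangles, mass one handles complements, and
    monotone convergence disjoint unions. *)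
Lemma disintegration_set (B : set (TG * Z)) : measurable B ->
  P [set w | B (w, z w)] = (\int[P]_w K w (xsection B w))%E.
Proof.
move: B.
suff h B : <<s [set E `*` C | E in @measurable _ TG & C in @measurable _ Z] >> B ->
    P [set w | B (w, z w)] = (\int[P]_w K w (xsection B w))%E.
  by move=> B mB; apply: h; rewrite -measurable_prod_measurableType.
have mp (A : set (TG * Z)) : measurable A -> measurable [set w | A (w, z w)].
  by move=> mA; have := measurable_graph measurableT mA; rewrite setTI.
move: B; apply: dynkin_induction.
- exact: measurable_prod_measurableType.
- move=> _ _ [E mE [C mC <-]] [E' mE' [C' mC' <-]].
  exists (E `&` E'); first exact: measurableI.
  by exists (C `&` C'); [exact: measurableI|rewrite setXI].
- rewrite (eq_integral (cst 1%E)); last first.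
    move=> w _; rewrite (_ : xsection _ _ = setT) ?K1 //.
    by apply/seteqP; split => // x _; rewrite /xsection /= inE.
  by rewrite integral_cst // mul1e.
- move=> _ [E mE [C mC <-]].
  have GE : G E by move: mE; rewrite /measurable /= sigma_algebra_id.
  rewrite (_ : [set w | _] = E `&` z @^-1` C) // PK // integral_mkcond.
  apply: eq_integral => w _; rewrite patchE; case: ifPn => wE.
    by rewrite (_ : xsection _ _ = C) //; exact: in_xsectionX.
  by rewrite (_ : xsection _ _ = set0) ?measure0 //; exact: notin_xsectionX.
- move=> A mA PA.
  rewrite (_ : [set w | _] = ~` [set w | A (w, z w)]) // probability_setC; last exact: mp.
  rewrite PA.
  transitivity (\int[P]_w (1 - K w (xsection A w)))%E.
    rewrite integralB //.
    - by rewrite integral_cst // mul1e; congr (_ - _)%E; exact/esym/probability_setT.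
    - by apply: (@bmeas_integrable _ _ _ P (cst 1)); apply: bmeas_cst; exact: sigma_algebra_measurable.
    - exact: K_section_integrable.
  apply: eq_integral => w _.
  rewrite (_ : xsection (~` A) w = ~` xsection A w); last first.
    by rewrite !xsectionE preimage_setC.
  by apply/esym; apply: (probability_setC (prob_of (K1 w))); exact: measurable_xsection.
- move=> F mF tF PF.
  rewrite (_ : [set w | _] = \bigcup_k [set w | F k (w, z w)]); last first.
    by apply/seteqP; split => [w [k _ h]|w [k _ h]]; exists k.
  rewrite measure_bigcup //; last 2 first.
  - by move=> k _; exact: mp.
  - move=> k l _ _ [w [h1 h2]]; apply: tF => //.
    by exists (w, z w).
  rewrite (@eq_eseriesl _ _ xpredT); last by move=> k; rewrite in_setT.
  rewrite (eq_eseriesr (fun i _ => PF i)).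
  rewrite -integral_nneseries //; last by move=> k; exact: (mTG (mxs (mF k))).
  apply: eq_integral => w _; rewrite xsection_bigcup measure_bigcup //.
  - by apply: eq_eseriesl => k; rewrite in_setT.
  - by move=> k _; exact: measurable_xsection.
  - exact: trivIset_xsection.
Qed.

Local Notation Ek w F := (Ex (prob_of (K1 w)) (fun y => F (w, y))).

Let bsection (F : TG * Z -> R) w : bmeas measurable F ->
  bmeas measurable (fun y => F (w, y)).
Proof. exact: bmeas_section. Qed.

Lemma bmeas_disintegration (F : TG * Z -> R) : bmeas measurable F ->
  bmeas G (fun w : T => Ek w F).
Proof.
move=> /(bmeas_kernel_mean K1 mK) [mE CE]; split => //.
by apply: measurable_wrtS mE => E; rewrite /measurable /= sigma_algebra_id.
Qed.

(** The freezing lemma: the first argument, known at [G], is held fixed while [z] is integrated out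
    under [K w]. It passes from sets to functions by uniform approximation, whose error enters once
    on each side, hence the [e / 2] in the proof. *)
Lemma disintegration (F : TG * Z -> R) : bmeas measurable F ->
  Ex P (fun w => F (w, z w)) = Ex P (fun w : T => Ek w F).
Proof.
move=> bF.
have sT : sigma_algebra setT (@measurable _ T) by exact: sigma_algebra_measurable.
have sTZ : sigma_algebra setT (@measurable _ (TG * Z)%type) by exact: sigma_algebra_measurable.
have graph (F' : TG * Z -> R) : bmeas measurable F' ->
    bmeas measurable (fun w => F' (w, z w)).
  move=> [/measurable_wrt_measurable mF [C FC]]; split; last by exists C => y.
  by apply/measurable_wrt_measurable; exact: measurableT_comp mF measurable_graph.
have bk (F' : TG * Z -> R) : bmeas measurable F' ->
    bmeas (@measurable _ T) (fun w : T => Ek w F').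
  by move=> bF'; apply: (bmeasS subG); exact: bmeas_disintegration.
apply/eqP; rewrite -subr_eq0 -normr_eq0 eq_le normr_ge0 andbT.
apply/ler_addgt0Pr => e e0; rewrite add0r.
have [m mP] := natSinv_lt (divr_gt0 e0 (@ltr0n R 2)).
have {}mP := mP m (leqnn m).
have [n [c [E [mE hE]]]] := bmeas_uniform_approx m sTZ bF.
pose Fm x := \sum_(j < n) c j * \1_(E j) x.
have b1 j : bmeas measurable (\1_(E j) : TG * Z -> R) by exact: bmeas_indic.
have bE j : bmeas measurable (fun x : TG * Z => c j * \1_(E j) x).
  by apply: bmeasM => //; exact: bmeas_cst.
have bFm : bmeas measurable Fm := bmeas_sum sTZ (fun j (_ : (j < n)%N) => bE j).
have e1 j : Ex P (fun w => \1_(E j) (w, z w)) = Ex P (fun w : T => Ek w \1_(E j)).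
  have -> : (fun w => \1_(E j) (w, z w)) = \1_[set w | E j (w, z w)] :> (T -> R).
    by apply/funext => w; exact: (indic_set_comp _ (fun w => (w, z w))).
  apply: EFin_inj; rewrite Ex_indic //; last first.
    by have := measurable_graph measurableT (mE j); rewrite setTI.
  rewrite disintegration_set // -ExE; last exact: bk.
  apply: eq_integral => w _.
  rewrite -[LHS](Ex_indic (prob_of (K1 w))); last exact: measurable_xsection.
  congr (_%:E); congr Ex; apply/funext => y.
  by rewrite !indicE mem_xsection.
have eqm : Ex P (fun w => Fm (w, z w)) = Ex P (fun w : T => Ek w Fm).
  have -> : (fun w => Ek w Fm) = (fun w => \sum_(j < n) c j * Ek w \1_(E j)).
    apply/funext => w; rewrite (Ex_sum (prob_of (K1 w)) (f := fun j y => c j * \1_(E j) (w, y))).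
      by apply: eq_bigr => j _; rewrite ExZ //; exact: (bsection w (b1 j)).
    by move=> j _; exact: (bsection w (bE j)).
  rewrite (Ex_sum P (f := fun j w => c j * \1_(E j) (w, z w))); last first.
    by move=> j _; exact: (graph _ (bE j)).
  rewrite (Ex_sum P (f := fun j w => c j * Ek w \1_(E j))); last first.
    by move=> j _; apply: bmeasM => //; [exact: bmeas_cst|exact: bk].
  apply: eq_bigr => j _; rewrite !ExZ ?e1 //; first exact: bk.
  exact: (graph _ (b1 j)).
have d1 : `|Ex P (fun w => F (w, z w)) - Ex P (fun w => Fm (w, z w))| <= m.+1%:R^-1.
  by apply: Ex_dist => [||w]; [exact: graph|exact: graph|exact: hE].
have d2 : `|Ex P (fun w : T => Ek w Fm) - Ex P (fun w : T => Ek w F)| <= m.+1%:R^-1.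
  rewrite distrC; apply: Ex_dist => [||w]; [exact: bk|exact: bk|].
  by apply: Ex_dist => [||y]; [exact: bsection|exact: bsection|exact: hE].
rewrite -(subrK (Ex P (fun w => Fm (w, z w))) (Ex P (fun w => F (w, z w)))) -addrA.
apply: (le_trans (ler_normD _ _)); rewrite {2}eqm.
apply: (le_trans (lerD d1 d2)); move: mP; move: m.+1%:R^-1 => r; lra.
Qed.

End disintegration.

(** * Measurability and means of Hilbert-valued maps *)

Section weakly_measurable_wrt.
Context {d} {T : measurableType d} {R : realType} {H : hilbertType R}.
Implicit Types (G : set (set T)) (f g : T -> H).

Definition weakly_measurable_wrt G f :=
  weakly_measurable (f : g_sigma_algebraType G -> H).

Lemma weakly_measurable_wrtS G G' f : sigma_algebra setT G -> sigma_algebra setT G' ->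
  G `<=` G' -> weakly_measurable_wrt G f -> weakly_measurable_wrt G' f.
Proof.
move=> sG sG' GG' [mf sf]; split => // h.
by apply/measurable_wrtP => //; apply: (measurable_wrtS GG'); apply/measurable_wrtP.
Qed.

Lemma measurable_wrt_inner G f g : sigma_algebra setT G ->
  weakly_measurable_wrt G f -> weakly_measurable_wrt G g ->
  measurable_wrt G (fun w => inner (f w) (g w)).
Proof. by move=> sG wf wg; apply/measurable_wrtP => //; exact: measurable_inner. Qed.

Lemma measurable_wrt_norm G f : sigma_algebra setT G ->
  weakly_measurable_wrt G f -> measurable_wrt G (fun w => `|f w|).
Proof.
move=> sG wf; have -> : (fun w => `|f w|) = (fun w => Num.sqrt (inner (f w) (f w))).
  by apply/funext => w; rewrite inner_normE sqrtr_sqr normr_id.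
exact: (measurable_wrt_comp measurable_sqrt (measurable_wrt_inner sG wf wf)).
Qed.

Lemma weakly_measurable_wrtD G f g :
  weakly_measurable_wrt G f -> weakly_measurable_wrt G g ->
  weakly_measurable_wrt G (fun w => f w + g w).
Proof. exact: weakly_measurableD. Qed.

Lemma weakly_measurable_wrtB G f g :
  weakly_measurable_wrt G f -> weakly_measurable_wrt G g ->
  weakly_measurable_wrt G (fun w => f w - g w).
Proof. exact: weakly_measurableB. Qed.

Lemma weakly_measurable_wrtZ G (c : T -> R) f : sigma_algebra setT G ->
  measurable_wrt G c -> weakly_measurable_wrt G f ->
  weakly_measurable_wrt G (fun w => c w *: f w).
Proof. by move=> sG /(measurable_wrtP _ sG) mc wf; exact: weakly_measurableZ. Qed.

Lemma weakly_measurable_wrt_comp d' (S : measurableType d') G (x : T -> S) (f : S -> H) :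
  sigma_algebra setT G -> measurable_wrt G x -> weakly_measurable f ->
  weakly_measurable_wrt G (f \o x).
Proof. by move=> sG /(measurable_wrtP _ sG) mx wf; exact: weakly_measurable_comp wf mx. Qed.

End weakly_measurable_wrt.

Section hilbert_mean.
Context {d} {T : measurableType d} {R : realType} {H : hilbertType R}.
Variables (mu : probability T R) (f : T -> H) (C : R).
Hypothesis mf : forall h, measurable_fun [set: T] (fun x => inner (f x) h).
Hypothesis fC : forall x, `|f x| <= C.

Lemma bmeas_inner h : bmeas measurable (fun x => inner (f x) h).
Proof.
split; first exact/measurable_wrt_measurable.
by exists (C * `|h|) => x; rewrite (le_trans (cauchy_schwarz _ _)) // ler_wpM2r.
Qed.

(** Riesz representation of the bounded functional on the right shows that a mean exists, so the
    default 0 of [hilbert_mean] is not taken. *)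
Lemma inner_hilbert_mean h :
  inner (hilbert_mean mu f) h = Ex mu (fun x => inner (f x) h).
Proof.
have [||m mE] := @riesz_representation R H (fun h => Ex mu (fun x => inner (f x) h)) C.
- move=> c g g'.
  have bc k : bmeas measurable (fun x => c * inner (f x) k).
    apply: bmeasM; [exact: sigma_algebra_measurable| |exact: bmeas_inner].
    by apply: bmeas_cst; exact: sigma_algebra_measurable.
  under eq_fun do rewrite innerDr innerZr.
  by rewrite ExD ?ExZ //; exact: bmeas_inner.
- move=> k; have bk := bmeas_inner k.
  apply: (le_trans (Ex_norm mu bk)); rewrite -(Ex_cst mu (C * `|k|)).
  apply: le_Ex; first exact: bmeas_norm.
    by apply: bmeas_cst; exact: sigma_algebra_measurable.
  by move=> x; rewrite (le_trans (cauchy_schwarz _ _)) // ler_wpM2r.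
rewrite /hilbert_mean; case: xgetP => [m' _ /(_ h)[_ m'E]|/(_ m)[]].
  by apply: EFin_inj; rewrite m'E ExE //; exact: bmeas_inner.
move=> k; split; first by apply: bmeas_integrable; exact: bmeas_inner.
by rewrite mE ExE //; exact: bmeas_inner.
Qed.

(** Pair the mean [m] with itself: [|m|^2] is the mean of [<f, m>], at most [C * |m|]. *)
Lemma norm_hilbert_mean : `|hilbert_mean mu f| <= C.
Proof.
set m := hilbert_mean mu f.
have C0 : 0 <= C by rewrite (le_trans _ (fC point)).
have [->|m0] := eqVneq m 0; first by rewrite normr0.
have mp : 0 < `|m| by rewrite normr_gt0.
rewrite -(ler_pM2r mp) -expr2 -inner_normE {1}/m inner_hilbert_mean -/m.
rewrite -(Ex_cst mu (C * `|m|)); apply: le_Ex; first exact: bmeas_inner.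
  by apply: bmeas_cst; exact: sigma_algebra_measurable.
move=> x; apply: (le_trans (ler_norm _)).
by rewrite (le_trans (cauchy_schwarz _ _)) // ler_wpM2r.
Qed.

End hilbert_mean.

Section prod_sigma.
Context {d} {T : measurableType d} {d'} {X : measurableType d'}.
Implicit Types G : set (set T).

Lemma prod_sigmaE G : sigma_algebra setT G ->
  @prod_sigma T d' X G = @measurable _ (g_sigma_algebraType G * X)%type.
Proof.
move=> sG; rewrite measurable_prod_measurableType /prod_sigma; congr (<<s _ >>).
by rewrite /measurable /= sigma_algebra_id.
Qed.

Lemma prod_sigma_measurable_wrt dU (U : measurableType dU) G (f : T * X -> U) :
  sigma_algebra setT G -> measurable_wrt (@prod_sigma T d' X G) f ->
  measurable_fun [set: g_sigma_algebraType G * X] f.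
Proof. by move=> sG; rewrite prod_sigmaE // => h _ B mB; apply: h; exists B. Qed.

(** Evaluates a random function determined by [G] at a point that becomes known only at the finer
    [G']. *)
Lemma measurable_wrt_graph dU (U : measurableType dU) G G' (f : T * X -> U) (x : T -> X) :
  sigma_algebra setT G -> sigma_algebra setT G' -> G `<=` G' ->
  measurable_wrt (@prod_sigma T d' X G) f -> measurable_wrt G' x ->
  measurable_wrt G' (fun w => f (w, x w)).
Proof.
move=> sG sG' GG' /(prod_sigma_measurable_wrt sG) mf /(measurable_wrtP _ sG') mx.
apply/measurable_wrtP => //.
have mg : measurable_fun [set: g_sigma_algebraType G']
    (fun w => (w, x w) : g_sigma_algebraType G * X).
  apply/measurable_fun_pair => //= _ B mB; rewrite setTI.
  apply: sub_sigma_algebra; apply: GG'.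
  by move: mB; rewrite /measurable /= sigma_algebra_id.
exact: measurableT_comp mf mg.
Qed.

Lemma weakly_measurable_graph (R : realType) (H : hilbertType R) G G'
    (f : T * X -> H) (x : T -> X) :
  sigma_algebra setT G -> sigma_algebra setT G' -> G `<=` G' ->
  strongly_measurable (@prod_sigma T d' X G) f -> measurable_wrt G' x ->
  weakly_measurable_wrt G' (fun w => f (w, x w)).
Proof.
move=> sG sG' GG' sf mx; move: (sf) => [_ [S cS fS]].
have [mf _] : weakly_measurable (f : g_sigma_algebraType G * X -> H).
  by apply: strong_weakly_measurable; rewrite -prod_sigmaE.
split; last by exists S => // _ [w _ <-]; apply: fS; exists (w, x w).
move=> h; apply/measurable_wrtP => //.
apply: (measurable_wrt_graph sG sG' GG' (f := fun wx => inner (f wx) h)) mx.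
by rewrite prod_sigmaE // => E [B mB <-]; exact: mf.
Qed.

End prod_sigma.

(** Policies are measurable one action at a time; countability of [A] lets preimages be split along
    the value of a random action. *)
Lemma measurable_wrt_discrete d (T : measurableType d) dA (A : measurableType dA)
    (R : realType) (G : set (set T)) (f : T -> A -> R) (a : T -> A) :
  discrete_space A -> sigma_algebra setT G ->
  (forall b, measurable_wrt G (f^~ b)) -> measurable_wrt G a ->
  measurable_wrt G (fun w => f w (a w)).
Proof.
move=> [cA mA] sG mf ma; have ma' := (measurable_wrtP _ sG).1 ma.
have mf' b := (measurable_wrtP _ sG).1 (mf b).
apply/measurable_wrtP => // _ B mB; rewrite setTI.
rewrite (_ : _ @^-1` _ = \bigcup_(b in [set: A])
    ((a @^-1` [set b]) `&` ((f^~ b) @^-1` B))); last first.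
  by apply/seteqP; split => [w wB|w [b _ [/= <-]]] //; exists (a w).
apply: countable_bigcupT_measurable => // b; apply: measurableI.
  by rewrite -[X in measurable X]setTI; exact: ma'.
by rewrite -[X in measurable X]setTI; exact: mf'.
Qed.

(** * Scores under adaptive data collection *)

Section experiment_fields.
Context {R : realType} {d} {Omega : measurableType d} {dX} {X : measurableType dX}
  {dA} {A : measurableType dA} {dY} {Y : measurableType dY} {H : hilbertType R}.
Context {S : experiment R Omega X A Y H}.
Context {P : probability Omega R} {PX : probability X R}
  {PY : R.-pker (X * A)%type ~> Y} {Pol : set (A -> X -> R)}.
Hypothesis data : adaptive_data S P PX PY Pol.

Lemma sub_field_generated (B : set (set Omega)) :
  B `<=` measurable -> sub_sigma_field <<s B >>.
Proof.
move=> Bm; split; first exact: smallest_sigma_algebra.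
by apply: smallest_sub => //; exact: sigma_algebra_measurable.
Qed.

Let sigma_of_sub d' (U : measurableType d') (f : Omega -> U) :
  measurable_fun [set: Omega] f -> sigma_of f `<=` measurable.
Proof. by move=> /measurable_wrt_measurable. Qed.

Lemma hist_field t : sub_sigma_field (hist S t).
Proof.
apply: sub_field_generated => E [s /= /andP[s1 _]].
have [mx ma my _] := data_measurable data s1.
by move=> [[]|]; [exact: sigma_of_sub mx _|exact: sigma_of_sub ma _|exact: sigma_of_sub my _].
Qed.

Lemma hist_ctx_field t : (1 <= t)%N -> sub_sigma_field (hist_ctx S t).
Proof.
move=> t1; apply: sub_field_generated => E.
have [mx ma my _] := data_measurable data t1.
by move=> []; [case: (hist_field t.-1) => _; apply|exact: sigma_of_sub mx _].
Qed.

Lemma hist_ctx_act_field t : (1 <= t)%N -> sub_sigma_field (hist_ctx_act S t).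
Proof.
move=> t1; apply: sub_field_generated => E.
have [mx ma my _] := data_measurable data t1.
by move=> [[]|]; [case: (hist_field t.-1) => _; apply|exact: sigma_of_sub mx _|
  exact: sigma_of_sub ma _].
Qed.

Lemma hist_le s t : (s <= t)%N -> hist S s `<=` hist S t.
Proof.
move=> st; apply: sub_sigma_algebra2 => E [r /= /andP[r1 rs] rE].
by exists r => //=; rewrite r1 (leq_trans rs).
Qed.

Lemma hist_sub_hist_ctx t : hist S t.-1 `<=` hist_ctx S t.
Proof. by move=> E hE; apply: sub_sigma_algebra; left. Qed.

Lemma hist_ctx_sub_act t : hist_ctx S t `<=` hist_ctx_act S t.
Proof. by apply: sub_sigma_algebra2 => E hE; left. Qed.

Lemma hist_measurable s t : (1 <= s)%N -> (s <= t)%N ->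
  [/\ measurable_wrt (hist S t) (ctx S s), measurable_wrt (hist S t) (act S s) &
      measurable_wrt (hist S t) (out S s)].
Proof.
move=> s1 st; split => E hE; apply: sub_sigma_algebra; exists s => //=; rewrite ?s1 //.
- by left; left.
- by left; right.
- by right.
Qed.

Lemma ctx_hist_ctx t : measurable_wrt (hist_ctx S t) (ctx S t).
Proof. by move=> E hE; apply: sub_sigma_algebra; right. Qed.

Lemma act_hist_ctx_act t : measurable_wrt (hist_ctx_act S t) (act S t).
Proof. by move=> E hE; apply: sub_sigma_algebra; right. Qed.

End experiment_fields.

Section scores.
Context {R : realType} {d} {Omega : measurableType d} {dX} {X : measurableType dX}
  {dA} {A : measurableType dA} {dY} {Y : measurableType dY} {H : hilbertType R}.
Variable phi : Y -> H.
Hypothesis discreteA : discrete_space A.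
Hypothesis phi_measurable : strongly_measurable measurable phi.

Let phi_weak : weakly_measurable phi.
Proof. exact: strong_weakly_measurable. Qed.

Lemma measurable_act_indic (G : set (set Omega)) (c : Omega -> A) (b : A) :
  sigma_algebra setT G -> measurable_wrt G c ->
  measurable_wrt G (fun w => \1_[set b] (c w) : R).
Proof.
move=> sG; apply: (measurable_wrt_comp (h := \1_[set b] : A -> R)).
by apply: measurable_indic; case: discreteA.
Qed.

Context (G0 G : set (set Omega)).
Hypotheses (sG0 : sigma_algebra setT G0) (sG : sigma_algebra setT G) (G0G : G0 `<=` G).
Context (p : Omega -> A -> X -> R) (m : Omega -> A -> X -> H).
Hypothesis mp : forall b, measurable_wrt (@prod_sigma _ _ X G0) (fun wx => p wx.1 b wx.2).
Hypothesis mm : forall b, strongly_measurable (@prod_sigma _ _ X G0) (fun wx => m wx.1 b wx.2).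
Context (x : Omega -> X) (c : Omega -> A) (y : Omega -> Y).
Hypotheses (mx : measurable_wrt G x) (mc : measurable_wrt G c) (my : measurable_wrt G y).

Lemma weakly_measurable_score b :
  weakly_measurable_wrt G (fun w => score phi (p w) (m w) b (x w) (c w) (y w)).
Proof.
have wm : weakly_measurable_wrt G (fun w => m w b (x w)).
  exact: (weakly_measurable_graph sG0 sG G0G (@mm b) mx).
have wy : weakly_measurable_wrt G (fun w => phi (y w)).
  exact: (weakly_measurable_wrt_comp sG my phi_weak).
apply: weakly_measurable_wrtD => //; apply: weakly_measurable_wrtZ => //; last first.
  exact: weakly_measurable_wrtB.
apply: measurable_wrtM => //; first exact: measurable_act_indic.
have := measurable_wrt_graph sG0 sG G0G (@mp b) mx.
exact: measurable_wrt_comp measurable_invr.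
Qed.

Lemma weakly_measurable_contrast a a' :
  weakly_measurable_wrt G (fun w => contrast phi a a' (p w) (m w) (x w) (c w) (y w)).
Proof. by apply: weakly_measurable_wrtB; exact: weakly_measurable_score. Qed.

End scores.

Section score_mean.
Context {R : realType} {d} {Omega : measurableType d} {dX} {X : measurableType dX}
  {dA} {A : measurableType dA} {dY} {Y : measurableType dY} {H : hilbertType R}.
Context {S : experiment R Omega X A Y H}.
Context {P : probability Omega R} {PX : probability X R}
  {PY : R.-pker (X * A)%type ~> Y} {Pol : set (A -> X -> R)}.
Hypothesis discreteA : discrete_space A.
Hypothesis data : adaptive_data S P PX PY Pol.
Variable phi : Y -> H.
Hypothesis phi_measurable : strongly_measurable measurable phi.
Variable rk : R.
Hypothesis phi_bound : forall y, `|phi y| <= rk.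
Variables (t : nat) (b : A) (cc Bm CU : R).
Hypothesis t1 : (1 <= t)%N.
Hypothesis cc0 : 0 < cc.
Variable m : nat -> Omega -> A -> X -> H.
Hypothesis adapted_m : adapted_nuisance S m.
Hypothesis floor_t : {ae P, forall w, cc <= pol S t w b (ctx S t w)}.
Hypothesis envelope_t : {ae P, forall w, `|m t.-1 w b (ctx S t w)| <= Bm}.
Variable U : Omega -> H.
Hypothesis wU : weakly_measurable_wrt (hist S t.-1) U.
Hypothesis UC : forall w, `|U w| <= CU.

Local Notation G := (hist S t.-1).
Local Notation Gc := (hist_ctx S t).
Local Notation Ga := (hist_ctx_act S t).

Let fG : sub_sigma_field G. Proof. exact: (hist_field data). Qed.
Let fGc : sub_sigma_field Gc. Proof. exact: (hist_ctx_field data). Qed.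
Let fGa : sub_sigma_field Ga. Proof. exact: (hist_ctx_act_field data). Qed.
Let sG : sigma_algebra setT G. Proof. by case: fG. Qed.
Let sGc : sigma_algebra setT Gc. Proof. by case: fGc. Qed.
Let sGa : sigma_algebra setT Ga. Proof. by case: fGa. Qed.
Let sm : sigma_algebra setT (@measurable _ Omega).
Proof. exact: sigma_algebra_measurable. Qed.

Let PY1 xa : PY xa setT = 1%E. Proof. exact: prob_kernel. Qed.

Let r w : R := pol S t w b (ctx S t w).
(** The floor and the envelope hold only almost surely. Truncating the propensity here and the
    nuisance in [mu'] gives bounded test functions that almost surely coincide with the
    originals. *)
Let ir w : R := (Num.max (r w) cc)^-1.
Let I w : R := \1_[set b] (act S t w).
Let pp w : R := inner (U w) (phi (out S t w)).
Let mu w : R := inner (U w) (m t.-1 w b (ctx S t w)).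
Let K := CU * Bm.
Let mu' w : R := Num.max (- K) (Num.min K (mu w)).
(** The mean outcome, in direction [U] with the past frozen, if action [b] is taken in the given
    context. *)
Let Q (wx : g_sigma_algebraType G * X) : R :=
  Ex (prob_of (PY1 (wx.2, b))) (fun y => inner (U wx.1) (phi y)).
Let q w : R := Q (w, ctx S t w).

Let mr : measurable_wrt Gc r.
Proof.
apply: (measurable_wrt_graph sG sGc (@hist_sub_hist_ctx _ _ _ _ _ _ _ _ _ _ S t)
  (f := fun wx => pol S t wx.1 b wx.2)); last exact: ctx_hist_ctx.
exact: (data_policy_adapted data).
Qed.

Let bir : bmeas Gc ir.
Proof.
split.
  apply: (measurable_wrt_comp measurable_invr).
  by apply/measurable_wrtP => //; apply: measurable_maxr => //; exact/measurable_wrtP.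
exists cc^-1 => w; rewrite ger0_norm ?invr_ge0 ?le_max ?(ltW cc0) ?orbT //.
by rewrite lef_pV2 ?posrE ?lt_max ?cc0 ?orbT // le_max lexx orbT.
Qed.

Let bmu' : bmeas Gc mu'.
Proof.
split; last first.
  exists `|K| => w; rewrite /mu' ler_norml.
  have h1 := ler_norm K; have := ler_norm (- K); rewrite normrN => h2.
  by rewrite le_max ge_max ge_min lerN2 h1 h2.
have mmu : measurable_wrt Gc mu.
  apply: measurable_wrt_inner => //.
    exact: (weakly_measurable_wrtS sG sGc (@hist_sub_hist_ctx _ _ _ _ _ _ _ _ _ _ S t) wU).
  apply: (weakly_measurable_graph sG sGc (@hist_sub_hist_ctx _ _ _ _ _ _ _ _ _ _ S t)
    (f := fun wx => m t.-1 wx.1 b wx.2)); last exact: ctx_hist_ctx.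
  exact: adapted_m.
apply/measurable_wrtP => //; apply: measurable_maxr => //; apply: measurable_minr => //.
exact/measurable_wrtP.
Qed.

Let bQ : bmeas measurable Q.
Proof.
apply: (@bmeas_kernel_mean _ (g_sigma_algebraType G * X)%type _ Y R
  (fun wx => PY (wx.2, b)) (fun wx => PY1 (wx.2, b)) _
  (fun wxy => inner (U wxy.1.1) (phi wxy.2))).
- move=> C mC; apply: measurableT_comp (measurable_kernel PY C mC) _.
  exact/measurable_fun_pair.
- split; last first.
    exists (CU * rk) => wxy; apply: (le_trans (cauchy_schwarz _ _)).
    by rewrite ler_pM.
  apply/measurable_wrt_measurable; apply: measurable_inner.
    apply: (weakly_measurable_comp (g := fun wxy => wxy.1.1) wU).
    exact: measurableT_comp.
  apply: (weakly_measurable_comp (g := snd)) => //.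
  exact: strong_weakly_measurable.
Qed.

Let bq : bmeas Gc q.
Proof.
have [mQ [C QC]] := bQ; split; last by exists C => w; exact: QC.
apply: (measurable_wrt_graph sG sGc (@hist_sub_hist_ctx _ _ _ _ _ _ _ _ _ _ S t) (f := Q)).
  by rewrite prod_sigmaE.
exact: ctx_hist_ctx.
Qed.

Let wUa : weakly_measurable_wrt Ga U.
Proof.
apply: (weakly_measurable_wrtS sG sGa _ wU).
exact: subset_trans (@hist_sub_hist_ctx _ _ _ _ _ _ _ _ _ _ S t) (@hist_ctx_sub_act _ _ _ _ _ _ _ _ _ _ S t).
Qed.

Let bI : bmeas Ga I.
Proof.
split; last by exists 1 => w; rewrite /I indicE; case: (_ \in _); rewrite ?normr1 ?normr0.
by apply: measurable_act_indic => //; exact: act_hist_ctx_act.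
Qed.

Let bI' : bmeas measurable I.
Proof. by apply: bmeasS bI; case: fGa. Qed.

Let bir' : bmeas measurable ir.
Proof. by apply: bmeasS bir; case: fGc. Qed.

Let bq' : bmeas measurable q.
Proof. by apply: bmeasS bq; case: fGc. Qed.

(** Disintegration over the outcome law given [Ga]: the actual action may be replaced by [b] because
    [I] vanishes when they differ. *)
Let outcome_step : Ex P (fun w => I w * ir w * pp w) = Ex P (fun w => I w * ir w * q w).
Proof.
have [mx ma my _] := data_measurable data t1.
pose L (w : g_sigma_algebraType Ga) : {measure set Y -> \bar R} :=
  PY (ctx S t w, act S t w).
have L1 w : L w setT = 1%E by exact: PY1.
have mxa : measurable_fun [set: g_sigma_algebraType Ga] (fun w => (ctx S t w, act S t w)).
  apply/measurable_fun_pair; apply/(measurable_wrtP _ sGa).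
    by apply: (measurable_wrtS (@hist_ctx_sub_act _ _ _ _ _ _ _ _ _ _ S t)); exact: ctx_hist_ctx.
  exact: act_hist_ctx_act.
have mL C : measurable C -> measurable_fun [set: g_sigma_algebraType Ga] (L^~ C).
  by move=> mC; exact: measurableT_comp (measurable_kernel PY C mC) mxa.
have PL E C : Ga E -> measurable C ->
    P (E `&` out S t @^-1` C) = (\int[P]_(w in E) L w C)%E.
  move=> GE mC; have [_ _ /(_ E GE) h] := data_outcome data t1 mC.
  have mE : measurable E by case: fGa => _; apply.
  have mo : measurable (out S t @^-1` C) by rewrite -[X in measurable X]setTI; exact: my.
  rewrite integral_indic // in h; rewrite setIC -h; apply: eq_integral => w _.
  rewrite fineK // ge0_fin_numE // (le_lt_trans (probability_le1 (prob_of (L1 w)) mC)) //.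
  exact: ltry.
pose F (wy : g_sigma_algebraType Ga * Y) : R := I wy.1 * ir wy.1 * inner (U wy.1) (phi wy.2).
have bfst (f : Omega -> R) : bmeas Ga f ->
    bmeas measurable (fun wy : g_sigma_algebraType Ga * Y => f wy.1).
  move=> [/(measurable_wrtP _ sGa) mf [C fC]]; split; last by exists C => wy.
  by apply/measurable_wrt_measurable; exact: measurableT_comp mf _.
have bF : bmeas measurable F.
  have sF : sigma_algebra setT (@measurable _ (g_sigma_algebraType Ga * Y)%type).
    exact: sigma_algebra_measurable.
  apply: (bmeasM sF); first apply: (bmeasM sF).
  - exact: (bfst _ bI).
  - apply: (bfst ir); apply: bmeasS bir; exact: hist_ctx_sub_act.
  - split; last first.
      exists (CU * rk) => wxy; apply: (le_trans (cauchy_schwarz _ _)).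
      by rewrite ler_pM.
    apply/measurable_wrt_measurable; apply: measurable_inner.
      exact: (weakly_measurable_comp wUa measurable_fst).
    apply: (weakly_measurable_comp (g := snd)) => //.
    exact: strong_weakly_measurable.
rewrite (disintegration fGa my L1 mL PL bF); congr Ex; apply/funext => w.
transitivity (I w * ir w * Ex (prob_of (L1 w)) (fun y => inner (U w) (phi y))).
  rewrite -ExZ //; split; last first.
    by exists (CU * rk) => y; apply: (le_trans (cauchy_schwarz _ _)); rewrite ler_pM.
  apply/measurable_wrt_measurable; apply: measurable_inner; first exact: weakly_measurable_cst.
  exact: strong_weakly_measurable.
have [ab|ab] := eqVneq (act S t w) b; last first.
  by rewrite /I indicE memNset ?mul0r // => /= e; rewrite e eqxx in ab.
congr (_ * _); rewrite /q /Q /=.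
(* [prob_of] carries a proof about the point [(ctx S t w, act S t w)], so that point and proof must
   be generalized together before the action is replaced. *)
suff h xa (e : xa = (ctx S t w, b)) (h1 : PY xa setT = 1%E) :
    Ex (prob_of h1) (fun y => inner (U w) (phi y)) =
    Ex (prob_of (PY1 (ctx S t w, b))) (fun y => inner (U w) (phi y)).
  by apply: h; rewrite ab.
by case: _ / (esym e) h1 => h1; rewrite (Prop_irrelevance h1 (PY1 _)).
Qed.

Let phi_inner x h : Ex (prob_of (PY1 (x, b))) (fun y => inner (phi y) h) =
  inner (cond_mean_embedding PY phi b x) h.
Proof.
rewrite -(inner_hilbert_mean (prob_of (PY1 (x, b))) (f := phi) (C := rk)) //.
move=> g; exact: (strong_weakly_measurable phi_measurable).1.
Qed.

(** The context is independent of the past, so the disintegration uses the constant kernel [PX]; the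
    two nested Hilbert means are then unfolded by pairing with [U w]. *)
Let context_step : Ex P q = Ex P (fun w => inner (U w) (interventional_embedding PX PY phi b)).
Proof.
have [mx _ _ _] := data_measurable data t1.
rewrite (disintegration fG mx (K := fun=> PX) (fun=> probability_setT PX) _ _ bQ); last 2 first.
- by move=> C mC; exact: measurable_cst.
- move=> E C GE mC; rewrite setIC (data_context data) // integral_cst //.
  by case: fG => _; apply.
congr Ex; apply/funext => w.
rewrite innerC /interventional_embedding (inner_hilbert_mean PX (C := rk)).
- congr Ex; apply/funext => x; rewrite -phi_inner; congr Ex; apply/funext => y.
  exact: innerC.
- move=> h; rewrite (_ : (fun x => _) =
    (fun x => Ex (prob_of (PY1 (x, b))) (fun y => inner (phi y) h))); last first.
    by apply/funext => x; rewrite phi_inner.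
  apply/measurable_wrt_measurable.
  have := @bmeas_kernel_mean _ X _ Y R (fun x => PY (x, b)) (fun x => PY1 (x, b)) _
    (fun xy => inner (phi xy.2) h).
  case=> //.
  - move=> C mC; apply: measurableT_comp (measurable_kernel PY C mC) _.
    exact/measurable_fun_pair.
  - split; last first.
      exists (rk * `|h|) => xy; apply: (le_trans (cauchy_schwarz _ _)).
      by rewrite ler_wpM2r.
    apply/measurable_wrt_measurable.
    apply: (measurableT_comp (f := fun y => inner (phi y) h)) => //.
    exact: (strong_weakly_measurable phi_measurable).1.
- move=> x; apply: (norm_hilbert_mean (prob_of (PY1 (x, b)))) => // h.
  exact: (strong_weakly_measurable phi_measurable).1.
Qed.

Let IE w : I w = \1_(act S t @^-1` [set b]) w :> R.
Proof. exact: indic_set_comp. Qed.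

Let r_ir : {ae P, forall w, r w * ir w = 1}.
Proof.
apply: filterS floor_t => w cr; rewrite /ir max_l // mulfV // gt_eqF //.
exact: lt_le_trans cr.
Qed.

(** Given [Gc], the mean of [I] is the propensity [r], and [r * ir = 1] almost surely. *)
Let action_step (h : Omega -> R) : bmeas Gc h ->
  Ex P (fun w => I w * ir w * h w) = Ex P h.
Proof.
move=> bh; have [_ ma _ _] := data_measurable data t1.
have mb : measurable (act S t @^-1` [set b]).
  by rewrite -[X in measurable X]setTI; apply: ma => //; case: discreteA => _; exact.
have ji : rintegrable P (\1_(act S t @^-1` [set b]) : Omega -> R).
  apply: bmeas_integrable; apply: bmeas_indic => //.
have bih : bmeas Gc (fun w => ir w * h w) by exact: bmeasM.
have mh : measurable_fun [set: Omega] h by exact: (sub_field_measurable_fun fGc bh.1).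
rewrite (_ : (fun w => _) = (fun w => \1_(act S t @^-1` [set b]) w * (ir w * h w))); last first.
  by apply/funext => w; rewrite -IE mulrA.
rewrite -(condE_pullout fGc ji (data_action data b t1) bih).
apply: Ex_ae_eq => //.
  apply: measurable_funM; first exact: (sub_field_measurable_fun fGc mr).
  exact: (sub_field_measurable_fun fGc bih.1).
by apply: filterS r_ir => w e; rewrite mulrA e mul1r.
Qed.

Let D w : R :=
  inner (U w) (score phi (pol S t w) (m t.-1 w) b (ctx S t w) (act S t w) (out S t w)).

Let bD' : bmeas measurable (fun w => I w * ir w * (pp w - mu' w) + mu' w).
Proof.
have bm : bmeas measurable mu' by apply: bmeasS bmu'; case: fGc.
have [_ _ my _] := data_measurable data t1.
apply: (bmeasD sm) => //; apply: (bmeasM sm); first exact: (bmeasM sm).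
apply: (bmeasB sm) => //; split; last first.
  by exists (CU * rk) => w; apply: (le_trans (cauchy_schwarz _ _)); rewrite ler_pM.
apply: measurable_wrt_inner => //.
  by apply: (weakly_measurable_wrtS sG sm _ wU); case: fG.
apply: (weakly_measurable_wrt_comp sm); first exact/measurable_wrt_measurable.
exact: strong_weakly_measurable.
Qed.

Let DD' : {ae P, forall w, D w = I w * ir w * (pp w - mu' w) + mu' w}.
Proof.
apply: filterS2 floor_t envelope_t => w cr mB.
rewrite /D /score innerDr innerZr innerBr -/(pp w) -/(mu w) -/(I w).
have -> : mu' w = mu w.
  have : `|mu w| <= K.
    by apply: (le_trans (cauchy_schwarz _ _)); rewrite ler_pM.
  rewrite ler_norml => /andP[h1 h2].
  by rewrite /mu' (min_r h2) max_r.
by rewrite /ir max_l.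
Qed.

Let mD : measurable_fun [set: Omega] D.
Proof.
have [mx ma my _] := data_measurable data t1.
apply/measurable_wrt_measurable; apply: measurable_wrt_inner => //.
  by apply: (weakly_measurable_wrtS sG sm _ wU); case: fG.
have Gm : G `<=` measurable by case: fG.
apply: (weakly_measurable_score discreteA phi_measurable sG sm Gm
  (fun c => data_policy_adapted data (b := c) t1) (adapted_m t.-1)); exact/measurable_wrt_measurable.
Qed.

Lemma score_integrable : rintegrable P D.
Proof.
have [_ [C hC]] := bD'; apply: (@rintegrable_ae_bounded _ _ _ P D C) => //.
by apply: filterS DD' => w ->.
Qed.

Lemma score_mean :
  Ex P D = Ex P (fun w => inner (U w) (interventional_embedding PX PY phi b)).
Proof.
have bm : bmeas measurable mu' by apply: bmeasS bmu'; case: fGc.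
have bpp : bmeas measurable pp.
  have [_ _ my _] := data_measurable data t1.
  split; last first.
    by exists (CU * rk) => w; apply: (le_trans (cauchy_schwarz _ _)); rewrite ler_pM.
  apply: measurable_wrt_inner => //.
    by apply: (weakly_measurable_wrtS sG sm _ wU); case: fG.
  apply: (weakly_measurable_wrt_comp sm); first exact/measurable_wrt_measurable.
  exact: strong_weakly_measurable.
have bIi : bmeas measurable (fun w => I w * ir w) by exact: (bmeasM sm).
have mD' : measurable_fun [set: Omega] (fun w => I w * ir w * (pp w - mu' w) + mu' w).
  by apply/measurable_wrt_measurable; case: bD'.
rewrite (Ex_ae_eq mD mD' DD').
have e : (fun w => I w * ir w * (pp w - mu' w) + mu' w) =
    (fun w => (I w * ir w * pp w - I w * ir w * mu' w) + mu' w).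
  by apply/funext => w; rewrite mulrBr.
rewrite e ExD //; last by apply: (bmeasB sm); exact: (bmeasM sm).
rewrite ExB; [|exact: (bmeasM sm)|exact: (bmeasM sm)].
(* [action_step] applied to [mu'] turns the weighted nuisance into the plain one, which cancels the
   correction term. *)
by rewrite (action_step bmu') subrK outcome_step (action_step bq) context_step.
Qed.

End score_mean.

(** The policy is random, so a null set of contexts may depend on the past. The current context is
    independent of the past with law [PX], hence avoids it: the set [B] of violations has null
    sections, and disintegration makes its trace on the graph null. *)
Lemma floor_at_context {R : realType} {d} {Omega : measurableType d} {dX} {X : measurableType dX}
  {dA} {A : measurableType dA} {dY} {Y : measurableType dY} {H : hilbertType R}
  {S : experiment R Omega X A Y H} {P : probability Omega R} {PX : probability X R}
  {PY : R.-pker (X * A)%type ~> Y} {Pol : set (A -> X -> R)} (t : nat) (b : A) (c : R) :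
  adaptive_data S P PX PY Pol -> (1 <= t)%N ->
  {ae P, forall w, {ae PX, forall x, c <= pol S t w b x}} ->
  {ae P, forall w, c <= pol S t w b (ctx S t w)}.
Proof.
move=> data t1 hc; have [mx _ _ _] := data_measurable data t1.
have fG := hist_field data t.-1; have [sG Gm] := fG.
pose B : set (g_sigma_algebraType (hist S t.-1) * X) :=
  [set wx | pol S t wx.1 b wx.2 < c].
have mB : measurable B.
  have mp : measurable_fun [set: g_sigma_algebraType (hist S t.-1) * X]
      (fun wx => pol S t wx.1 b wx.2).
    apply: (prod_sigma_measurable_wrt sG); exact: (data_policy_adapted data (b := b) t1).
  rewrite (_ : B = (fun wx => pol S t wx.1 b wx.2) @^-1` `]-oo, c[%classic).
    by rewrite -[X in measurable X]setTI; exact: mp.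
  by apply/seteqP; split => wx; rewrite /B /= in_itv.
have h := disintegration_set fG mx (K := fun=> PX) (fun=> probability_setT PX)
  (fun C mC => measurable_cst _) _ mB.
have {}h : P [set w | B (w, ctx S t w)] = (\int[P]_w PX (xsection B w))%E.
  apply: h => E C GE mC; rewrite setIC (data_context data) // integral_cst //.
  exact: Gm.
have mB' : measurable [set w | B (w, ctx S t w)].
  by have := measurable_graph fG mx measurableT mB; rewrite setTI.
exists [set w | B (w, ctx S t w)]; split => //; last first.
  by move=> w /= /negP; rewrite -ltNge.
rewrite h (ae_eq_integral (cst 0%E)) ?integral0 //.
  apply: (sub_field_measurable_fun fG); apply/(measurable_wrtP _ sG).
  exact: (measurable_fun_xsection (PX : {sigma_finite_measure set X -> \bar R}) mB).
apply: filterS hc => w hw _ /=.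
apply/negligibleP; first exact: measurable_xsection.
apply: negligibleS hw => x; rewrite /xsection /= inE /B /= => xc.
by apply/negP; rewrite -ltNge.
Qed.

Lemma norm_feature_map (R : realType) (Y : Type) (H : hilbertType R) (k : Y -> Y -> R)
    (ev : H -> Y -> R) (phi : Y -> H) (kappa : R) :
  is_rkhs k ev phi -> (forall y, k y y <= kappa) ->
  forall y, `|phi y| <= Num.sqrt kappa.
Proof.
move=> rkhs kk y; rewrite -[leLHS]ger0_norm // -sqrtr_sqr ler_wsqrtr //.
by rewrite -inner_normE -(rkhs_reproducing rkhs) (rkhs_feature rkhs).
Qed.

Lemma strongly_measurableS (T : Type) (R : realType) (H : hilbertType R)
    (G G' : set (set T)) (f : T -> H) :
  G `<=` G' -> strongly_measurable G f -> strongly_measurable G' f.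
Proof. by move=> GG' [mf sf]; split => // U oU; apply: GG'; exact: mf. Qed.

Lemma prod_sigmaS (T : Type) d (U : measurableType d) (G G' : set (set T)) :
  G `<=` G' -> @prod_sigma T d U G `<=` prod_sigma G'.
Proof.
move=> GG'; apply: sub_sigma_algebra2 => _ [E GE [F mF <-]].
by exists E; [exact: GG'|exists F].
Qed.

(** * Measurability of the pilot direction, the scores and the variance estimator *)

Section statistics.
Context {R : realType} {d} {Omega : measurableType d} {dX} {X : measurableType dX}
  {dA} {A : measurableType dA} {dY} {Y : measurableType dY} {H : hilbertType R}.
Context {S : experiment R Omega X A Y H}.
Context {P : probability Omega R} {PX : probability X R}
  {PY : R.-pker (X * A)%type ~> Y} {Pol : set (A -> X -> R)}.
Hypothesis discreteA : discrete_space A.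
Hypothesis data : adaptive_data S P PX PY Pol.
Variable phi : Y -> H.
Hypothesis phi_measurable : strongly_measurable measurable phi.
Hypothesis adapted1 : adapted_nuisance S (nuis1 S).
Hypothesis adapted2 : adapted_nuisance S (nuis2 S).
Variables (a a' : A) (u0 : H).

Let sH t : sigma_algebra setT (hist S t). Proof. by case: (hist_field data t). Qed.

Lemma weakly_measurable_phihat nuis s t : adapted_nuisance S nuis -> (1 <= s <= t)%N ->
  weakly_measurable_wrt (hist S t) (phihat S phi a a' nuis s).
Proof.
move=> ad /andP[s1 st]; have [mx mc my] := hist_measurable (S := S) s1 st.
apply: (weakly_measurable_contrast discreteA phi_measurable (sH s.-1) (sH t) _
  (fun c => data_policy_adapted data (b := c) s1) (ad s.-1)) => //.
by apply: hist_le; rewrite (leq_trans (leq_pred _)).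
Qed.

Lemma weakly_measurable_pilot_witness n :
  weakly_measurable_wrt (hist S n) (pilot_witness S phi a a' n).
Proof.
apply: (weakly_measurable_wrtZ (c := fun=> n%:R^-1) (sH n)).
  exact: measurable_wrt_cst.
(* Extension by 0 makes every index measurable, not only those in range. *)
pose f s w := if (1 <= s <= n)%N then phihat S phi a a' (nuis1 S) s w else 0.
rewrite (_ : (fun w => _) = (fun w => \sum_(1 <= s < n.+1) f s w)); last first.
  by apply/funext => w; apply: eq_big_nat => s sn; rewrite /f sn.
apply: weakly_measurable_sum => s; rewrite /f.
case sn: (0 < s <= n)%N; last exact: weakly_measurable_cst.
exact: weakly_measurable_phihat.
Qed.

Lemma weakly_measurable_pilot_direction n :
  weakly_measurable_wrt (hist S n) (pilot_direction S phi a a' u0 n).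
Proof.
pose v := pilot_witness S phi a a' n.
have wv : weakly_measurable_wrt (hist S n) v by exact: weakly_measurable_pilot_witness.
have mv := measurable_wrt_norm (sH n) wv.
(* Without a case distinction: where the witness is 0, the convention [0^-1 = 0] kills the second
   term. *)
have -> : pilot_direction S phi a a' u0 n =
    (fun w => \1_[set w | `|v w| <= 0] w *: u0 + `|v w|^-1 *: v w).
  apply/funext => w; rewrite /pilot_direction -/(v w) indicE.
  have [v0|v0] := eqVneq (v w) 0.
    by rewrite mem_set /= ?v0 ?normr0 // scaler0 addr0 scale1r.
  rewrite memNset ?scale0r ?add0r //= normr_le0; exact/negP.
apply: weakly_measurable_wrtD; last first.
  apply: weakly_measurable_wrtZ => //; exact: (measurable_wrt_comp measurable_invr mv).
apply: weakly_measurable_wrtZ => //; last exact: weakly_measurable_cst.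
apply: measurable_wrt_indic => //; apply: measurable_wrt_le => //.
exact: measurable_wrt_cst.
Qed.

Lemma norm_pilot_direction n w : `|u0| = 1 -> `|pilot_direction S phi a a' u0 n w| = 1.
Proof.
move=> u1; rewrite /pilot_direction; case: ifPn => // v0.
by rewrite normrZ normfV normr_id mulVf // normr_eq0.
Qed.

Lemma measurable_xi n t : (n < t)%N -> measurable_wrt (hist S t) (xi S phi a a' u0 n t).
Proof.
move=> nt; apply: measurable_wrt_inner => //.
  apply: (weakly_measurable_wrtS (sH n) (sH t)); first exact: hist_le (ltnW nt).
  exact: weakly_measurable_pilot_direction.
by apply: weakly_measurable_phihat; rewrite // leqnn (leq_trans _ nt).
Qed.

(** The policy of round [t] is determined by the first [t.-1] rounds and is evaluated here at data
    of an earlier round. *)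
Lemma measurable_xi_check n s t : (n < s < t)%N ->
  measurable_wrt (hist S t.-1) (xi_check S phi a a' u0 n s t).
Proof.
move=> /andP[ns st]; have s1 : (1 <= s)%N by rewrite (leq_trans _ ns).
have st' : (s <= t.-1)%N by rewrite -ltnS prednK // (leq_ltn_trans _ st).
have t1 : (1 <= t)%N by rewrite (leq_trans _ st).
apply: measurable_wrt_inner => //.
  apply: (weakly_measurable_wrtS (sH n) (sH t.-1)); first exact: hist_le (leq_trans (ltnW ns) st').
  exact: weakly_measurable_pilot_direction.
have [mx mc my] := hist_measurable (S := S) s1 st'.
have ad b : strongly_measurable (@prod_sigma _ _ X (hist S t.-1))
    (fun wx => nuis2 S s.-1 wx.1 b wx.2).
  apply: strongly_measurableS (adapted2 s.-1 b); apply: prod_sigmaS.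
  by apply: hist_le; rewrite (leq_trans (leq_pred _)).
exact: (weakly_measurable_contrast discreteA phi_measurable (sH t.-1) (sH t.-1) (@subset_refl _ _)
  (fun c => data_policy_adapted data (b := c) t1) ad mx mc my).
Qed.

Lemma measurable_weight s t : (1 <= s)%N -> (s < t)%N ->
  measurable_wrt (hist S t.-1) (weight S s t : Omega -> R).
Proof.
move=> s1 st.
have st' : (s <= t.-1)%N by rewrite -ltnS prednK // (leq_ltn_trans _ st).
have t1 : (1 <= t)%N by rewrite (leq_trans _ st).
have [mx mc _] := hist_measurable (S := S) s1 st'.
have mpol r : (1 <= r <= t)%N ->
    measurable_wrt (hist S t.-1) (fun w => pol S r w (act S s w) (ctx S s w)).
  move=> /andP[r1 rt].
  apply: (measurable_wrt_discrete (f := fun w b => pol S r w b (ctx S s w)) discreteA) => // b.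
  apply: (measurable_wrt_graph (sH r.-1) (sH t.-1) _
    (data_policy_adapted data (b := b) r1) mx).
  by apply: hist_le; rewrite -!subn1 leq_sub2r.
apply: measurable_wrtM => //; first by apply: mpol; rewrite t1 leqnn.
apply: (measurable_wrt_comp measurable_invr (f := fun w => pol S s w (act S s w) (ctx S s w))).
by apply: mpol; rewrite s1 ltnW.
Qed.

Lemma measurable_Mhat (j n t : nat) : (n < t)%N ->
  measurable_wrt (hist S t.-1) (fun w => (t - n.+1)%:R^-1 *
    \sum_(n.+1 <= s < t) weight S s t w * xi_check S phi a a' u0 n s t w ^+ j).
Proof.
move=> nt; apply: measurable_wrtM => //; first exact: measurable_wrt_cst.
rewrite (_ : (fun w => _) = (fun w => \sum_(s <- index_iota n.+1 t | (n < s < t)%N)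
    weight S s t w * xi_check S phi a a' u0 n s t w ^+ j)); last first.
  by apply/funext => w; rewrite big_nat.
apply: measurable_wrt_sum => // s /andP[ns st].
have s1 : (1 <= s)%N by rewrite (leq_trans _ ns).
apply: measurable_wrtM => //; first exact: measurable_weight.
have := measurable_xi_check (n := n) (s := s) (t := t); rewrite ns st => /(_ isT).
move=> mxi; apply: (measurable_wrt_comp (h := fun x : R => x ^+ j) _ mxi).
exact: exprn_measurable.
Qed.

(** Predictability of the estimator: dividing by it keeps the scores martingale differences. *)
Lemma measurable_sigma2hat n t : (n < t)%N ->
  measurable_wrt (hist S t.-1) (sigma2hat S phi a a' u0 n t).
Proof.
move=> nt; apply/(measurable_wrtP _ (sH t.-1)); apply: measurable_maxr => //.
have m1 := (measurable_wrtP _ (sH t.-1)).1 (measurable_Mhat (j := 1) nt).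
have m2 := (measurable_wrtP _ (sH t.-1)).1 (measurable_Mhat (j := 2) nt).
apply: measurable_funB.
  rewrite /Mhat2; case: (t == n.+1); first exact: measurable_cst.
  exact: m2.
apply: measurable_funX; rewrite /Mhat1; case: (t == n.+1); first exact: measurable_cst.
by move: m1; under eq_fun do under eq_bigr do rewrite expr1.
Qed.

End statistics.

Lemma is_condE_Ex {d} {T : measurableType d} {R : realType} (P : probability T R)
    (G : set (set T)) (f g : T -> R) :
  sub_sigma_field G -> rintegrable P f -> measurable_wrt G g -> rintegrable P g ->
  (forall E, G E -> Ex P (fun w => g w * \1_E w) = Ex P (fun w => f w * \1_E w)) ->
  is_condE P G f g.
Proof.
move=> [_ Gm] jf mg jg fg; split => // E GE; have mE := Gm _ GE.
have sf := integrableS measurableT mE (@subsetT _ E) jf.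
have s' := integrableS measurableT mE (@subsetT _ E) jg.
rewrite -[LHS]fineK; last exact: integrable_fin_num s'.
rewrite -[RHS]fineK; last exact: integrable_fin_num sf.
by congr (_%:E); have := fg _ GE; rewrite !Ex_indicM.
Qed.

Lemma sqr_le_normP (R : realDomainType) (x m : R) : `|x| <= m -> x ^+ 2 <= m ^+ 2.
Proof.
move=> h; rewrite -[x ^+ 2]real_normK ?num_real // ler_sqr // nnegrE.
exact: le_trans h.
Qed.

(** * Bound, mean and conditional variance of the scores under the null hypothesis *)

Section oracle_variance.
Context {R : realType} {d} {Omega : measurableType d} {dX} {X : measurableType dX}
  {dA} {A : measurableType dA} {dY} {Y : measurableType dY} {H : hilbertType R}.
Context {S : experiment R Omega X A Y H}.
Context {P : probability Omega R} {PX : probability X R}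
  {PY : R.-pker (X * A)%type ~> Y} {Pol : set (A -> X -> R)}.
Hypothesis discreteA : discrete_space A.
Hypothesis data : adaptive_data S P PX PY Pol.
Variable phi : Y -> H.
Hypothesis phi_measurable : strongly_measurable measurable phi.
Hypothesis adapted1 : adapted_nuisance S (nuis1 S).
Hypothesis adapted2 : adapted_nuisance S (nuis2 S).
Variables (a a' : A) (u0 : H).
Hypothesis u0_unit : `|u0| = 1.
Variables (n t : nat) (rk Bm cc : R).
Hypothesis nt : (n < t)%N.
Hypothesis cc0 : 0 < cc.
Hypothesis phi_bound : forall y, `|phi y| <= rk.
Hypothesis envelope_t : {ae P, forall w, forall b x, `|nuis2 S t.-1 w b x| <= Bm}.
Hypothesis floor_t : forall b, {ae P, forall w, cc <= pol S t w b (ctx S t w)}.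
Hypothesis H0 :
  interventional_embedding PX PY phi a = interventional_embedding PX PY phi a'.

Let t1 : (1 <= t)%N. Proof. exact: leq_trans nt. Qed.
Let G := hist S t.-1.
Let fG : sub_sigma_field G. Proof. exact: hist_field data t.-1. Qed.
Let sG : sigma_algebra setT G. Proof. by case: fG. Qed.
Let Gm : G `<=` measurable. Proof. by case: fG. Qed.

(** Each of the two scores has a residual of norm at most [rk + Bm], weighted by at most [1 / cc],
    plus a nuisance of norm at most [Bm]. *)
Definition score_bound := 2 * (cc^-1 * (rk + Bm) + Bm).

Local Notation xi := (xi S phi a a' u0 n t).
Local Notation sigma2_0 := (sigma2_0 S phi a a' u0 P n t).
Local Notation M := score_bound.

Lemma xi_bound : {ae P, forall w, `|xi w| <= M}.
Proof.
apply: filterS3 envelope_t (floor_t a) (floor_t a') => w env fa fa'.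
apply: (le_trans (cauchy_schwarz _ _)).
rewrite (norm_pilot_direction _ _ _ _ _ u0_unit) mul1r.
have -> : M = (cc^-1 * (rk + Bm) + Bm) + (cc^-1 * (rk + Bm) + Bm) by rewrite /score_bound; ring.
have sb b : cc <= pol S t w b (ctx S t w) ->
    `|score phi (pol S t w) (nuis2 S t.-1 w) b (ctx S t w) (act S t w) (out S t w)| <=
    cc^-1 * (rk + Bm) + Bm.
  move=> fb; apply: (le_trans (ler_normD _ _)); apply: (lerD _ (env _ _)).
  rewrite normrZ; apply: ler_pM; [exact: normr_ge0|exact: normr_ge0| |].
    have pp : 0 < pol S t w b (ctx S t w) by exact: lt_le_trans fb.
    rewrite normrM normfV (gtr0_norm pp) -[leRHS]mul1r.
    apply: ler_pM; [exact: normr_ge0|by rewrite invr_ge0 ltW| |by rewrite lef_pV2].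
    by rewrite indicE; case: (_ \in _); rewrite ?normr1 ?normr0.
  by apply: (le_trans (ler_normB _ _)); exact: (lerD (phi_bound _) (env _ _)).
by apply: (le_trans (ler_normB _ _)); exact: (lerD (sb a fa) (sb a' fa')).
Qed.

Let mxi : measurable_fun [set: Omega] xi.
Proof.
apply: (sub_field_measurable_fun (hist_field data t)).
exact: (measurable_xi discreteA data phi_measurable adapted1 adapted2).
Qed.

Lemma xi_integrable : rintegrable P xi.
Proof. exact: rintegrable_ae_bounded mxi xi_bound. Qed.

(** The test function is absorbed into the direction: [h *: w_n] is bounded and known at time [t.-1]
    because [n < t]. Then [score_mean] for [a] and for [a'] gives equal values by [H0]. *)
Lemma xi_centered h : bmeas G h -> Ex P (fun w => xi w * h w) = 0.
Proof.
move=> bh; have [mh [C hC]] := bh.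
pose U w := h w *: pilot_direction S phi a a' u0 n w.
have wU : weakly_measurable_wrt G U.
  apply: (weakly_measurable_wrtZ sG mh).
  apply: (weakly_measurable_wrtS _ sG _
    (weakly_measurable_pilot_direction discreteA data phi_measurable adapted1 a a' u0 n)).
    by case: (hist_field data n).
  by apply: hist_le; rewrite -ltnS prednK.
have UC w : `|U w| <= C by rewrite normrZ (norm_pilot_direction _ _ _ _ _ u0_unit) mulr1.
have env b : {ae P, forall w, `|nuis2 S t.-1 w b (ctx S t w)| <= Bm}.
  by apply: filterS envelope_t => w.
have jD b := score_integrable discreteA data phi_measurable phi_bound t1 cc0 adapted2
  (floor_t b) (env b) wU UC.
have mean b := score_mean discreteA data phi_measurable phi_bound t1 cc0 adapted2
  (floor_t b) (env b) wU UC.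
transitivity (Ex P (fun w =>
    inner (U w) (score phi (pol S t w) (nuis2 S t.-1 w) a (ctx S t w) (act S t w) (out S t w)) -
    inner (U w) (score phi (pol S t w) (nuis2 S t.-1 w) a' (ctx S t w) (act S t w) (out S t w)))).
  by congr Ex; apply/funext => w; rewrite -innerBr innerZl mulrC.
by rewrite (rExB (jD a) (jD a')) !mean H0 subrr.
Qed.

Let r0 : rintegrable P (fun=> 0).
Proof. by apply: bmeas_integrable; apply: bmeas_cst; exact: sigma_algebra_measurable. Qed.

Let condE_xi : {ae P, forall w, condE P G xi w = 0}.
Proof.
have c0 : is_condE P G xi (fun=> 0).
  have mc0 : measurable_wrt G (fun _ : Omega => 0 : R) by exact: measurable_wrt_cst.
  have h := is_condE_Ex fG xi_integrable mc0 r0; apply: h.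
  move=> E GE; rewrite (xi_centered (bmeas_indic sG GE)).
  by under eq_fun do rewrite mul0r; exact: Ex_cst.
exact: (condE_ae_eq fG (condEP fG xi_integrable) c0).
Qed.

(** The integrand of [condVar]; by [condE_xi] it almost surely equals the square of the score. *)
Let f2 w : R := (xi w - condE P G xi w) ^+ 2.

Let mf2 : measurable_fun [set: Omega] f2.
Proof.
apply: measurable_funX; apply: (measurable_funB mxi).
by apply: (sub_field_measurable_fun fG); case: (condEP fG xi_integrable).
Qed.

Let f2E : {ae P, forall w, f2 w = xi w ^+ 2}.
Proof. by apply: filterS condE_xi => w e; rewrite /f2 e subr0. Qed.

Let f2_bound : {ae P, forall w, 0 <= f2 w <= M ^+ 2}.
Proof.
apply: filterS2 f2E xi_bound => w -> h; rewrite sqr_ge0 /=.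
exact: sqr_le_normP.
Qed.

Let jf2 : rintegrable P f2.
Proof.
apply: (@rintegrable_ae_bounded _ _ _ P f2 (M ^+ 2) mf2).
by apply: filterS f2_bound => w /andP[h1 h2]; rewrite ger0_norm.
Qed.

Let cf2 : is_condE P G f2 sigma2_0.
Proof. exact: condEP. Qed.

Lemma measurable_sigma2_0 : measurable_wrt G sigma2_0.
Proof. by case: cf2. Qed.

(** Positivity of conditional expectation, for [f2] and for [M ^+ 2 - f2]. *)
Lemma sigma2_0_bound : {ae P, forall w, 0 <= sigma2_0 w <= M ^+ 2}.
Proof.
have [mg jg _] := cf2.
have jM : rintegrable P (fun=> M ^+ 2).
  by apply: bmeas_integrable; apply: bmeas_cst; exact: sigma_algebra_measurable.
have lo : {ae P, forall w, 0 <= sigma2_0 w}.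
  by apply: (condE_ge0 fG jf2 cf2); apply: filterS f2_bound => w /andP[].
have hi : {ae P, forall w, 0 <= M ^+ 2 - sigma2_0 w}.
  apply: (condE_ge0 fG (rintegrableB jM jf2)); last first.
    by apply: filterS f2_bound => w /andP[_]; rewrite subr_ge0.
  have mMg : measurable_wrt G (fun w => M ^+ 2 - sigma2_0 w).
    have mM : measurable_wrt G (fun _ : Omega => M ^+ 2) by exact: measurable_wrt_cst.
    exact: (measurable_wrtD sG mM (measurable_wrt_comp (@oppr_measurable R setT) mg)).
  have h := is_condE_Ex fG (rintegrableB jM jf2) mMg (rintegrableB jM jg); apply: h.
  move=> E GE; have bE : bmeas G (\1_E : Omega -> R) by exact: bmeas_indic sG GE.
  have bE' : bmeas measurable (\1_E : Omega -> R) := bmeasS Gm bE.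
  under eq_fun do rewrite mulrBl; rewrite [RHS](_ : _ =
    Ex P (fun w => M ^+ 2 * \1_E w - f2 w * \1_E w)); last first.
    by congr Ex; apply/funext => w; rewrite mulrBl.
  rewrite (rExB (rintegrableM jM bE') (rintegrableM jg bE')).
  rewrite (rExB (rintegrableM jM bE') (rintegrableM jf2 bE')).
  by rewrite (condE_pullout fG jf2 cf2 bE).
by apply: filterS2 lo hi => w ->; rewrite subr_ge0.
Qed.

Lemma Ex_sigma2_0 h : bmeas G h ->
  Ex P (fun w => sigma2_0 w * h w) = Ex P (fun w => xi w ^+ 2 * h w).
Proof.
move=> bh; have mh : measurable_fun [set: Omega] h by exact: (sub_field_measurable_fun fG bh.1).
rewrite (condE_pullout fG jf2 cf2 bh); apply: Ex_ae_eq.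
- exact: (measurable_funM mf2 mh).
- exact: (measurable_funM (measurable_funX _ mxi) mh).
- by apply: filterS f2E => w ->.
Qed.

End oracle_variance.

(** * Studentized sums *)

Section convergence_in_probability.
Context {d} {T : measurableType d} {R : realType} {P : probability T R}.
Implicit Types Z Y : nat -> T -> R.

Lemma le_probability_ae (A B : set T) : measurable A -> measurable B ->
  {ae P, forall w, A w -> B w} -> (P A <= P B)%E.
Proof.
move=> mA mB [N [mN N0 hN]].
have AB : A `<=` B `|` N.
  by move=> w Aw; have [Bw|Bw] := pselect (B w); [left|right; apply: hN => /(_ Aw)].
apply: (@le_trans _ _ (P (B `|` N))).
  by apply: le_measure; rewrite ?inE //; exact: measurableU.
by rewrite -[leRHS]adde0 -N0 measureU2.
Qed.

Let measurable_dev Z (c delta : R) n : measurable_fun [set: T] (Z n) ->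
  measurable [set w | delta <= `|Z n w - c|].
Proof.
move=> mZ; have sm : sigma_algebra setT (@measurable d T) by exact: sigma_algebra_measurable.
apply: (measurable_wrt_le sm (f := fun=> delta)); first exact: measurable_wrt_cst.
apply/measurable_wrt_measurable; apply: measurableT_comp => //.
exact: measurable_funB.
Qed.

(** Dominated convergence for the indicators of the deviation events, which almost surely vanish
    from some index on. *)
Lemma ae_cvg_in_probability Z (c : R) : (forall n, measurable_fun [set: T] (Z n)) ->
  {ae P, forall w, Z n w @[n --> \oo] --> c} -> cvg_in_probability P Z c.
Proof.
move=> mZ Zc delta delta0.
pose A n := [set w | delta <= `|Z n w - c|].
have mA n : measurable (A n) by exact: measurable_dev.
have [|||||_ _] := @dominated_convergence _ _ R P setT measurableT
  (fun n w => (\1_(A n) w)%:E) (cst 0%E) (cst 1%E).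
- by move=> n; apply/measurable_EFinP; exact: measurable_indic.
- exact: measurable_cst.
- apply: filterS Zc => w Zw _.
  apply: cvg_near_cst; move/cvgrPdist_lt/(_ _ delta0) : Zw; apply: filterS => n h.
  by rewrite indicE memNset // => /= /le_lt_trans; rewrite distrC => /(_ _ h); rewrite ltxx.
- by apply: (@bmeas_integrable _ _ _ P (cst 1)); apply: bmeas_cst; exact: sigma_algebra_measurable.
- by apply: aeW => w n _; rewrite indicE; case: (_ \in _); rewrite /= ?normr1 ?normr0 lee_fin.
rewrite integral0.
rewrite (_ : [sequence _]_n = (fun n => P (A n))) //.
by apply/funext => n /=; rewrite integral_indic // setIT.
Qed.

Lemma le_cvg_in_probability Z Y (c : R) :
  (forall n, measurable_fun [set: T] (Z n)) -> (forall n, measurable_fun [set: T] (Y n)) ->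
  (\forall n \near \oo, {ae P, forall w, `|Z n w - c| <= Y n w}) ->
  cvg_in_probability P Y 0 -> cvg_in_probability P Z c.
Proof.
move=> mZ mY ZY Y0 delta delta0.
apply: (squeeze_cvge _ (cvg_cst 0%E) (Y0 _ delta0)).
apply: filterS ZY => n ZYn; rewrite measure_ge0 /=.
apply: le_probability_ae; [exact: measurable_dev|exact: measurable_dev|].
by apply: filterS ZYn => w h /= dZ; rewrite subr0 (le_trans dZ) // (le_trans h) // ler_norm.
Qed.

Lemma cvg_in_probabilityD0 Z Y :
  (forall n, measurable_fun [set: T] (Z n)) -> (forall n, measurable_fun [set: T] (Y n)) ->
  cvg_in_probability P Z 0 -> cvg_in_probability P Y 0 ->
  cvg_in_probability P (fun n w => Z n w + Y n w) 0.
Proof.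
move=> mZ mY Z0 Y0 delta delta0; have d2 : 0 < delta / 2 by rewrite divr_gt0.
have := cvgeD _ (Z0 _ d2) (Y0 _ d2); rewrite adde0 => /(_ _ isT) ZY0.
apply: (squeeze_cvge _ (cvg_cst 0%E) ZY0).
apply: nearW => n; rewrite measure_ge0 /=.
apply: (@le_trans _ _ (P ([set w | delta / 2 <= `|Z n w - 0|] `|`
    [set w | delta / 2 <= `|Y n w - 0|]))).
  apply: le_measure; rewrite ?inE.
  - apply: (measurable_dev (Z := fun n w => Z n w + Y n w)); exact: measurable_funD.
  - by apply: measurableU; exact: measurable_dev.
  - move=> w /=; rewrite !subr0 => h.
    have := le_trans h (ler_normD _ _).
    by case: (lerP (delta / 2) `|Z n w|) => h1 h2; [left|right; lra].
by apply: measureU2; exact: measurable_dev.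
Qed.

Lemma cvg_in_probabilityZ0 (c : R) Z : 0 < c -> cvg_in_probability P Z 0 ->
  cvg_in_probability P (fun n w => c * Z n w) 0.
Proof.
move=> c0 Z0 delta delta0; have := Z0 _ (divr_gt0 delta0 c0).
rewrite (_ : (fun n => P [set w | delta / c <= `|Z n w - 0|]) =
  (fun n => P [set w | delta <= `|c * Z n w - 0|])) //.
apply/funext => n; congr (P _); apply/seteqP; split => w /=;
  by rewrite !subr0 normrM (gtr0_norm c0) ler_pdivrMr // mulrC.
Qed.

(** The constant hidden in [O_as] depends on the path, so the product is first shown to converge
    almost surely; [V] is a neighbourhood of infinity, also depending on the path, where the ratio
    is bounded. *)
Lemma O_as_cvg_in_probability Z (r c : nat -> R) :
  (forall n, measurable_fun [set: T] (Z n)) ->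
  O_as P (fun n w => (Z n w)%:E) r ->
  (\forall n \near \oo, 0 < r n) -> c n * r n @[n --> \oo] --> 0 ->
  cvg_in_probability P (fun n w => c n * Z n w) 0.
Proof.
move=> mZ Zr r0 cr; apply: ae_cvg_in_probability => [n|].
  by apply: measurable_funM.
apply: filterS Zr => w; rewrite /limn_esup /limf_esup => /ereal_inf_lt[_ [V VF <-]] Vy.
have [C hC] : exists C : R, forall n, V n -> `|Z n w| / r n <= C.
  move: Vy; case E : (ereal_sup _) => [C| |] // _.
    exists C => n Vn; rewrite -lee_fin -E; apply: ereal_sup_ubound.
    by exists n.
  exists 0 => n Vn; have : ((`|Z n w| / r n)%:E <= -oo)%E.
    by rewrite -E; apply: ereal_sup_ubound; exists n.
  by [].
have C0 : (`|c n * r n| * `|C|) @[n --> \oo] --> 0.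
  rewrite -[0](mul0r `|C|); apply: cvgMl; rewrite -(@normr0 _ R); exact: cvg_norm.
apply/norm_cvg0P; apply: (squeeze_cvgr _ (cvg_cst 0) C0).
near=> n; rewrite normr_ge0 /=.
have rn : 0 < r n by near: n.
have Vn : V n by near: n.
rewrite !normrM -mulrA ler_wpM2l // (gtr0_norm rn).
have := hC _ Vn; rewrite ler_pdivrMr // => h.
by rewrite (le_trans h) // mulrC ler_wpM2l ?(ltW rn) // ler_norm.
Unshelve. all: by end_near. Qed.

End convergence_in_probability.

Section clamp.
Context {R : realType}.

Definition clamp (lo hi x : R) := Num.max lo (Num.min hi x).

Lemma clampP (lo hi x : R) : lo <= hi -> lo <= clamp lo hi x <= hi.
Proof. by move=> h; rewrite /clamp le_max lexx /= ge_max h ge_min lexx. Qed.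

Lemma clamp_id (lo hi x : R) : lo <= x <= hi -> clamp lo hi x = x.
Proof. by move=> /andP[h1 h2]; rewrite /clamp min_r // max_r. Qed.

Lemma norm_clamp (m x : R) : 0 <= m -> `|clamp (- m) m x| <= m.
Proof. by move=> m0; rewrite ler_norml; apply: clampP; rewrite (le_trans _ m0) // oppr_le0. Qed.

Lemma measurable_clamp d (T : measurableType d) (lo hi : R) (f : T -> R) :
  measurable_fun [set: T] f -> measurable_fun [set: T] (fun w => clamp lo hi (f w)).
Proof. by move=> mf; apply: measurable_maxr => //; exact: measurable_minr. Qed.

End clamp.

(** The squared studentizer is [m = max h (e^2)]. If [V <= 4 * e^2], the ratio [V / m] lies in
    [[0, 4]]. Otherwise [V] exceeds [e^2], so raising [h] to [m] brings it no further from [V], and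
    [1 / m <= 1 / e^2]. *)
Lemma variance_ratio_bound (R : realType) (h V e : R) : 0 < e -> 0 <= h -> 0 <= V ->
  `|V / Num.max (Num.sqrt h) e ^+ 2 - 1| <=
  4 * (Num.sqrt V <= 2 * e)%R%:R + `|h - V| / e ^+ 2.
Proof.
move=> e0 h0 V0; have e20 : 0 < e ^+ 2 by rewrite exprn_gt0.
have -> : Num.max (Num.sqrt h) e ^+ 2 = Num.max h (e ^+ 2).
  have [h1|h1] := lerP (Num.sqrt h) e.
    by rewrite max_r // -(sqr_sqrtr h0) ler_sqr ?nnegrE ?sqrtr_ge0 // ltW.
  rewrite sqr_sqrtr // max_l // -(sqr_sqrtr h0).
  by rewrite ler_sqr ?nnegrE ?sqrtr_ge0 ?ltW.
set m := Num.max h (e ^+ 2).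
have m0 : 0 < m by rewrite lt_max e20 orbT.
have em : e ^+ 2 <= m by rewrite le_max lexx orbT.
have d0 : 0 <= `|h - V| / e ^+ 2 by rewrite divr_ge0 // ltW.
case: (lerP (Num.sqrt V) (2 * e)) => [hV|hV].
  rewrite mulr1; have V4 : V <= 4 * e ^+ 2.
    rewrite -(sqr_sqrtr V0) (_ : 4 * e ^+ 2 = (2 * e) ^+ 2); last by ring.
    by rewrite ler_sqr ?nnegrE ?sqrtr_ge0 // mulr_ge0 // ltW.
  have q0 : 0 <= V / m by rewrite divr_ge0 // ltW.
  have q4 : V / m <= 4 by rewrite ler_pdivrMr // (le_trans V4) // ler_pM2l.
  by rewrite ler_norml; move: (V / m) (_ / _) q0 q4 d0 => q r; move=> *; apply/andP; split; lra.
rewrite mulr0 add0r.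
have V4 : 4 * e ^+ 2 < V.
  rewrite -(sqr_sqrtr V0) (_ : 4 * e ^+ 2 = (2 * e) ^+ 2); last by ring.
  by rewrite ltr_sqr ?nnegrE ?sqrtr_ge0 // mulr_ge0 // ltW.
have -> : V / m - 1 = (V - m) / m by rewrite mulrBl divff // gt_eqF.
rewrite normrM normfV (gtr0_norm m0).
apply: ler_pM => //; [by rewrite invr_ge0 ltW| |by rewrite lef_pV2].
rewrite /m; case: (lerP h (e ^+ 2)) => [he|he]; last by rewrite distrC.
by rewrite ger0_norm ?ler0_norm; move: (e ^+ 2) e20 he V4 => ee; lra.
Qed.

Lemma measurable_sum_lt d (T : measurableType d) (R : realType) n
    (f : nat -> T -> R) :
  (forall k, (k < n)%N -> measurable_fun [set: T] (f k)) ->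
  measurable_fun [set: T] (fun w => \sum_(k < n) f k w).
Proof.
elim: n => [|n IH] mf.
  by under eq_fun do rewrite big_ord0; exact: measurable_cst.
under eq_fun do rewrite big_ord_recr.
by apply: measurable_funD; [apply: IH => k kn; apply: mf; exact: ltnW|exact: mf].
Qed.

(** * The central limit theorem for studentized martingale differences *)

Section studentized_clt.
Context {d} {T : measurableType d} {R : realType} {P : probability T R}.
Context {F : nat -> nat -> set (set T)} {X h V : nat -> nat -> T -> R} {M e : nat -> R}.
Hypothesis field : forall n k, sub_sigma_field (F n k).
Hypothesis filtration : forall n k, F n k `<=` F n k.+1.
Hypothesis mX : forall n k, (k < n)%N -> measurable_wrt (F n k.+1) (X n k).
Hypothesis mh : forall n k, (k < n)%N -> measurable_wrt (F n k) (h n k).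
Hypothesis mV : forall n k, (k < n)%N -> measurable_wrt (F n k) (V n k).
Hypothesis e_gt0 : forall n, (0 < n)%N -> 0 < e n.
Hypothesis h_ge0 : forall n k w, 0 <= h n k w.
Hypothesis M_ge0 : forall n, 0 <= M n.
Hypothesis X_bound : forall n k, (k < n)%N -> {ae P, forall w, `|X n k w| <= M n}.
Hypothesis V_bound : forall n k, (k < n)%N -> {ae P, forall w, 0 <= V n k w <= M n ^+ 2}.
Hypothesis X_centered : forall n k g, (k < n)%N -> bmeas (F n k) g ->
  Ex P (fun w => X n k w * g w) = 0.
Hypothesis X_variance : forall n k g, (k < n)%N -> bmeas (F n k) g ->
  Ex P (fun w => V n k w * g w) = Ex P (fun w => X n k w ^+ 2 * g w).
Hypothesis M_rate : M n / (e n * Num.sqrt n%:R) @[n --> \oo] --> 0.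
Hypothesis clipping : cvg_in_probability P (fun n w =>
  n%:R^-1 * \sum_(k < n) (Num.sqrt (V n k w) <= 2 * e n)%R%:R) 0.
Hypothesis estimation : cvg_in_probability P (fun n w =>
  (e n ^+ 2)^-1 * (n%:R^-1 * \sum_(k < n) `|h n k w - V n k w|)) 0.

Let s n k w : R := Num.max (Num.sqrt (h n k w)) (e n).
(** The clamps, here and in [v], are almost surely inactive; they provide the bounds on every path
    that [bounded_martingale_array] demands. *)
Let D n k w : R := (Num.sqrt n%:R)^-1 * ((s n k w)^-1 * clamp (- M n) (M n) (X n k w)).
Let v n k w : R := n%:R^-1 * ((s n k w)^-1 ^+ 2 * clamp 0 (M n ^+ 2) (V n k w)).
Let delta n := M n / (e n * Num.sqrt n%:R).

Let sF n k : sigma_algebra setT (F n k). Proof. by case: (field n k). Qed.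

Let s_gt0 n k w : (k < n)%N -> 0 < s n k w.
Proof. by move=> kn; rewrite /s lt_max e_gt0 ?orbT // (leq_ltn_trans _ kn). Qed.

Let sV_ge0 n k w : (k < n)%N -> 0 <= (s n k w)^-1.
Proof. by move=> kn; rewrite invr_ge0 ltW // s_gt0. Qed.

Let sV_le n k w : (k < n)%N -> (s n k w)^-1 <= (e n)^-1.
Proof.
move=> kn; rewrite lef_pV2 ?posrE ?s_gt0 //; first by rewrite /s le_max lexx orbT.
by apply: e_gt0; exact: leq_ltn_trans kn.
Qed.

Let bsV n k : (k < n)%N -> bmeas (F n k) (fun w => (s n k w)^-1).
Proof.
move=> kn; split; last by exists (e n)^-1 => w; rewrite ger0_norm ?sV_ge0 ?sV_le.
have ms : measurable_wrt (F n k) (s n k).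
  apply/(measurable_wrtP _ (sF n k)); apply: measurable_maxr => //.
  apply: (measurableT_comp measurable_sqrt).
  by apply/(measurable_wrtP _ (sF n k)); exact: mh.
exact: (measurable_wrt_comp measurable_invr ms).
Qed.

Let mD n k : (k < n)%N -> measurable_wrt (F n k.+1) (D n k).
Proof.
move=> kn; have mc : measurable_wrt (F n k.+1) (fun w => clamp (- M n) (M n) (X n k w)).
  apply/(measurable_wrtP _ (sF n k.+1)); apply: measurable_clamp.
  by apply/(measurable_wrtP _ (sF n k.+1)); exact: mX.
have msV : measurable_wrt (F n k.+1) (fun w => (s n k w)^-1).
  exact: (measurable_wrtS (@filtration n k) (bsV kn).1).
apply: (measurable_wrtM (sF n k.+1) (f := fun=> (Num.sqrt n%:R)^-1)).
  exact: measurable_wrt_cst.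
exact: (measurable_wrtM (sF n k.+1) msV mc).
Qed.

Let mv n k : (k < n)%N -> measurable_wrt (F n k) (v n k).
Proof.
move=> kn; have mc : measurable_wrt (F n k) (fun w => clamp 0 (M n ^+ 2) (V n k w)).
  apply/(measurable_wrtP _ (sF n k)); apply: measurable_clamp.
  by apply/(measurable_wrtP _ (sF n k)); exact: mV.
apply: (measurable_wrtM (sF n k) (f := fun=> n%:R^-1)).
  exact: measurable_wrt_cst.
exact: (measurable_wrtM (sF n k) (bmeasX _ (sF n k) (bsV kn)).1 mc).
Qed.

Let array n : bounded_martingale_array P n (F n) (D n) (v n) (delta n).
Proof.
have e0 k : (k < n)%N -> 0 < e n by move=> kn; apply: e_gt0; exact: leq_ltn_trans kn.
have sn0 k : (k < n)%N -> 0 < Num.sqrt n%:R :> R.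
  by move=> kn; rewrite sqrtr_gt0 ltr0n; exact: leq_ltn_trans kn.
split => //.
- rewrite /delta divr_ge0 //; have [->|n0] := posnP n; first by rewrite sqrtr0 mulr0.
  by rewrite mulr_ge0 ?sqrtr_ge0 // ltW // e_gt0.
- by move=> k; exact: mD.
- by move=> k; exact: mv.
- move=> k w kn; rewrite /D /delta !normrM (ger0_norm (sV_ge0 w kn)).
  rewrite (@ger0_norm _ (Num.sqrt n%:R)^-1) ?invr_ge0 ?sqrtr_ge0 //.
  have -> : M n / (e n * Num.sqrt n%:R) = (Num.sqrt n%:R)^-1 * ((e n)^-1 * M n).
    by rewrite invfM; ring.
  by rewrite ler_wpM2l ?invr_ge0 ?sqrtr_ge0 // ler_pM // ?sV_ge0 ?sV_le ?norm_clamp.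
- move=> k w kn; have /andP[c0 cM] := clampP (V n k w) (sqr_ge0 (M n)).
  have n0 : 0 <= n%:R^-1 :> R by rewrite invr_ge0.
  have -> : delta n ^+ 2 = n%:R^-1 * ((e n)^-1 ^+ 2 * M n ^+ 2).
    by rewrite /delta -[in RHS](@sqr_sqrtr _ n%:R) // -[in RHS]exprVn invfM; ring.
  apply/andP; split; first by apply: mulr_ge0 => //; apply: mulr_ge0 => //; exact: sqr_ge0.
  rewrite /v; apply: ler_wpM2l => //; apply: ler_pM => //; first exact: sqr_ge0.
  by rewrite ler_sqr ?nnegrE ?sV_ge0 ?sV_le ?invr_ge0 ?(ltW (e0 _ kn)).
- move=> k g kn bg.
  have bg' : bmeas (F n k) (fun w => (Num.sqrt n%:R)^-1 * (s n k w)^-1 * g w).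
    apply: (bmeasM (sF n k)) bg; apply: (bmeasM (sF n k)) (bsV kn).
    exact: bmeas_cst.
  rewrite -(X_centered kn bg'); apply: Ex_ae_eq.
  + apply: measurable_funM; first exact: (sub_field_measurable_fun (field n k.+1) (mD kn)).
    exact: (sub_field_measurable_fun (field n k) bg.1).
  + apply: measurable_funM; first exact: (sub_field_measurable_fun (field n k.+1) (mX kn)).
    exact: (sub_field_measurable_fun (field n k) bg'.1).
  + apply: filterS (X_bound kn) => w; rewrite ler_norml => hX.
    by rewrite /D clamp_id //; ring.
- move=> k g kn bg.
  have bg' : bmeas (F n k) (fun w => n%:R^-1 * (s n k w)^-1 ^+ 2 * g w).
    apply: (bmeasM (sF n k)) bg; apply: (bmeasM (sF n k)); first exact: bmeas_cst.
    exact: (bmeasX _ (sF n k) (bsV kn)).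
  have mg : measurable_fun [set: T] g by exact: (sub_field_measurable_fun (field n k) bg.1).
  have mg' := sub_field_measurable_fun (field n k) bg'.1.
  have mXT := sub_field_measurable_fun (field n k.+1) (mX kn).
  transitivity (Ex P (fun w => X n k w ^+ 2 * (n%:R^-1 * (s n k w)^-1 ^+ 2 * g w))).
    apply: Ex_ae_eq.
    + apply: measurable_funM => //; apply: measurable_funX.
      exact: (sub_field_measurable_fun (field n k.+1) (mD kn)).
    + by apply: measurable_funM => //; exact: measurable_funX.
    + apply: filterS (X_bound kn) => w; rewrite ler_norml => hX.
      rewrite /D clamp_id // -[in RHS](@sqr_sqrtr _ n%:R) //.
      by rewrite -[in RHS]exprVn; ring.
  rewrite -(X_variance kn bg'); apply: Ex_ae_eq.
  + apply: measurable_funM => //.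
    exact: (sub_field_measurable_fun (field n k) (mV kn)).
  + apply: measurable_funM => //; exact: (sub_field_measurable_fun (field n k) (mv kn)).
  + by apply: filterS (V_bound kn) => w hV; rewrite /v clamp_id //; ring.
Qed.

Let ae_all n (Q : nat -> T -> Prop) : (forall k, (k < n)%N -> {ae P, forall w, Q k w}) ->
  {ae P, forall w, forall k, (k < n)%N -> Q k w}.
Proof.
move=> hQ; apply/ae_foralln => k; case: (boolP (k < n)%N) => kn.
  by apply: filterS (hQ k kn).
exact: aeW.
Qed.

Let variance_cvg : cvg_in_probability P (fun n w => \sum_(k < n) v n k w) 1.
Proof.
have mVT n k : (k < n)%N -> measurable_fun [set: T] (V n k).
  by move=> kn; exact: (sub_field_measurable_fun (field n k) (mV kn)).
have mhT n k : (k < n)%N -> measurable_fun [set: T] (h n k).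
  by move=> kn; exact: (sub_field_measurable_fun (field n k) (mh kn)).
have mclip n : measurable_fun [set: T] (fun w =>
    n%:R^-1 * \sum_(k < n) ((Num.sqrt (V n k w) <= 2 * e n)%R%:R : R)).
  apply: measurable_funM => //.
  apply: (measurable_sum_lt (f := fun k w => (Num.sqrt (V n k w) <= 2 * e n)%R%:R)) => k kn.
  rewrite (_ : (fun w => _) = \1_[set w | Num.sqrt (V n k w) <= 2 * e n]); last first.
    apply/funext => w; rewrite indicE.
    by case: (boolP (_ <= _)) => hw; [rewrite mem_set|rewrite memNset //; exact/negP].
  apply: measurable_indic.
  have sT : sigma_algebra setT (@measurable d T) by exact: sigma_algebra_measurable.
  apply: (measurable_wrt_le sT (f := fun w => Num.sqrt (V n k w)) (g := fun=> 2 * e n)).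
    apply/measurable_wrt_measurable; apply: (measurableT_comp measurable_sqrt).
    exact: mVT.
  exact: measurable_wrt_cst.
have mest n : measurable_fun [set: T] (fun w =>
    (e n ^+ 2)^-1 * (n%:R^-1 * \sum_(k < n) `|h n k w - V n k w|)).
  apply: measurable_funM => //; apply: measurable_funM => //.
  apply: (measurable_sum_lt (f := fun k w => `|h n k w - V n k w|)) => k kn.
  by apply: measurableT_comp => //; apply: measurable_funB; [exact: mhT|exact: mVT].
have four : (0 : R) < 4 by [].
apply: (@le_cvg_in_probability _ _ _ _ _ _ _ _ _ _
  (cvg_in_probabilityD0 _ mest (cvg_in_probabilityZ0 four clipping) estimation)).
- move=> n; apply: (measurable_sum_lt (f := v n)) => k kn.
  exact: (sub_field_measurable_fun (field n k) (mv kn)).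
- by move=> n; apply: measurable_funD => //; apply: measurable_funM.
- exists 1%N => // n /= n1.
  have nn : n%:R^-1 * n%:R = 1 :> R by rewrite mulVf // pnatr_eq0 -lt0n.
  apply: filterS (ae_all (@V_bound n)) => w hV.
  (* The 1 is spread over the [n] terms, so that [variance_ratio_bound] applies to each; this needs
     [n > 0]. *)
  have -> : \sum_(k < n) v n k w - 1 =
      n%:R^-1 * \sum_(k < n) (V n k w / s n k w ^+ 2 - 1).
    rewrite sumrB sumr_const card_ord mulrBr nn; congr (_ - _).
    rewrite mulr_sumr; apply: eq_bigr => k _.
    by rewrite /v clamp_id ?hV // exprVn; ring.
  rewrite normrM ger0_norm ?invr_ge0 //.
  rewrite [X in _ <= X](_ : _ = n%:R^-1 * \sum_(k < n)
     (4 * (Num.sqrt (V n k w) <= 2 * e n)%R%:R + `|h n k w - V n k w| / e n ^+ 2)); last first.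
    rewrite big_split /= -mulr_sumr -mulr_suml; ring.
  rewrite ler_wpM2l ?invr_ge0 //; apply: (le_trans (ler_norm_sum _ _ _)).
  apply: ler_sum => k _; apply: variance_ratio_bound => //; first exact: e_gt0.
  by case/andP: (hV k (ltn_ord k)).
- by move=> n; apply: measurable_funM.
Qed.

Theorem studentized_clt : cvg_in_distribution P
  (fun n w => (Num.sqrt n%:R)^-1 *
     \sum_(k < n) (Num.max (Num.sqrt (h n k w)) (e n))^-1 * X n k w)
  (normal_prob 0 1).
Proof.
move=> x Qx.
have := martingale_clt array M_rate variance_cvg Qx.
apply: cvg_trans; apply: near_eq_cvg; apply: nearW => n.
have sT : sigma_algebra setT (@measurable d T) by exact: sigma_algebra_measurable.
have mle (f : T -> R) : measurable_fun [set: T] f -> measurable [set w | f w <= x].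
  move=> mf; apply: (measurable_wrt_le sT (g := fun=> x)); first exact/measurable_wrt_measurable.
  exact: measurable_wrt_cst.
have m1 : measurable [set w | \sum_(i < n) D n i w <= x].
  apply: mle; apply: (measurable_sum_lt (f := D n)) => k kn.
  exact: (sub_field_measurable_fun (field n k.+1) (mD kn)).
have m2 : measurable [set w | (Num.sqrt n%:R)^-1 * \sum_(k < n) (s n k w)^-1 * X n k w <= x].
  apply: mle; apply: measurable_funM => //.
  apply: (measurable_sum_lt (f := fun k w => (s n k w)^-1 * X n k w)) => k kn; apply: measurable_funM.
    exact: (sub_field_measurable_fun (field n k) (bsV kn).1).
  exact: (sub_field_measurable_fun (field n k.+1) (mX kn)).
(* Unclamping changes the sum only on a null set, hence not its distribution function. *)
have E : {ae P, forall w, \sum_(i < n) D n i w =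
    (Num.sqrt n%:R)^-1 * \sum_(k < n) (s n k w)^-1 * X n k w}.
  apply: filterS (ae_all (@X_bound n)) => w hX; rewrite mulr_sumr; apply: eq_bigr => k _.
  by rewrite /D clamp_id // -ler_norml hX.
apply/eqP; rewrite eq_le; apply/andP.
split; apply: le_probability_ae => //; by apply: filterS E => w /= ->.
Qed.

End studentized_clt.

(** * Rates and quantiles *)

Lemma cvg_nat_powRN (R : realType) (g : R) : 0 < g ->
  (n%:R : R) `^ (- g) @[n --> \oo] --> 0.
Proof.
move=> g0; apply/cvgrPdist_le => eps eps0.
exists (Num.truncn (eps^-1 `^ g^-1)).+1 => // n /= nN; rewrite sub0r normrN ger0_norm ?powR_ge0 //.
have hn : eps^-1 `^ g^-1 <= n%:R.
  apply: ltW; apply: (lt_le_trans (truncnS_gt _)); by rewrite ler_nat.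
have : eps^-1 <= n%:R `^ g.
  have := ge0_ler_powR (ltW g0) (powR_ge0 _ _ : _ \is Num.nneg) (ler0n R n : _ \is Num.nneg) hn.
  by rewrite -powRrM mulVf ?gt_eqF // powRr1 // invr_ge0 ltW.
rewrite powRN -[X in _ -> _ <= X]invrK; move=> h.
by rewrite lef_pV2 // posrE ?invr_gt0 // (lt_le_trans _ h) // invr_gt0.
Qed.

(** Step [k] of row [n] is round [(n + k).+1], whose past is the history up to round [n + k]. *)
Lemma big_second_half (R : realType) (n : nat) (f : nat -> R) :
  \sum_(n.+1 <= t < (2 * n).+1) f t = \sum_(k < n) f (n + k).+1.
Proof.
rewrite -{1}[n.+1]add0n big_addn subSS mul2n -addnn addnK big_mkord.
by apply: eq_bigr => k _; rewrite addnS addnC.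
Qed.

Section normal_quantile.
Context {R : realType}.

Lemma normal_prob_set1 (x : R) : normal_prob (0 : R) 1 [set x] = 0%E.
Proof. by rewrite /normal_prob integral_set1. Qed.

(** The tails make the infimum finite; points of the set accumulate at it from the right, and
    continuity carries the inequality over. *)
Lemma normal_cdf_quantile (q : R) : 0 < q < 1 ->
  q <= normal_cdf (quantile (normal_prob (0 : R) 1) q).
Proof.
move=> /andP[q0 q1]; set z := quantile _ _.
pose E := [set x : R | q <= normal_cdf x].
have zE : z = inf E.
  by congr inf; apply/seteqP; split => x /=; rewrite normal_cdfE lee_fin.
have hE : has_inf E.
  split.
    have [|m _ [h _]] := @normal_cdf_tails R (1 - q); first by rewrite subr_gt0.
    by exists m; rewrite /E /=; lra.
  have [|m _ [_ h]] := @normal_cdf_tails R (q / 2); first by rewrite divr_gt0.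
  exists (- m) => x; rewrite /E /= => qx; rewrite leNgt; apply/negP => xm.
  have := normal_cdf_nondecreasing (ltW xm); lra.
apply/ler_addgt0Pr => e e0.
have /cvgrPdist_lt/(_ _ e0)[r r0 hr] := @continuous_normal_cdf R z.
have r0' : 0 < r by [].
have [y Ey yz] := inf_adherent (divr_gt0 r0' (@ltr0n R 2)) hE.
have zr : `|normal_cdf z - normal_cdf (z + r / 2)| < e.
  apply: hr; rewrite /= opprD addNKr normrN gtr0_norm ?divr_gt0 //; lra.
have := normal_cdf_nondecreasing (ltW yz); rewrite -zE => yz'.
move: zr Ey; rewrite /E /= ltr_norml => /andP[h1 h2] h3; lra.
Qed.

End normal_quantile.

(** The rejection probabilities converge to one minus [normal_cdf z], and [normal_cdf z] is at least
    [1 - gamma]. *)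
Lemma normal_cvg_level d (T : measurableType d) (R : realType) (P : probability T R)
    (Z : nat -> T -> R) (gamma : R) :
  (forall n, measurable_fun [set: T] (Z n)) ->
  cvg_in_distribution P Z (normal_prob 0 1) -> 0 < gamma < 1 ->
  (limn_esup (fun n => P [set w | (quantile (normal_prob 0 1) (1 - gamma) < Z n w)%R])
     <= gamma%:E)%E.
Proof.
move=> mZ Zcvg g01; set z := quantile _ _.
have Zz : P [set w | (Z n w <= z)%R] @[n --> \oo] --> (normal_cdf z)%:E.
  by rewrite -normal_cdfE; exact: Zcvg (normal_prob_set1 z).
have sT : sigma_algebra setT (@measurable d T) by exact: sigma_algebra_measurable.
have h n : P [set w | (z < Z n w)%R] = (1 - P [set w | (Z n w <= z)%R])%E.
  rewrite -probability_setC; last first.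
    apply: (measurable_wrt_le sT (g := fun=> z)); first exact/measurable_wrt_measurable.
    exact: measurable_wrt_cst.
  by congr (P _); apply/seteqP; split => w /=; rewrite ltNge => /negP.
have hc : P [set w | (z < Z n w)%R] @[n --> \oo] --> (1 - (normal_cdf z)%:E)%E.
  under eq_fun do rewrite h.
  by apply: cvgeB => //; exact: cvg_cst.
have [_ ->] := cvg_limn_einf_sup hc.
rewrite -EFinB lee_fin lerBlDr -lerBlDl.
apply: normal_cdf_quantile; lra.
Qed.

Section rates.
Context {R : realType}.
Variables (c alpha rho rk Bm : R).
Hypotheses (c0 : 0 < c) (alpha0 : 0 <= alpha) (rk0 : 0 <= rk) (Bm0 : 0 <= Bm).

(** The floor decreases in time, so its value at round [2 * n] serves all rounds of row [n]. *)
Definition exploration_floor (n : nat) : R := c * (2 * n)%:R `^ (- alpha).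

Lemma exploration_floor_gt0 n : (0 < n)%N -> 0 < exploration_floor n.
Proof. by move=> n0; rewrite mulr_gt0 // powR_gt0 // ltr0n muln_gt0. Qed.

Lemma exploration_floor_ge0 n : 0 <= exploration_floor n.
Proof. by rewrite mulr_ge0 ?powR_ge0 // ltW. Qed.

Lemma exploration_floor_le n t : (0 < t)%N -> (t <= 2 * n)%N ->
  exploration_floor n <= c * t%:R `^ (- alpha).
Proof.
move=> t0 tn; have n0 : (0 < 2 * n)%N by exact: leq_trans tn.
rewrite /exploration_floor ler_wpM2l ?(ltW c0) // !powRN.
rewrite lef_pV2 ?posrE ?powR_gt0 ?ltr0n //.
by apply: ge0_ler_powR => //; rewrite ?nnegrE ?ler0n // ler_nat.
Qed.

Lemma score_bound_ge0 cc : 0 <= cc -> 0 <= score_bound rk Bm cc.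
Proof.
by move=> h; rewrite /score_bound mulr_ge0 // addr_ge0 // mulr_ge0 ?invr_ge0 // addr_ge0.
Qed.

Lemma score_bound_rate : alpha + rho < 1 / 2 ->
  score_bound rk Bm (exploration_floor n) / (n%:R `^ (- rho) * Num.sqrt n%:R)
    @[n --> \oo] --> 0.
Proof.
move=> ar; pose K := 2 * (c^-1 * 2 `^ alpha * (rk + Bm) + Bm).
have g0 : 0 < 1 / 2 - alpha - rho by lra.
have K0 : (fun n : nat => K * n%:R `^ (- (1 / 2 - alpha - rho))) @ \oo --> (0 : R).
  by rewrite -(mulr0 K); apply: cvgMr; exact: cvg_nat_powRN.
apply: (squeeze_cvgr _ (cvg_cst 0) K0).
exists 1%N => // n /= n1; have n0 : 0 < n%:R :> R by rewrite ltr0n.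
have s0 : 0 <= score_bound rk Bm (exploration_floor n).
  exact: score_bound_ge0 (exploration_floor_ge0 n).
rewrite divr_ge0 // ?mulr_ge0 ?powR_ge0 ?sqrtr_ge0 //=.
have E : n%:R `^ (- (1 / 2 - alpha - rho)) =
    n%:R `^ alpha / (n%:R `^ (- rho) * Num.sqrt n%:R) :> R.
  have nn : n%:R != 0 :> R by rewrite gt_eqF.
  rewrite (_ : - (1 / 2 - alpha - rho) = alpha - (- rho + 2^-1)); last by field.
  by rewrite powRD ?nn ?implybT // powRN powRD ?nn ?implybT // -powR12_sqrt // ltW.
rewrite E mulrA ler_wpM2r ?invr_ge0 ?mulr_ge0 ?powR_ge0 ?sqrtr_ge0 //.
have na1 : 1 <= n%:R `^ alpha :> R.
  by rewrite -[leLHS](powRr0 (n%:R : R)) ler_powR // ler1n.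
rewrite /score_bound /K -!mulrA ler_pM2l // mulrDl; apply: lerD.
  rewrite /exploration_floor invfM powRN invrK natrM powRM // -!mulrA.
  by rewrite [(rk + Bm) * _]mulrC.
by rewrite ler_peMr.
Qed.

Lemma clip_rate nu : rho < nu / 2 ->
  ((n%:R : R) `^ (- rho) ^+ 2)^-1 * n%:R `^ (- nu) @[n --> \oo] --> 0.
Proof.
move=> h; have g0 : 0 < nu - 2 * rho by lra.
apply: cvg_trans (cvg_nat_powRN g0); apply: near_eq_cvg.
exists 1%N => // n /= n1; have nn : n%:R != 0 :> R by rewrite pnatr_eq0 -lt0n.
rewrite (_ : - (nu - 2 * rho) = rho + rho - nu); last by ring.
by rewrite powRD ?nn ?implybT // powRD ?nn ?implybT // (powRN _ rho) exprVn invrK expr2.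
Qed.

(** [alpha + (1 - 3 * alpha) / 4 = (1 + alpha) / 4], below [1 / 2] since [alpha < 1]. *)
Lemma clip_exponent_lt nu : alpha < 1 -> rho < Num.min ((1 - 3 * alpha) / 4) (nu / 2) ->
  alpha + rho < 1 / 2 /\ rho < nu / 2.
Proof. by move=> a1; rewrite lt_min => /andP[h1 h2]; split => //; lra. Qed.

End rates.

Theorem corollary6p1 (R : realType)
  (* probability space, context, action and outcome spaces, RKHS *)
  (d : measure_display) (Omega : measurableType d) (P : probability Omega R)
  (dX : measure_display) (X : measurableType dX) (PX : probability X R)
  (dA : measure_display) (A : measurableType dA) (discreteA : discrete_space A)
  (dY : measure_display) (Y : measurableType dY) (PY : R.-pker (X * A)%type ~> Y)
  (H : hilbertType R) (k : Y -> Y -> R) (ev : H -> Y -> R) (phi : Y -> H)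
  (rkhs : is_rkhs k ev phi) (phi_measurable : strongly_measurable measurable phi)
  (* adaptive data and estimators *)
  (Pol : set (A -> X -> R)) (S : experiment R Omega X A Y H)
  (data : adaptive_data S P PX PY Pol)
  (adapted1 : adapted_nuisance S (nuis1 S))
  (adapted2 : adapted_nuisance S (nuis2 S))
  (a a' : A) (u0 : H) (u0_unit : `|u0| = 1)
  (* (1) ignorability, positivity *)
  (consistency : forall b t, b = a \/ b = a' -> (1 <= t)%N ->
    {ae P, forall w, act S t w = b -> out S t w = pot S t b w})
  (ignorability : forall b t, b = a \/ b = a' -> (1 <= t)%N ->
    cond_indep P (hist_ctx S t) (pot S t b) (act S t))
  (positivity : forall b t, b = a \/ b = a' -> (1 <= t)%N ->
    {ae P, forall w, 0 < pol S t w b (ctx S t w)})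
  (* (2) kernel *)
  (kappa : R) (k_characteristic : characteristic phi)
  (k_bounded : forall y, k y y <= kappa)
  (* (3) nuisance envelope *)
  (Bmu : R)
  (envelope : {ae P, forall w, forall t b x, (1 <= t)%N ->
    `|nuis1 S t.-1 w b x| <= Bmu /\ `|nuis2 S t.-1 w b x| <= Bmu})
  (* (4) nuisance stabilization *)
  (muinf : A -> X -> H)
  (muinf_measurable : forall b, strongly_measurable measurable (muinf b))
  (beta : R) (beta_gt0 : 0 < beta)
  (stabilization : O_as P
    (fun t w => L2norm PX (fun b x => nuis2 S t.-1 w b x - muinf b x))
    (fun t => t%:R `^ (- beta)))
  (* (5) policy class *)
  (pref : A -> X -> R) (pref_policy : is_policy pref)
  (pref_gt0 : forall b x, 0 < pref b x)
  (G : R) (p : R) (p_gt0 : 0 < p)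
  (ratio_bounded : forall g, ref_ratios Pol pref g -> forall b x, `|g b x| <= G)
  (ratio_bracketing : exists K : R, forall eps : R, 0 < eps ->
    (lne (bracketing_number (refnorm PX pref) eps (ref_ratios Pol pref))
       <= (K * eps `^ (- p))%:E)%E)
  (* (6) exploration floor *)
  (cpi : R) (cpi_gt0 : 0 < cpi)
  (alpha : R) (alpha_ge0 : 0 <= alpha) (alpha_lt1 : alpha < 1)
  (alpha_lt : alpha < Num.min (1 / (3 + p)) (Num.min (1 / (1 + 2 * p)) beta))
  (floor : forall t b, (1 <= t)%N ->
    {ae P, forall w, {ae PX, forall x, cpi * t%:R `^ (- alpha) <= pol S t w b x}})
  (* (7) negligible clipping *)
  (nu : R -> R -> R -> R) (nu_gt0 : 0 < nu alpha beta p)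
  (nu_rate : has_rate S phi a a' u0 P (nu alpha beta p))
  (rho : R) (rho_gt0 : 0 < rho)
  (rho_lt : rho < Num.min ((1 - 3 * alpha) / 4) (nu alpha beta p / 2))
  (clipping : cvg_in_probability P
    (fun n w => avg2 n (fun t =>
      (sigma_0 S phi a a' u0 P n t w <= 2 * n%:R `^ (- rho))%R%:R)) 0)
  (* null hypothesis *)
  (H0 : interventional_embedding PX PY phi a = interventional_embedding PX PY phi a') :
  let Tn := statistic S phi a a' u0 (fun n => n%:R `^ (- rho)) in
  cvg_in_distribution P Tn (normal_prob 0 1) /\
  (forall gamma : R, 0 < gamma < 1 ->
    (limn_esup (fun n => P [set w | (quantile (normal_prob 0 1) (1 - gamma) < Tn n w)%R])
       <= gamma%:E)%E).
Proof.
move=> Tn.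
pose rk := Num.sqrt kappa.
have phi_bound : forall y, `|phi y| <= rk := norm_feature_map rkhs k_bounded.
(* [Bmu] comes without a sign, while [score_bound_rate] asks for a nonnegative envelope. *)
pose Bm := `|Bmu|.
have Bm0 : 0 <= Bm by exact: normr_ge0.
have rk0 : 0 <= rk by exact: sqrtr_ge0.
pose cn n := exploration_floor cpi alpha n.
have cn_gt0 n : (0 < n)%N -> 0 < cn n by exact: exploration_floor_gt0.
pose M n := score_bound rk Bm (cn n).
pose e (n : nat) : R := n%:R `^ (- rho).
pose X_ (n j : nat) := xi S phi a a' u0 n (n + j).+1.
pose h_ (n j : nat) := sigma2hat S phi a a' u0 n (n + j).+1.
pose V_ (n j : nat) := sigma2_0 S phi a a' u0 P n (n + j).+1.
pose F_ (n j : nat) := hist S (n + j).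
have n_pos n j : (j < n)%N -> (0 < n)%N by exact: leq_ltn_trans.
have lt_t n j : (n < (n + j).+1)%N by rewrite ltnS leq_addr.
have floor_n n j : (j < n)%N ->
    forall b, {ae P, forall w, cn n <= pol S (n + j).+1 w b (ctx S (n + j).+1 w)}.
  move=> kn b; apply: (floor_at_context data (ltn0Sn _)).
  apply: filterS (floor (n + j).+1 b isT) => w; apply: filterS => x; apply: le_trans.
  apply: (exploration_floor_le cpi_gt0 alpha_ge0 (ltn0Sn _)).
  by rewrite mul2n -addnn -addnS leq_add2l.
have envelope_n n j : {ae P, forall w, forall b x, `|nuis2 S (n + j).+1.-1 w b x| <= Bm}.
  apply: filterS envelope => w env b x; have [_ h] := env (n + j).+1 b x isT.
  exact: (le_trans h (ler_norm Bmu)).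
have mX n j : measurable_wrt (F_ n j.+1) (X_ n j).
  rewrite /F_ addnS.
  exact: (measurable_xi discreteA data phi_measurable adapted1 adapted2 (lt_t n j)).
have mh n j : measurable_wrt (F_ n j) (h_ n j).
  exact: (measurable_sigma2hat discreteA data phi_measurable adapted1 adapted2 (lt_t n j)).
have mV n j : (j < n)%N -> measurable_wrt (F_ n j) (V_ n j).
  move=> kn; exact: (measurable_sigma2_0 discreteA data phi_measurable adapted1 adapted2
    u0_unit (lt_t n j) (cn_gt0 n (n_pos _ _ kn)) phi_bound (envelope_n n j) (floor_n n j kn) H0).
have field n j : sub_sigma_field (F_ n j) by exact: hist_field data (n + j)%N.
have mXT n j : measurable_fun [set: Omega] (X_ n j).
  exact: (sub_field_measurable_fun (field n j.+1) (mX n j)).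
have mhT n j : measurable_fun [set: Omega] (h_ n j).
  exact: (sub_field_measurable_fun (field n j) (mh n j)).
have mVT n j : (j < n)%N -> measurable_fun [set: Omega] (V_ n j).
  by move=> kn; exact: (sub_field_measurable_fun (field n j) (mV n j kn)).
have [rate1 rate2] := clip_exponent_lt alpha_lt1 rho_lt.
have clip_cvg : cvg_in_probability P (fun n w =>
    n%:R^-1 * \sum_(j < n) (Num.sqrt (V_ n j w) <= 2 * e n)%R%:R) 0.
  move: clipping; congr (cvg_in_probability P _ 0).
  by apply/funext => n; apply/funext => w; rewrite /avg2 big_second_half.
have est_cvg : cvg_in_probability P (fun n w =>
    (e n ^+ 2)^-1 * (n%:R^-1 * \sum_(j < n) `|h_ n j w - V_ n j w|)) 0.
  have [_ _ hr] := nu_rate.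
  apply: (O_as_cvg_in_probability (r := fun n : nat => n%:R `^ (- nu alpha beta p))).
  - move=> n; apply: (measurable_funM (measurable_cst _)).
    apply: (measurable_sum_lt (f := fun j w => `|h_ n j w - V_ n j w|)) => j jn.
    by apply: measurableT_comp; last exact: (measurable_funB (mhT n j) (mVT n j jn)).
  - move: hr; congr (O_as P _ _).
    by apply/funext => n; apply/funext => w; rewrite /avg2 big_second_half.
  - exists 1%N; first exact: I.
    by move=> n /= n1; apply: powR_gt0; rewrite ltr0n.
  - exact: clip_rate rate2.
have M_rate : M n / (e n * Num.sqrt n%:R) @[n --> \oo] --> 0 by
  exact: (score_bound_rate cpi_gt0 alpha_ge0 rk0 Bm0 rate1).
have TnE : Tn = (fun n w => (Num.sqrt n%:R)^-1 *
     \sum_(j < n) (Num.max (Num.sqrt (h_ n j w)) (e n))^-1 * X_ n j w).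
  by apply/funext => n; apply/funext => w; rewrite /Tn /statistic big_second_half.
have clt : cvg_in_distribution P Tn (normal_prob 0 1).
  rewrite TnE; apply: (studentized_clt (F := F_) (V := V_) (M := M)).
  - exact: field.
  - by move=> n j; rewrite /F_ addnS; exact: hist_le.
  - by move=> n j _; exact: mX.
  - by move=> n j _; exact: mh.
  - exact: mV.
  - by move=> n n0; apply: powR_gt0; rewrite ltr0n.
  - by move=> n j w; rewrite /h_ /sigma2hat le_max lexx orbT.
  - by move=> n; exact: (score_bound_ge0 rk0 Bm0 (exploration_floor_ge0 alpha cpi_gt0 n)).
  - move=> n j kn; exact: (xi_bound a a' u0_unit n (cn_gt0 n (n_pos _ _ kn)) phi_bound
      (envelope_n n j) (floor_n n j kn)).
  - move=> n j kn; exact: (sigma2_0_bound discreteA data phi_measurable adapted1 adapted2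
      u0_unit (lt_t n j) (cn_gt0 n (n_pos _ _ kn)) phi_bound (envelope_n n j) (floor_n n j kn) H0).
  - move=> n j g kn bg; exact: (xi_centered discreteA data phi_measurable adapted1 adapted2
      u0_unit (lt_t n j) (cn_gt0 n (n_pos _ _ kn)) phi_bound (envelope_n n j) (floor_n n j kn) H0 bg).
  - move=> n j g kn bg; exact: (Ex_sigma2_0 discreteA data phi_measurable adapted1 adapted2
      u0_unit (lt_t n j) (cn_gt0 n (n_pos _ _ kn)) phi_bound (envelope_n n j) (floor_n n j kn) H0 bg).
  - exact: M_rate.
  - exact: clip_cvg.
  - exact: est_cvg.
split; first exact: clt.
move=> gamma; apply: normal_cvg_level clt => n.
rewrite TnE; apply: (measurable_funM (measurable_cst _)); apply: measurable_sum => j.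
apply: measurable_funM; last exact: mXT.
apply: (measurableT_comp (measurable_invr (R := R))).
apply: measurable_maxr; last exact: measurable_cst.
exact: (measurableT_comp measurable_sqrt (mhT n j)).
Qed.
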